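(* Let $\theta$ be a non-constant inner function and let $X$ be a bounded linear operator on $L^2(\mathbb{T})$. Then there exist $\varphi,\psi,\chi\in L^\infty(\mathbb{T})$ such that $X=M_\varphi P_{\theta H^2}+M_\psi P_{\mathcal{K}_\theta}+M_\chi P_{-}$ if and only if there exists $w\in L^\infty(\mathbb{T})$ with $$X=M_z^*XM_zP_{+}+M_zXM_z^*P_{-}-\bigl(w\otimes\widetilde{k}_0^\theta\bigr)P_{\mathcal{K}_\theta}.$$ When these hold, the symbols are recovered by $$\chi=zX(\bar z),\qquad \varphi=\overline{\theta}\,X(\theta),\qquad \psi=\varphi-z\overline{\theta}\,w.$$
   Context: $\mathbb{T}$ is the unit circle with normalized Lebesgue measure; $H^2\subset L^2(\mathbb{T})$ is the Hardy space (functions with vanishing negative Fourier coefficients), and $H^2_-=L^2(\mathbb{T})\ominus H^2$. $P_+$ and $P_-=I-P_+$ are the orthogonal projections of $L^2(\mathbb{T})$ onto $H^2$ and $H^2_-$. An inner function $\theta$ is a bounded analytic function on the unit disk with $|\theta|=1$ a.e. on $\mathbb{T}$. The model space is $\mathcal{K}_\theta=H^2\ominus\theta H^2$, so $L^2(\mathbb{T})=\theta H^2\oplus\mathcal{K}_\theta\oplus H^2_-$; $P_{\theta H^2}$, $P_{\mathcal{K}_\theta}$ are the orthogonal projections of $L^2(\mathbb{T})$ onto $\theta H^2$ and $\mathcal{K}_\theta$. All projections are viewed as operators on $L^2(\mathbb{T})$. $\widetilde{k}_0^\theta\in\mathcal{K}_\theta$ is the function $\widetilde{k}_0^\theta(z)=\frac{\theta(z)-\theta(0)}{z}$.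 For $\varphi\in L^\infty(\mathbb{T})$, $M_\varphi f=\varphi f$ on $L^2(\mathbb{T})$; $M_z$ is multiplication by the coordinate function $z$. $(p\otimes q)f=\langle f,q\rangle p$ (inner product linear in the first variable). *)

(* Defs.v *)
From HB Require Import structures.
From mathcomp Require Import all_boot all_order all_algebra.
From mathcomp Require Import generic_quotient ring_quotient ring.
From mathcomp Require Import complex.
From mathcomp Require Import all_classical all_reals all_analysis.
From mathcomp Require Import measurable_realfun.

Set Implicit Arguments.
Unset Strict Implicit.
Unset Printing Implicit Defensive.
Import Order.TTheory GRing.Theory Num.Theory.
Import numFieldNormedType.Exports ComplexField.Normc.

Local Open Scope classical_set_scope.
Local Open Scope quotient_scope.
Local Open Scope complex_scope.
Local Open Scope ring_scope.

Lemma ltr0_2pi (R : realType) : 0 < 2 * pi :> R.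
Proof. by rewrite mulr_gt0 ?pi_gt0. Qed.

(* The unit circle is parametrized by the angle: a function f on the circle is
   represented by t |-> f (e^(it)), and normalized Lebesgue measure by the
   uniform probability on [0, 2 pi]. *)
Notation circle_measure R := (uniform_prob (ltr0_2pi R)).

Definition cis (R : realType) (t : R) : R[i] := cos t +i* sin t.

Section complex_parts.
Variable R : realType.
Implicit Types x y : R[i].

Lemma complex_ReB x y : complex.Re (x - y) = complex.Re x - complex.Re y.
Proof. by case: x y => ? ? []. Qed.

Lemma complex_ImB x y : complex.Im (x - y) = complex.Im x - complex.Im y.
Proof. by case: x y => ? ? []. Qed.

Lemma complex_ReM x y : complex.Re (x * y) =
  complex.Re x * complex.Re y - complex.Im x * complex.Im y.
Proof. by case: x y => ? ? []. Qed.

Lemma complex_ImM x y : complex.Im (x * y) =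
  complex.Re x * complex.Im y + complex.Im x * complex.Re y.
Proof. by case: x y => ? ? []. Qed.

Lemma complex_ReC x : complex.Re x^* = complex.Re x.
Proof. by case: x. Qed.

Lemma complex_ImC x : complex.Im x^* = - complex.Im x.
Proof. by case: x. Qed.

Lemma normc_sqr x : normc x ^+ 2 = complex.Re x ^+ 2 + complex.Im x ^+ 2.
Proof. by case: x => a b; rewrite sqr_sqrtr// addr_ge0 ?sqr_ge0. Qed.

End complex_parts.

Section measurable_functions.
Variable R : realType.
Local Notation C := R[i].
Local Notation mu := (circle_measure R).

Lemma ae_imp2 (P Q S : R -> Prop) : (forall t, P t -> Q t -> S t) ->
  {ae mu, forall t, P t} -> {ae mu, forall t, Q t} -> {ae mu, forall t, S t}.
Proof.
move=> PQS P_ Q_; have F := ae_filter_ringOfSetsType mu.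
by apply: filterS2 PQS P_ Q_.
Qed.

Definition cmeas : {pred R -> C} := fun f =>
  `[< measurable_fun setT (fun t => complex.Re (f t)) /\
      measurable_fun setT (fun t => complex.Im (f t)) >].

Lemma cmeasP (f : R -> C) :
  reflect (measurable_fun setT (fun t => complex.Re (f t)) /\
           measurable_fun setT (fun t => complex.Im (f t))) (f \in cmeas).
Proof. exact: asboolP. Qed.

Lemma cmeas_cst (c : C) : cst c \in cmeas.
Proof. by apply/cmeasP; split; exact: measurable_cst. Qed.

Lemma cmeas_subring : subring_closed cmeas.
Proof.
split=> [|f g /cmeasP[rf jf] /cmeasP[rg jg]|f g /cmeasP[rf jf] /cmeasP[rg jg]].
- exact: cmeas_cst.
- apply/cmeasP; split.
  + by under eq_fun do rewrite complex_ReB; exact: measurable_funB.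
  + by under eq_fun do rewrite complex_ImB; exact: measurable_funB.
- apply/cmeasP; split.
  + under eq_fun do rewrite complex_ReM.
    by apply: measurable_funB; exact: measurable_funM.
  + under eq_fun do rewrite complex_ImM.
    by apply: measurable_funD; exact: measurable_funM.
Qed.

HB.instance Definition _ := GRing.isSubringClosed.Build (R -> C) cmeas
  cmeas_subring.

Record cmfun := CMFun { cmfun_fun :> R -> C ; _ : cmfun_fun \in cmeas }.
HB.instance Definition _ := [isSub for cmfun_fun].
HB.instance Definition _ := [Choice of cmfun by <:].
HB.instance Definition _ := [SubChoice_isSubComNzRing of cmfun by <:].

Lemma cmeas_fun (f : cmfun) : (f : R -> C) \in cmeas.
Proof. exact: valP. Qed.

Lemma cmeas_conj (f : cmfun) : (fun t => (f t)^*) \in cmeas.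
Proof.
have /cmeasP[rf jf] := cmeas_fun f; apply/cmeasP; split.
- by under eq_fun do rewrite complex_ReC.
- by under eq_fun do rewrite complex_ImC; exact: measurableT_comp.
Qed.

Definition cmconj (f : cmfun) := CMFun (cmeas_conj f).
Definition cmcst (c : C) := CMFun (cmeas_cst c).

Lemma cmeas_cis (k : int) : (fun t => cis (k%:~R * t)) \in cmeas.
Proof.
apply/cmeasP; split=> /=.
- apply: (measurableT_comp (f := @cos R)).
    by apply: continuous_measurable_fun; exact: continuous_cos.
  exact: measurable_funM.
- apply: (measurableT_comp (f := @sin R)).
    by apply: continuous_measurable_fun; exact: continuous_sin.
  exact: measurable_funM.
Qed.

Definition cmcis (k : int) := CMFun (cmeas_cis k).

Definition ae_null : {pred cmfun} := fun f =>
  `[< {ae mu, forall t, f t = 0} >].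

Lemma ae_nullP (f : cmfun) :
  reflect {ae mu, forall t, f t = 0} (f \in ae_null).
Proof. exact: asboolP. Qed.

Lemma ae_null_idealr : idealr_closed ae_null.
Proof.
split.
- by apply/ae_nullP; exact: aeW.
- apply/negP => /ae_nullP[A [mA A0 sA]].
  have AT : A = setT.
    by apply/seteqP; split => // t _; apply: sA => /=; apply/eqP/oner_neq0.
  by move: A0; rewrite AT probability_setT => /eqP; rewrite eqe oner_eq0.
- move=> a f g /ae_nullP f0 /ae_nullP g0; apply/ae_nullP.
  apply: ae_imp2 f0 g0 => t f0 g0.
  by rewrite [LHS](_ : _ = a t * f t + g t)// f0 g0 mulr0 addr0.
Qed.

HB.instance Definition _ := isIdealr.Build cmfun ae_null ae_null_idealr.

Definition L0 : Type := {ideal_quot ae_null}.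
HB.instance Definition _ := GRing.ComNzRing.on L0.
HB.instance Definition _ := EqQuotient.on L0.

Definition cls (f : cmfun) : L0 := \pi_({ideal_quot ae_null}) f.
Definition L0_repr (f : L0) : cmfun := repr f.
Coercion L0_repr : L0 >-> cmfun.

End measurable_functions.

Section L0_theory.
Variable R : realType.
Local Notation C := R[i].
Local Notation mu := (circle_measure R).
Implicit Types (f g : L0 R) (c : C).

Lemma clsD (u v : cmfun R) : cls (u + v) = cls u + cls v.
Proof. exact: (rmorphD \pi_({ideal_quot (@ae_null R)})). Qed.

Lemma clsM (u v : cmfun R) : cls (u * v) = cls u * cls v.
Proof. exact: (rmorphM \pi_({ideal_quot (@ae_null R)})). Qed.

Lemma cls1 : cls 1 = 1 :> L0 R.
Proof. exact: (rmorph1 \pi_({ideal_quot (@ae_null R)})). Qed.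

Lemma L0_reprK f : cls f = f.
Proof. exact: reprK. Qed.

Lemma clsP (u v : cmfun R) : cls u = cls v <-> {ae mu, forall t, u t = v t}.
Proof.
have -> : (cls u = cls v) <-> (u - v \in @ae_null R).
  by rewrite Quotient.idealrBE; split => [/eqP|/eqP].
have FF := ae_filter_ringOfSetsType mu.
split=> [/ae_nullP uv|uv].
  apply: filterS uv => t uv; apply/eqP; rewrite -subr_eq0; exact/eqP.
apply/ae_nullP; apply: filterS uv => t uv.
by rewrite [LHS](_ : _ = u t - v t)// uv subrr.
Qed.

Lemma cls_repr (u : cmfun R) : {ae mu, forall t, cls u t = u t}.
Proof. by apply/clsP; exact: L0_reprK. Qed.

Lemma L0_reprD f g : {ae mu, forall t, (f + g : L0 R) t = f t + g t}.
Proof.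
have := cls_repr ((f : cmfun R) + (g : cmfun R)).
by rewrite clsD !L0_reprK.
Qed.

Lemma L0_reprM f g : {ae mu, forall t, (f * g : L0 R) t = f t * g t}.
Proof.
have := cls_repr ((f : cmfun R) * (g : cmfun R)).
by rewrite clsM !L0_reprK.
Qed.

Definition L0_scale c f : L0 R := cls (cmcst c) * f.

Lemma L0_scaleA a b f : L0_scale a (L0_scale b f) = L0_scale (a * b) f.
Proof. by rewrite /L0_scale mulrA -clsM; congr (cls _ * _); exact: val_inj. Qed.

Lemma L0_scale1 : left_id 1 L0_scale.
Proof.
move=> f; rewrite /L0_scale (_ : cmcst 1 = 1) ?cls1 ?mul1r//.
exact: val_inj.
Qed.

Lemma L0_scaleDr : right_distributive L0_scale +%R.
Proof. by move=> c f g; rewrite /L0_scale mulrDr. Qed.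

Lemma L0_scaleDl f : {morph L0_scale^~ f : a b / a + b}.
Proof.
move=> a b; rewrite /L0_scale -mulrDl -clsD; congr (cls _ * _).
exact: val_inj.
Qed.

HB.instance Definition _ := GRing.Zmodule_isLmodule.Build C (L0 R)
  L0_scaleA L0_scale1 L0_scaleDr L0_scaleDl.

Lemma L0_scaleAl c f g : c *: (f * g) = c *: f * g.
Proof. exact: mulrA. Qed.

HB.instance Definition _ := GRing.Lmodule_isLalgebra.Build C (L0 R) L0_scaleAl.

Lemma L0_scaleAr c f g : c *: (f * g) = f * (c *: g).
Proof. exact: mulrCA. Qed.

HB.instance Definition _ := GRing.Lalgebra_isAlgebra.Build C (L0 R) L0_scaleAr.

Lemma L0_reprZ c f : {ae mu, forall t, (c *: f : L0 R) t = c * f t}.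
Proof.
have := L0_reprM (cls (cmcst c)) f; apply: ae_imp2 (cls_repr (cmcst c)) => t.
by move=> /= -> ->.
Qed.

Definition L0_conj f : L0 R := cls (cmconj f).

Definition zexp0 (k : int) : L0 R := cls (cmcis R k).

Definition inL2 : {pred L0 R} := fun f =>
  `[< (\int[mu]_t (normc (f t) ^+ 2)%:E < +oo)%E >].

Definition inLinf : {pred L0 R} := fun f =>
  `[< exists M : R, {ae mu, forall t, normc (f t) <= M} >].

Lemma inL2P f :
  reflect (\int[mu]_t (normc (f t) ^+ 2)%:E < +oo)%E (f \in inL2).
Proof. exact: asboolP. Qed.

Lemma inLinfP f : reflect (exists M : R, {ae mu, forall t, normc (f t) <= M})
  (f \in inLinf).
Proof. exact: asboolP. Qed.

Lemma measurable_normc_sqr (u : cmfun R) :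
  measurable_fun setT (fun t => (normc (u t) ^+ 2)%:E).
Proof.
have /cmeasP[ru iu] := cmeas_fun u; apply: measurableT_comp => //.
under eq_fun do rewrite normc_sqr.
by apply: measurable_funD; exact: measurable_funX.
Qed.

Lemma normc_ge0 (x : C) : 0 <= normc x.
Proof. by case: x => a b; exact: sqrtr_ge0. Qed.

Lemma normcD_le (x y : C) : normc (x + y) <= normc x + normc y.
Proof. by have := ler_normD x y; rewrite -rmorphD lecR. Qed.

Lemma inL2_dominated (a b : R) f g (h : L0 R) : 0 <= a -> 0 <= b ->
    f \in inL2 -> g \in inL2 ->
    {ae mu, forall t,
      normc (h t) ^+ 2 <= a * normc (f t) ^+ 2 + b * normc (g t) ^+ 2} ->
  h \in inL2.
Proof.
move=> a0 b0 /inL2P f2 /inL2P g2 hle; apply/inL2P.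
have nn u : (forall t, setT t -> 0 <= (normc (u t) ^+ 2)%:E)%E.
  by move=> t _; rewrite lee_fin sqr_ge0.
have m u (k : R) :
    measurable_fun setT (fun t => k%:E * (normc ((u : cmfun R) t) ^+ 2)%:E)%E.
  by apply: emeasurable_funM => //; exact: measurable_normc_sqr.
apply: (@le_lt_trans _ _ (\int[mu]_t
    (a%:E * (normc (f t) ^+ 2)%:E + b%:E * (normc (g t) ^+ 2)%:E))%E).
  apply: ae_ge0_le_integral => //.
  - exact: nn.
  - exact: measurable_normc_sqr.
  - by move=> t _; rewrite adde_ge0// mule_ge0// lee_fin sqr_ge0.
  - by apply: emeasurable_funD; exact: m.
  - have FF := ae_filter_ringOfSetsType mu.
    by apply: filterS hle => t hle _; rewrite -!EFinM -EFinD lee_fin.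
rewrite ge0_integralD//; [|by move=> t _; rewrite mule_ge0// lee_fin sqr_ge0
  |exact: m|by move=> t _; rewrite mule_ge0// lee_fin sqr_ge0|exact: m].
rewrite !ge0_integralZl_EFin//; try exact: nn; try exact: measurable_normc_sqr.
by rewrite lte_add_pinfty// lte_mul_pinfty.
Qed.

Lemma inLinf_subalg : subalg_closed inLinf.
Proof.
split.
- apply/inLinfP; exists 1; rewrite -cls1.
  have FF := ae_filter_ringOfSetsType mu.
  by apply: filterS (cls_repr 1) => t ->; rewrite [normc _]normc1.
- move=> a f g /inLinfP[M fM] /inLinfP[N gN]; apply/inLinfP.
  exists (normc a * M + N).
  apply: ae_imp2 (L0_reprD (a *: f) g) _ => [t -> h|]; first exact: h.
  apply: ae_imp2 (L0_reprZ a f) _ => [t -> h|]; first exact: h.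
  apply: ae_imp2 fM gN => t fM gN.
  rewrite (le_trans (normcD_le _ _))// lerD// normcM ler_wpM2l//.
  exact: normc_ge0.
- move=> f g /inLinfP[M fM] /inLinfP[N gN]; apply/inLinfP.
  exists (M * N).
  apply: ae_imp2 (L0_reprM f g) _ => [t -> h|]; first exact: h.
  apply: ae_imp2 fM gN => t fM gN.
  by rewrite normcM ler_pM// normc_ge0.
Qed.

HB.instance Definition _ := GRing.isSubalgClosed.Build C (L0 R) inLinf
  inLinf_subalg.

Lemma inL2_mulLinf f g : f \in inLinf -> g \in inL2 -> f * g \in inL2.
Proof.
move=> /inLinfP[M fM] g2; apply: (@inL2_dominated (M ^+ 2) 0 g g) => //.
  exact: sqr_ge0.
apply: ae_imp2 (L0_reprM f g) _ => [t -> h|]; first exact: h.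
have FF := ae_filter_ringOfSetsType mu.
apply: filterS fM => t fM; rewrite mul0r addr0 normcM exprMn.
by rewrite ler_wpM2r ?sqr_ge0// lerXn2r// nnegrE ?normc_ge0//
  (le_trans _ fM)// normc_ge0.
Qed.

Lemma inL2_1 : 1 \in inL2.
Proof.
apply/inL2P; rewrite (@ae_eq_integral _ _ _ _ setT (cst 1%E))//.
- by rewrite integral_cst// mul1e (le_lt_trans (probability_le1 mu measurableT))// ltry.
- exact: measurable_normc_sqr.
- have FF := ae_filter_ringOfSetsType mu.
  rewrite -cls1; apply: filterS (cls_repr 1) => t -> _.
  by rewrite [normc _]normc1 expr1n.
Qed.

Lemma inLinf_inL2 f : f \in inLinf -> f \in inL2.
Proof. by move=> fi; rewrite -[f]mulr1 inL2_mulLinf// inL2_1. Qed.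

Lemma inL2_submod : submod_closed inL2.
Proof.
split; first by apply: inLinf_inL2; exact: rpred0.
move=> a f g f2 g2.
apply: (@inL2_dominated (2 * normc a ^+ 2) 2 f g) => //.
  by rewrite mulr_ge0// sqr_ge0.
apply: ae_imp2 (L0_reprD (a *: f) g) _ => [t -> h|]; first exact: h.
have FF := ae_filter_ringOfSetsType mu.
apply: filterS (L0_reprZ a f) => t ->.
rewrite -mulrA -exprMn -normcM -mulrDr.
move: (a * (f : L0 R) t) ((g : L0 R) t) => x y.
apply: (@le_trans _ _ ((normc x + normc y) ^+ 2)).
  by rewrite lerXn2r ?nnegrE ?addr_ge0 ?normc_ge0// normcD_le.
rewrite -subr_ge0 (_ : _ - _ = (normc x - normc y) ^+ 2) ?sqr_ge0//.
by ring.
Qed.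

HB.instance Definition _ := GRing.isSubmodClosed.Build C (L0 R) inL2
  inL2_submod.

Lemma inLinf_conj f : f \in inLinf -> L0_conj f \in inLinf.
Proof.
move=> /inLinfP[M fM]; apply/inLinfP; exists M.
apply: ae_imp2 (cls_repr (cmconj f)) fM => t -> /=.
by case: (f t) => a b /=; rewrite sqrrN.
Qed.

Lemma inLinf_zexp k : zexp0 k \in inLinf.
Proof.
apply/inLinfP; exists 1; have FF := ae_filter_ringOfSetsType mu.
apply: filterS (cls_repr (cmcis R k)) => t -> /=.
by rewrite cos2Dsin2 sqrtr1.
Qed.

Record L2 := MkL2 { L2_val :> L0 R ; _ : L2_val \in inL2 }.
HB.instance Definition _ := [isSub for L2_val].
HB.instance Definition _ := [Choice of L2 by <:].
HB.instance Definition _ := [SubChoice_isSubLmodule of L2 by <:].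

Record Linf := MkLinf { Linf_val :> L0 R ; _ : Linf_val \in inLinf }.
HB.instance Definition _ := [isSub for Linf_val].
HB.instance Definition _ := [Choice of Linf by <:].
HB.instance Definition _ := [SubChoice_isSubComNzRing of Linf by <:].
HB.instance Definition _ := [SubZmodule_isSubLmodule of Linf by <:].
HB.instance Definition _ := [SubNzRing_SubLmodule_isSubLalgebra of Linf by <:].
HB.instance Definition _ := [SubLalgebra_isSubAlgebra of Linf by <:].

Lemma Linf_inL2 (phi : Linf) : (phi : L0 R) \in inL2.
Proof. exact/inLinf_inL2/valP. Qed.

Lemma Linf_mul_inL2 (phi : Linf) (f : L2) : (phi : L0 R) * (f : L0 R) \in inL2.
Proof. by apply: inL2_mulLinf; exact: valP. Qed.

Definition Linf_L2 (phi : Linf) : L2 := MkL2 (Linf_inL2 phi).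

Definition Linf_conj (phi : Linf) : Linf := MkLinf (inLinf_conj (valP phi)).

(* The class of $\zeta \mapsto \zeta^k$. *)
Definition zexp (k : int) : Linf := MkLinf (inLinf_zexp k).

End L0_theory.

Section hilbert.
Variable R : realType.
Local Notation C := R[i].
Local Notation mu := (circle_measure R).
Implicit Types (f g h : L2 R) (M N : set (L2 R)) (T : L2 R -> L2 R).

Definition cint (u : R -> C) : C :=
  (\int[mu]_t complex.Re (u t)) +i* (\int[mu]_t complex.Im (u t)).

Definition inprod f g : C := cint (fun t => f t * (g t)^*).

Definition L2norm f : R := Num.sqrt (\int[mu]_t (normc (f t) ^+ 2)).

Definition bounded_op T := exists B : R, forall f, L2norm (T f) <= B * L2norm f.

Definition ortho_diff M N : set (L2 R) :=
  [set f | M f /\ forall g, N g -> inprod f g = 0].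

(* The orthogonal projection of f onto M is the element g of M such that f - g
   is orthogonal to M; it exists for all f when M is a closed subspace. *)
Definition orth_proj M f : L2 R :=
  xget 0 [set g | M g /\ forall h, M h -> inprod (f - g) h = 0].

Definition adjoint T g : L2 R :=
  xget 0 [set h | forall f, inprod (T f) g = inprod f h].

Definition tensor (p q : L2 R) f : L2 R := inprod f q *: p.

Definition mulop (phi : Linf R) f : L2 R := MkL2 (Linf_mul_inL2 phi f).

End hilbert.

Section hardy.
Variable R : realType.
Local Notation C := R[i].
Local Notation mu := (circle_measure R).

Definition fourier (f : L2 R) (n : int) : C := inprod f (Linf_L2 (zexp R n)).

Definition H2 : set (L2 R) := [set f | forall n : int, n < 0 -> fourier f n = 0].

Definition Pplus (f : L2 R) : L2 R := orth_proj H2 f.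

Definition Pminus (f : L2 R) : L2 R := f - Pplus f.

Definition analytic_at (F : C -> C) (z0 : C) :=
  exists (a : nat -> C) (r : R), 0 < r /\ forall z, normc (z - z0) < r ->
    series (fun n => a n * (z - z0) ^+ n : C^o) @ \oo --> (F z : C^o).

(* An inner function is kept together with its boundary values, the radial
   limits, which exist a.e. by Fatou's theorem and are determined a.e. by the
   function on the disk. *)
Record inner_function := InnerFunction {
  inner_disk :> C -> C ;
  inner_bdry : Linf R ;
  inner_analytic : forall z, normc z < 1 -> analytic_at inner_disk z ;
  inner_bounded : exists B : R, forall z, normc z < 1 ->
    normc (inner_disk z) <= B ;
  inner_radial : {ae mu, forall t,
    (inner_disk (r%:C * cis t) : C^o) @[r --> (1 : R)^'-] -->
      (inner_bdry t : C^o)} ;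
  inner_unimodular : {ae mu, forall t, normc (inner_bdry t) = 1}
}.

Definition nonconstant (theta : inner_function) :=
  ~ exists c : C, forall z, normc z < 1 -> theta z = c.

Variable theta : inner_function.

Definition thetaH2 : set (L2 R) := [set mulop (inner_bdry theta) h | h in H2].

Definition model_space : set (L2 R) := ortho_diff H2 thetaH2.

(* On the circle, division by z is multiplication by its conjugate. *)
Definition k0tilde : L2 R :=
  Linf_L2 (Linf_conj (zexp R 1) * (inner_bdry theta - (theta 0)%:A)).

End hardy.

(* Main.v *)
Require Import Defs.
From HB Require Import structures.
From mathcomp Require Import all_boot all_order all_algebra.
From mathcomp Require Import complex ring lra zify.
From mathcomp Require Import all_classical all_reals all_analysis.
From mathcomp Require Import measurable_realfun.

Set Implicit Arguments.
Unset Strict Implicit.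
Unset Printing Implicit Defensive.
Import Order.TTheory GRing.Theory Num.Theory.
Import numFieldNormedType.Exports ComplexField.Normc.

Local Open Scope classical_set_scope.
Local Open Scope complex_scope.
Local Open Scope ring_scope.

(** An operator that multiplies by three bounded functions on [theta H2],
    [K_theta] and [H2-] almost commutes with [M_z]. On [theta H2], invariant
    under [M_z], and on [H2-], invariant under its adjoint, it commutes exactly.
    On [K_theta], [z k - <k, k0> theta] is again in [K_theta]
    ([model_space_shift]); hence the commutator is of rank one and carries the
    jump from [psi] to [phi] along [theta], namely
    [w = (phi - psi) * conj z * theta] ([symbols_defect]). Everything is first
    reduced to the three blocks ([blocksP], [blockwise_symbolsP],
    [blockwise_defectP]).

    Conversely, commutation with the shift propagates the values of [X] at
    [conj z] and at [theta] along the powers of [z], so that on [H2-] and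
    [theta H2] the operator multiplies by [chi = z X(conj z)] and
    [phi = conj theta X(theta)]. That these functions are bounded, and not only
    square-integrable, is [bounded_symbol]: high powers of [z] move any
    trigonometric polynomial [p] into the range where the formula is known, so
    that [chi p] is bounded in norm by a constant times [p]; approximating
    indicators of arcs by squares of such [p] gives the bound on [|chi|]
    ([bounded_multiplier]). On [K_theta] put [psi = phi - z conj(theta) w] and
    [D = X - M_psi]. The defect equation says that [D] turns the compressed
    shift of [K_theta] into [M_z], which preserves norms; but the iterates of
    the compressed shift tend to [0], because up to the unimodular factor
    [conj theta] they are the projections to [H2-] of [z ^ n] times a fixed
    function ([compressed_shift_iter], [Pminus_shift_cvg0]). Hence [D = 0] on
    [K_theta] ([model_symbol]).

    The symbols are read off at [conj z] and [theta] ([symbols_values]). The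
    formula for [psi] amounts to the uniqueness of [w], which holds because
    some vector of [K_theta] is not orthogonal to [k0]
    ([model_space_k0_nonorthogonal]).

    Two facts of analysis support this. Uniqueness of Fourier coefficients
    ([fourier_uniqueness]) gives the density of polynomials; it follows from
    the same arc polynomials, which detect the sign of an integrable function
    ([arc_positivity]). And the boundary function of [theta] has to lie in
    [H2] and to be non-constant ([inner_bdry_H2], [inner_bdry_nonconstant]).
    For this, the mean of [z ^ k * theta z] over a circle is shown not to
    depend on the radius. Instead of contour integrals, the Cauchy-Riemann
    equations are used in integrated form: to second order, a radial increment
    of an analytic function is a multiple of an angular increment, whose mean
    over the circle vanishes ([log_mean_quad]). *)

(** * Integration of complex functions on the circle *)

Section complex_integral.
Variable R : realType.
Local Notation C := R[i].
Local Notation mu := (circle_measure R).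
Implicit Types (u v : R -> C) (f g : R -> R).

Lemma ae_imp (P Q : R -> Prop) : (forall t, P t -> Q t) ->
  {ae mu, forall t, P t} -> {ae mu, forall t, Q t}.
Proof.
by move=> PQ; have F := ae_filter_ringOfSetsType mu; apply: filterS.
Qed.

Definition integr (f : R -> R) := mu.-integrable setT (EFin \o f).

Lemma integrD f g : integr f -> integr g -> integr (fun t => f t + g t).
Proof. by move=> fi gi; apply: eq_integrable (integrableD _ fi gi). Qed.

Lemma integrZ (k : R) f : integr f -> integr (fun t => k * f t).
Proof. by move=> fi; apply: eq_integrable (integrableZl _ k fi). Qed.

Lemma integrB f g : integr f -> integr g -> integr (fun t => f t - g t).
Proof. by move=> fi gi; apply: eq_integrable (integrableB _ fi gi). Qed.

Lemma integrN f : integr f -> integr (fun t => - f t).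
Proof. by move=> fi; apply: eq_integrable (integrableN fi). Qed.

Lemma integr_le f g : measurable_fun setT f -> (forall t, `|f t| <= g t) ->
  integr g -> integr f.
Proof.
move=> mf fg; apply: le_integrable => //; first exact/measurable_EFinP.
by move=> t _; rewrite !abse_EFin lee_fin (le_trans (fg t))// ler_norm.
Qed.

Lemma ae_eq_Rint (f g : R -> R) : measurable_fun setT f ->
  measurable_fun setT g -> {ae mu, forall t, f t = g t} ->
  \int[mu]_t f t = \int[mu]_t g t.
Proof.
move=> mf mg fg; rewrite /Rintegral; congr fine; apply: ae_eq_integral => //.
- exact/measurable_EFinP.
- exact/measurable_EFinP.
- by apply: ae_imp fg => t -> _.
Qed.

(** The comparison theorem for integrals asks for a pointwise inequality; it is
    applied to the minimum of the two functions. *)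
Lemma ae_le_Rint (f g : R -> R) : integr f -> integr g ->
  {ae mu, forall t, f t <= g t} -> \int[mu]_t f t <= \int[mu]_t g t.
Proof.
move=> fi gi fg.
have mf := (measurable_EFinP _ _).1 (measurable_int _ fi).
have mg := (measurable_EFinP _ _).1 (measurable_int _ gi).
have mi : integr (fun t => Num.min (f t) (g t)).
  apply: (@integr_le _ (fun t => `|f t| + `|g t|)).
  - exact: measurable_minr.
  - move=> t; rewrite /Num.min; case: ifP => _; first by rewrite lerDl.
    by rewrite lerDr.
  - by apply: integrD; apply: integrable_norm.
rewrite (@ae_eq_Rint f (fun t => Num.min (f t) (g t))) //.
- by apply: le_Rintegral => // t _; rewrite ge_min lexx orbT.
- exact: (measurable_EFinP _ _).1 (measurable_int _ mi).
- by apply: ae_imp fg => t /min_idPl ->.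
Qed.

Definition cintegr u := integr (fun t => complex.Re (u t)) /\
  integr (fun t => complex.Im (u t)).

Lemma cintD u v : cintegr u -> cintegr v ->
  cint (fun t => u t + v t) = cint u + cint v.
Proof.
move=> [ru iu] [rv iv]; rewrite /cint -[RHS]/(_ +i* _); congr (_ +i* _).
- rewrite -RintegralD//; apply: eq_Rintegral => t _; by case: (u t) (v t) => ? ? [].
- rewrite -RintegralD//; apply: eq_Rintegral => t _; by case: (u t) (v t) => ? ? [].
Qed.

Lemma cintegrD u v : cintegr u -> cintegr v -> cintegr (fun t => u t + v t).
Proof.
move=> [ru iu] [rv iv]; split.
- by apply: eq_integrable (integrD ru rv) => // t _ /=; case: (u t) (v t) => ? ? [].
- by apply: eq_integrable (integrD iu iv) => // t _ /=; case: (u t) (v t) => ? ? [].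
Qed.

Lemma cintegrZ (c : C) u : cintegr u -> cintegr (fun t => c * u t).
Proof.
move=> [ru iu]; split.
- under eq_fun do rewrite complex_ReM.
  by apply: integrB; exact: integrZ.
- under eq_fun do rewrite complex_ImM.
  by apply: integrD; exact: integrZ.
Qed.

Lemma cintZ (c : C) u : cintegr u -> cint (fun t => c * u t) = c * cint u.
Proof.
move=> [ru iu]; rewrite /cint.
under eq_Rintegral do rewrite complex_ReM.
under [X in _ +i* X]eq_Rintegral do rewrite complex_ImM.
rewrite RintegralB//; try exact: integrZ.
rewrite RintegralD//; try exact: integrZ.
rewrite !RintegralZl//.
by case: c => a b; apply/eqP; rewrite eq_complex /= !eqxx.
Qed.

Lemma cint_conj u : cintegr u -> cint (fun t => (u t)^*) = (cint u)^*.
Proof.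
move=> [ru iu]; rewrite /cint.
under eq_Rintegral do rewrite complex_ReC.
under [X in _ +i* X]eq_Rintegral do rewrite complex_ImC.
under [X in _ +i* X]eq_Rintegral do rewrite -mulN1r.
by rewrite RintegralZl// mulN1r.
Qed.

Lemma ae_eq_cint u v : u \in @cmeas R -> v \in @cmeas R ->
  {ae mu, forall t, u t = v t} -> cint u = cint v.
Proof.
move=> /cmeasP[ru iu] /cmeasP[rv iv] uv; congr (_ +i* _); apply: ae_eq_Rint => //.
- by apply: ae_imp uv => t ->.
- by apply: ae_imp uv => t ->.
Qed.

Lemma Re_le_normc (x : C) : `|complex.Re x| <= normc x.
Proof.
by case: x => a b /=; rewrite -sqrtr_sqr ler_wsqrtr// lerDl sqr_ge0.
Qed.

Lemma Im_le_normc (x : C) : `|complex.Im x| <= normc x.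
Proof.
by case: x => a b /=; rewrite -sqrtr_sqr ler_wsqrtr// lerDr sqr_ge0.
Qed.

Lemma cintegr_le u (g : R -> R) : u \in @cmeas R ->
  (forall t, normc (u t) <= g t) -> integr g -> cintegr u.
Proof.
move=> /cmeasP[ru iu] ug gi; split; apply: integr_le gi => // t.
- exact: le_trans (Re_le_normc _) (ug t).
- exact: le_trans (Im_le_normc _) (ug t).
Qed.

Lemma normcC (x : C) : normc x^* = normc x.
Proof. by case: x => a b /=; rewrite sqrrN. Qed.

Lemma mulcC_normc (x : C) : x * x^* = (normc x ^+ 2)%:C.
Proof.
rewrite normc_sqr; case: x => a b; apply/eqP; rewrite eq_complex /=.
by apply/andP; split; apply/eqP; ring.
Qed.

End complex_integral.

Lemma normcB_sqr_le (R : realType) (x y : R[i]) :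
  normc (x - y) ^+ 2 <= 2 * normc x ^+ 2 + 2 * normc y ^+ 2.
Proof.
rewrite !normc_sqr; case: x y => a b [c d] /=.
by have := sqr_ge0 (a + c); have := sqr_ge0 (b + d); lra.
Qed.

(** * The Hilbert space of square-integrable functions *)

Section inner_product.
Variable R : realType.
Local Notation C := R[i].
Local Notation mu := (circle_measure R).
Implicit Types (f g h : L2 R).

Lemma cmeasM (u v : R -> C) : u \in @cmeas R -> v \in @cmeas R ->
  (fun t => u t * v t) \in @cmeas R.
Proof. by move=> mu_ mv; exact: (rpredM mu_ mv). Qed.

Lemma cmeasC (u : R -> C) : u \in @cmeas R -> (fun t => (u t)^*) \in @cmeas R.
Proof. by move=> um; exact: (cmeas_conj (CMFun um)). Qed.

Lemma cmeas_normc (u : R -> C) : u \in @cmeas R ->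
  measurable_fun setT (fun t => normc (u t)).
Proof.
move=> um; have /cmeasP[ru iu] := um.
rewrite (_ : (fun _ => _) = @Num.sqrt R \o (fun t => normc (u t) ^+ 2)).
  apply: measurableT_comp.
    by apply: continuous_measurable_fun; exact: sqrt_continuous.
  by apply/measurable_EFinP; exact: (measurable_normc_sqr (CMFun um)).
by apply/funext => t /=; rewrite sqrtr_sqr ger0_norm// normc_ge0.
Qed.

Lemma L2_integr f : integr (fun t => normc (f t) ^+ 2).
Proof.
have /inL2P fi := valP f; apply/integrableP; split.
  exact: measurable_normc_sqr.
apply: le_lt_trans fi; under eq_integral do
  rewrite /= ger0_norm ?sqr_ge0//; exact: lexx.
Qed.

Lemma inprod_cintegr f g : cintegr (fun t => f t * (g t)^*).
Proof.
apply: (@cintegr_le _ _ (fun t => normc (f t) ^+ 2 + normc (g t) ^+ 2)).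
- by apply: cmeasM; [exact: cmeas_fun|apply: cmeasC; exact: cmeas_fun].
- move=> t; rewrite normcM normcC.
  have := sqr_ge0 (normc (f t) - normc (g t)).
  have := normc_ge0 (f t); have := normc_ge0 (g t); nra.
- by apply: integrD; exact: L2_integr.
Qed.

(** Elements of [L2 R] are classes, and their chosen representatives do not
    respect the algebra pointwise; each computation below starts by passing to
    representatives that do. *)
Lemma inprodE f g (u v : R -> C) : u \in @cmeas R -> v \in @cmeas R ->
  {ae mu, forall t, f t = u t} -> {ae mu, forall t, g t = v t} ->
  inprod f g = cint (fun t => u t * (v t)^*).
Proof.
move=> um vm fu gv; apply: ae_eq_cint.
- by apply: cmeasM; [exact: cmeas_fun|apply: cmeasC; exact: cmeas_fun].
- by apply: cmeasM => //; exact: cmeasC.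
- by apply: ae_imp2 fu gv => t -> ->.
Qed.

Lemma inprodDl f g h : inprod (f + g) h = inprod f h + inprod g h.
Proof.
rewrite (@inprodE (f + g) h (fun t => f t + g t) h).
- under [X in cint X]eq_fun do rewrite mulrDl.
  by rewrite cintD//; exact: inprod_cintegr.
- exact: (rpredD (cmeas_fun f) (cmeas_fun g)).
- exact: cmeas_fun.
- exact: L0_reprD.
- exact: aeW.
Qed.

Lemma inprodZl (c : C) f h : inprod (c *: f) h = c * inprod f h.
Proof.
rewrite (@inprodE (c *: f) h (fun t => c * f t) h).
- under [X in cint X]eq_fun do rewrite -mulrA.
  by rewrite cintZ//; exact: inprod_cintegr.
- by apply: (cmeasM (cmeas_cst c)); exact: cmeas_fun.
- exact: cmeas_fun.
- exact: L0_reprZ.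
- exact: aeW.
Qed.

Lemma inprodC f g : inprod g f = (inprod f g)^*.
Proof.
rewrite /inprod -cint_conj; last exact: inprod_cintegr.
congr cint; apply/funext => t.
by case: (f t) (g t) => a b [c d] /=; apply/eqP; rewrite eq_complex /=;
  apply/andP; split; apply/eqP; ring.
Qed.

Lemma inprodDr f g h : inprod h (f + g) = inprod h f + inprod h g.
Proof.
rewrite inprodC inprodDl [inprod h f]inprodC [inprod h g]inprodC.
by rewrite [LHS](rmorphD conjc).
Qed.

Lemma inprodZr (c : C) f h : inprod h (c *: f) = c^* * inprod h f.
Proof.
by rewrite inprodC inprodZl [inprod h f]inprodC [LHS](rmorphM conjc).
Qed.

Lemma inprod0l h : inprod 0 h = 0.
Proof. by rewrite -(scale0r (0 : L2 R)) inprodZl mul0r. Qed.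

Lemma inprod0r h : inprod h 0 = 0.
Proof. by rewrite -(scale0r (0 : L2 R)) inprodZr [_^*]conjc0 mul0r. Qed.

Lemma inprodNl f h : inprod (- f) h = - inprod f h.
Proof. by rewrite -scaleN1r inprodZl mulN1r. Qed.

Lemma inprodBl f g h : inprod (f - g) h = inprod f h - inprod g h.
Proof. by rewrite inprodDl inprodNl. Qed.

Lemma inprodBr f g h : inprod h (f - g) = inprod h f - inprod h g.
Proof.
by rewrite inprodC inprodBl rmorphB [inprod h f]inprodC [inprod h g]inprodC.
Qed.

(** The squared norm: working with it instead of [L2norm] avoids square
    roots throughout. *)
Definition nsq f : R := \int[mu]_t (normc (f t) ^+ 2).

Lemma inprodff f : inprod f f = (nsq f)%:C.
Proof.
rewrite /inprod /cint; under eq_Rintegral do rewrite mulcC_normc.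
under [X in _ +i* X]eq_Rintegral do rewrite mulcC_normc /=.
by congr (_ +i* _); rewrite /Rintegral integral0.
Qed.

Lemma nsq_ge0 f : 0 <= nsq f.
Proof. by apply: Rintegral_ge0 => t _; exact: sqr_ge0. Qed.

Lemma nsqE f (u : R -> C) : u \in @cmeas R ->
  {ae mu, forall t, f t = u t} -> nsq f = \int[mu]_t (normc (u t) ^+ 2).
Proof.
move=> um fu; apply: ae_eq_Rint.
- by apply: measurable_funX; apply: cmeas_normc; exact: cmeas_fun.
- by apply: measurable_funX; exact: cmeas_normc.
- by apply: ae_imp fu => t ->.
Qed.

Lemma cls0 : cls 0 = 0 :> L0 R.
Proof. by apply: (addIr (cls 0)); rewrite -clsD !add0r. Qed.

Lemma clsB (u v : cmfun R) : cls (u - v) = cls u - cls v.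
Proof. by apply/eqP; rewrite eq_sym subr_eq -clsD subrK. Qed.

Lemma L0_reprB (f g : L0 R) : {ae mu, forall t, (f - g : L0 R) t = f t - g t}.
Proof.
have := cls_repr ((f : cmfun R) - (g : cmfun R)).
by rewrite clsB !L0_reprK.
Qed.

Lemma nsq_eq0 f : nsq f = 0 -> f = 0.
Proof.
move=> f0; apply/val_inj/eqP; rewrite -[X in X == _]L0_reprK; apply/eqP.
transitivity (cls 0 : L0 R); last exact: cls0.
apply/clsP.
have : (\int[mu]_t `|(normc (f t) ^+ 2)%:E| = 0)%E.
  under eq_integral do rewrite abse_EFin ger0_norm ?sqr_ge0//.
  rewrite -[LHS]fineK ?(integrable_fin_num _ (L2_integr f))//.
  by congr (_%:E).
move=> /((ae_eq_integral_abs mu measurableT (measurable_normc_sqr f)).1).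
apply: ae_imp => t /(_ I) [] /eqP; rewrite sqrf_eq0 => /eqP.
exact: eq0_normc.
Qed.

Lemma nsqD f g : nsq (f + g) = nsq f + nsq g + 2 * complex.Re (inprod f g).
Proof.
have := inprodff (f + g); rewrite inprodDl !inprodDr !inprodff (inprodC f g).
move=> /(congr1 (@complex.Re R)); case: (inprod f g) => a b /= <-; ring.
Qed.

Lemma nsqN f : nsq (- f) = nsq f.
Proof.
have := inprodff (- f); rewrite -scaleN1r inprodZl inprodZr inprodff.
by case=> <- _; ring.
Qed.

Lemma nsqZ (c : C) f : nsq (c *: f) = normc c ^+ 2 * nsq f.
Proof.
have := inprodff (c *: f); rewrite inprodZl inprodZr inprodff mulrA mulcC_normc.
by case=> <- _; ring.
Qed.

Lemma nsq0 : nsq 0 = 0.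
Proof. by rewrite -(scale0r (0 : L2 R)) nsqZ normc0 expr0n mul0r. Qed.

Lemma nsq_parallelogram f g :
  nsq (f + g) + nsq (f - g) = 2 * nsq f + 2 * nsq g.
Proof.
rewrite !nsqD nsqN [inprod f (- g)]inprodC inprodNl [inprod g f]inprodC.
case: (inprod f g) => a b /=. ring.
Qed.

Lemma nsqD_le f g : nsq (f + g) <= 2 * nsq f + 2 * nsq g.
Proof. by rewrite -nsq_parallelogram lerDl nsq_ge0. Qed.

(** Removing from [f] its component along [h] is the optimal correction in that
    direction; both Cauchy-Schwarz and the orthogonality of minimizers follow. *)
Lemma nsq_residual f h : nsq h != 0 ->
  nsq (f - (inprod f h / (nsq h)%:C) *: h) =
  nsq f - normc (inprod f h) ^+ 2 / nsq h.
Proof.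
move=> h0; apply: complexI; rewrite -[LHS]inprodff; set n := nsq h.
set x := inprod f h.
have n0 : n%:C != 0 by rewrite (inj_eq (@complexI R)).
rewrite inprodBl !inprodBr !inprodZl !inprodZr !inprodff (inprodC f h) -/n -/x.
have -> : (nsq f - normc x ^+ 2 / n)%:C = (nsq f)%:C - x * x^* / n%:C.
  by rewrite mulcC_normc rmorphB rmorphM fmorphV.
have -> : (x / n%:C)^* = x^* / n%:C by rewrite rmorphM fmorphV; congr (_ * _^-1); exact: conjc_real.
by field.
Qed.

Lemma nsq_CS f h : normc (inprod f h) ^+ 2 <= nsq f * nsq h.
Proof.
have [h0|h0] := eqVneq (nsq h) 0.
  by rewrite (nsq_eq0 h0) inprod0r normc0 expr0n mulr_ge0 ?nsq_ge0.
have := nsq_ge0 (f - (inprod f h / (nsq h)%:C) *: h).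
by rewrite nsq_residual// subr_ge0 ler_pdivrMr// lt0r h0 nsq_ge0.
Qed.

Definition L2cvg (u : nat -> L2 R) f :=
  (fun n => nsq (u n - f)) @ \oo --> (0 : R).

(** Sequential closedness suffices, as all limits taken below are limits of
    sequences. *)
Definition closed_subspace (M : set (L2 R)) :=
  [/\ M 0, forall a f g, M f -> M g -> M (a *: f + g) &
      forall u f, (forall n, M (u n)) -> L2cvg u f -> M f].

(** The intervals of centre [a n] and radius [2 s / 2 ^ n] are nested, so the
    supremum of their left ends is the limit and lies in each of them; this
    gives the rate together with the limit. *)
Lemma real_fast_cvg (a : nat -> R) (s : R) :
  (forall n, `|a n.+1 - a n| <= s * 2^-1 ^+ n) ->
  exists l, a @ \oo --> l /\ forall n, `|a n - l| <= 2 * s * 2^-1 ^+ n.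
Proof.
move=> ha.
pose lo n := a n - 2 * s * 2^-1 ^+ n; pose up n := a n + 2 * s * 2^-1 ^+ n.
have s0 : 0 <= s by rewrite -[s]mulr1 -(expr0 2^-1) (le_trans _ (ha 0))//.
have p0 n : 0 < 2^-1 ^+ n :> R by rewrite exprn_gt0// invr_gt0.
have lo_nd : nondecreasing_seq lo.
  apply/nondecreasing_seqP => n; rewrite /lo.
  have := ha n; rewrite ler_norml exprS => /andP[+ _]; lra.
have up_ni : nonincreasing_seq up.
  apply/nonincreasing_seqP => n; rewrite /up.
  have := ha n; rewrite ler_norml exprS => /andP[_ +]; lra.
have lu n m : lo n <= up m.
  apply: (@le_trans _ _ (lo (maxn n m))); first exact/lo_nd/leq_maxl.
  apply: (@le_trans _ _ (up (maxn n m))); last exact/up_ni/leq_maxr.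
  by rewrite /lo /up lerD2l ge0_cp// !mulr_ge0// ltW.
have ub : has_ubound (range lo) by exists (up 0%N) => _ [n _ <-].
pose l := sup (range lo).
have al n : `|a n - l| <= 2 * s * 2^-1 ^+ n.
  rewrite ler_distlC; apply/andP; split.
    by apply: ub_le_sup => //; exists n.
  apply: ge_sup; first by exists (lo 0%N), 0%N.
  by move=> _ [m _ <-]; exact: lu.
exists l; split => //.
apply/subr_cvg0; apply/norm_cvg0P.
apply: (@squeeze_cvgr _ _ _ _ (cst 0) (geometric (2 * s) 2^-1)).
- by near=> n; rewrite normr_ge0/=; exact: al.
- exact: cvg_cst.
- by apply: cvg_geometric; rewrite ger0_norm ?invf_lt1 ?invr_ge0// ltr1n.
Unshelve. all: by end_near. Qed.

Lemma nneseries_half_lty (c : R) (u : nat -> \bar R) : 0 <= c ->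
  (forall n, 0 <= u n)%E -> (forall n, u n <= (c * 2^-1 ^+ n)%:E)%E ->
  (\sum_(n <oo) u n < +oo)%E.
Proof.
move=> c0 u0 uc; apply: (@le_lt_trans _ _ (2 * c)%:E); last exact: ltry.
apply: lime_le; first by apply: is_cvg_nneseries => n _ _; exact: u0.
apply: nearW => n.
apply: (@le_trans _ _ (2 * c - 2 * c * 2^-1 ^+ n)%:E); last first.
  by rewrite lee_fin gerBl !mulr_ge0// exprn_ge0// invr_ge0.
elim: n => [|n ih]; first by rewrite big_nil expr0 mulr1 subrr.
rewrite big_nat_recr//= (le_trans (leeD ih (uc n)))// -EFinD lee_fin exprS.
lra.
Qed.

(** Riesz-Fischer for geometrically fast sequences. Since the increments decay
    like [8 ^ - n] in squared norm, the series [K] of the squared increments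
    weighted by [4 ^ n] is still integrable. Its a.e. finite sum bounds the
    [n]-th increment by [2 ^ - n] times the square root of [K], which yields
    pointwise limits with a rate, and [K] itself is the dominating function for
    the convergence in [L2]. *)
Lemma L2_fast_complete (u : nat -> L2 R) (c : R) :
  (forall n, nsq (u n.+1 - u n) <= c * 2^-1 ^+ (3 * n)) ->
  exists f, L2cvg u f.
Proof.
move=> hu.
have c0 : 0 <= c.
  by rewrite -[c]mulr1 -(expr0 2^-1) (le_trans _ (hu 0%N))// nsq_ge0.
pose d n t := normc (u n.+1 t - u n t) ^+ 2.
have d0 n t : 0 <= d n t by exact: sqr_ge0.
have dm n : measurable_fun setT (d n).
  apply: measurable_funX; apply: cmeas_normc.
  exact: (rpredB (cmeas_fun (u n.+1)) (cmeas_fun (u n))).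
have dE n : nsq (u n.+1 - u n) = \int[mu]_t d n t.
  apply: (@nsqE _ (fun t => u n.+1 t - u n t)); last exact: L0_reprB.
  exact: (rpredB (cmeas_fun (u n.+1)) (cmeas_fun (u n))).
pose K t := (\sum_(n <oo) (4 ^+ n * d n t)%:E)%E.
have e0 n t : (0 <= (4 ^+ n * d n t)%:E)%E by rewrite lee_fin mulr_ge0// exprn_ge0.
have em n : measurable_fun setT (fun t => (4 ^+ n * d n t)%:E).
  by apply/measurable_EFinP; exact: measurable_funM.
have K0 t : (0 <= K t)%E by apply: nneseries_ge0 => n _ _; exact: e0.
have mK : measurable_fun setT K.
  by apply: ge0_emeasurable_sum => // n t _ _; exact: e0.
have iK : mu.-integrable setT K.
  apply/integrableP; split => //.
  under eq_integral do rewrite gee0_abs//.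
  rewrite integral_nneseries//.
  apply: (@nneseries_half_lty c) => // n; first by apply: integral_ge0 => t _; exact: e0.
  have di : integr (d n).
    apply: (@integr_le _ _ (fun t => 2 * normc (u n.+1 t) ^+ 2 +
                                     2 * normc (u n t) ^+ 2)) => //.
    - by move=> t; rewrite ger0_norm//; exact: normcB_sqr_le.
    - by apply: integrD; apply: integrZ; exact: L2_integr.
  rewrite -[leLHS]fineK; last exact: (integrable_fin_num _ (integrZ _ di)).
  rewrite lee_fin -[leLHS]/(\int[mu]_t (4 ^+ n * d n t)) RintegralZl// -dE.
  apply: (le_trans (ler_wpM2l _ (hu n))); first exact: exprn_ge0.
  rewrite mulrCA ler_wpM2l// exprM -exprMn (_ : 4 * _ = 2^-1)//.
  by rewrite !exprS expr0; field.
pose k t := fine (K t).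
have ik : integr k.
  apply: le_integrable iK => //.
    by apply/measurable_EFinP; exact: (measurableT_comp (fine_measurable measurableT)).
  move=> t _; rewrite /k /=; by move: (K t) => [r||]//=; rewrite leey.
have k0 t : 0 <= k t by exact: fine_ge0.
have dk : {ae mu, forall t, forall n, d n t <= k t * (2^-1 ^+ n) ^+ 2}.
  apply: ae_imp (integrable_ae measurableT iK) => t /(_ I) Kfin n.
  rewrite -exprM mulnC exprM.
  have : ((4 ^+ n * d n t)%:E <= K t)%E.
    apply: le_trans (nneseries_lim_ge n.+1 _); last by move=> i _ _; exact: e0.
    by rewrite big_nat_recr//= leeDr// sume_ge0// => i _; exact: e0.
  rewrite -[K t]fineK// => /=; rewrite lee_fin => h.
  rewrite -(@ler_pM2l _ (4 ^+ n)) ?exprn_gt0//; apply: le_trans h _.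
  rewrite mulrCA -exprMn (_ : 4 * _ = 1) ?expr1n ?mulr1//.
  by rewrite !exprS expr0; field.
(* The upper limit is a measurable function of [t] everywhere; it is the limit
   wherever the sequence converges. *)
pose L (v : nat -> R -> R) t := fine (limn_esup (fun n => (v n t)%:E)).
have Lm v : (forall n, measurable_fun setT (v n)) -> measurable_fun setT (L v).
  move=> mv; apply: (measurableT_comp (fine_measurable measurableT)) => //.
  by apply: measurable_fun_limn_esup => n; exact/measurable_EFinP.
have Lcvg (v : nat -> R -> R) t : (forall n, `|v n.+1 t - v n t| ^+ 2 <= d n t) ->
    (forall n, d n t <= k t * (2^-1 ^+ n) ^+ 2) ->
    forall n, `|v n t - L v t| ^+ 2 <= 4 * k t * (2^-1 ^+ n) ^+ 2.
  move=> vd dkt.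
  have [l [vl hl]] : exists l, v^~ t @ \oo --> l /\
      forall n, `|v n t - l| <= 2 * Num.sqrt (k t) * 2^-1 ^+ n.
    apply: real_fast_cvg => n.
    rewrite -(@ler_pXn2r _ 2)// ?nnegrE ?mulr_ge0 ?sqrtr_ge0 ?exprn_ge0 ?invr_ge0//.
    by rewrite exprMn sqr_sqrtr// (le_trans (vd n)).
  have -> : L v t = l.
    rewrite /L; have /cvg_limn_einf_sup[_ ->] // :
      (fun n => (v n t)%:E) @ \oo --> l%:E by apply: cvg_EFin => //; exact: nearW.
  move=> n; rewrite (_ : 4 * _ * _ = (2 * Num.sqrt (k t) * 2^-1 ^+ n) ^+ 2); last first.
    rewrite 2!exprMn sqr_sqrtr// (_ : 4 = 2 ^+ 2)//.
    by rewrite -natrX.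
  by rewrite ler_pXn2r// ?nnegrE ?mulr_ge0 ?sqrtr_ge0 ?exprn_ge0 ?invr_ge0.
pose f0 t := L (fun n t => complex.Re (u n t)) t +i*
             L (fun n t => complex.Im (u n t)) t.
have f0m : f0 \in @cmeas R.
  by apply/cmeasP; split; apply: Lm => n; have /cmeasP[] := cmeas_fun (u n).
have uf : {ae mu, forall t, forall n,
    normc (u n t - f0 t) ^+ 2 <= 8 * k t * (2^-1 ^+ n) ^+ 2}.
  apply: ae_imp dk => t dkt n.
  rewrite normc_sqr complex_ReB complex_ImB /= -[X in X + _]real_normK ?num_real//.
  rewrite -[X in _ + X]real_normK ?num_real//.
  apply: (@le_trans _ _ (4 * k t * (2^-1 ^+ n) ^+ 2 + 4 * k t * (2^-1 ^+ n) ^+ 2)).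
    apply: lerD.
      apply: (Lcvg (fun n t => complex.Re (u n t))) => // m.
      by rewrite -complex_ReB ler_pXn2r ?nnegrE ?normc_ge0// Re_le_normc.
    apply: (Lcvg (fun n t => complex.Im (u n t))) => // m.
    by rewrite -complex_ImB ler_pXn2r ?nnegrE ?normc_ge0// Im_le_normc.
  by rewrite -!mulrA -mulrDl -natrD.
pose g := cls (CMFun f0m).
have gf0 : {ae mu, forall t, g t = f0 t} by exact: cls_repr.
have ufm n : (fun t => u n t - f0 t) \in @cmeas R.
  exact: (rpredB (cmeas_fun (u n)) f0m).
have ikZ (a b : R) : integr (fun t => a * k t * b).
  by under eq_fun do rewrite mulrAC; exact: integrZ.
have g2 : g \in @inL2 R.
  apply/inL2P.
  have bi : integr (fun t => 2 * normc (u 0%N t) ^+ 2 + 2 * (8 * k t * 1)).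
    by apply: integrD; apply: integrZ => //; exact: L2_integr.
  have /integrableP[mb ltb] := bi; apply: le_lt_trans ltb.
  apply: ae_ge0_le_integral => //.
  - by move=> t _; rewrite lee_fin sqr_ge0.
  - exact: measurable_normc_sqr.
  - exact: measurableT_comp.
  - apply: ae_imp2 gf0 uf => t -> /(_ 0%N); rewrite expr0 expr1n => h _.
    rewrite abse_EFin lee_fin (le_trans _ (ler_norm _))//.
    rewrite -[f0 t](subKr (u 0%N t)).
    by apply: (le_trans (normcB_sqr_le _ _)); rewrite lerD2l ler_pM2l.
exists (MkL2 g2); apply: (@squeeze_cvgr _ _ _ _ (cst 0)
    (geometric (8 * \int[mu]_t k t) (2^-1 ^+ 2))); last 2 first.
- exact: cvg_cst.
- by apply: cvg_geometric; rewrite ger0_norm ?exprn_ilt1 ?invf_lt1 ?invr_ge0//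
    ?ltr1n// sqr_ge0.
near=> n; rewrite nsq_ge0/=.
apply: (@le_trans _ _ (\int[mu]_t (8 * k t * (2^-1 ^+ n) ^+ 2))); last first.
  rewrite RintegralZr ?RintegralZl//; last exact: integrZ.
  by rewrite -!exprM mulnC.
apply: ae_le_Rint => //; first exact: L2_integr.
apply: ae_imp2 (L0_reprB (u n) g) _ => [t /= -> h|]; first exact: h.
by apply: ae_imp2 gf0 uf => t ->.
Unshelve. all: by end_near. Qed.

End inner_product.

(** * Closed subspaces and orthogonal projections *)

Section projections.
Variable R : realType.
Local Notation C := R[i].
Local Notation mu := (circle_measure R).
Implicit Types (f g h : L2 R).

Lemma inprod_cvg (u : nat -> L2 R) f h : L2cvg u f ->
  (fun n => normc (inprod (u n - f) h) ^+ 2) @ \oo --> (0 : R).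
Proof.
move=> uf; apply: (@squeeze_cvgr _ _ _ _ (cst 0)
  (fun n => nsq (u n - f) * nsq h)); last 2 first.
- exact: cvg_cst.
- have : (fun n => nsq (u n - f) * nsq h) @ \oo --> 0 * nsq h by apply: cvgMl.
  by rewrite mul0r.
by near=> n; apply/andP; split; [exact: sqr_ge0|exact: nsq_CS].
Unshelve. all: by end_near. Qed.

Lemma cst_le_cvg0 (a : R) (v : nat -> R) : (forall n, a <= v n) ->
  v @ \oo --> (0 : R) -> a <= 0.
Proof.
move=> av v0; rewrite -(cvg_lim (@Rhausdorff R) v0).
by apply: limr_ge; [apply/cvg_ex; exists 0|exact: nearW].
Qed.

Lemma closed_subspaceB M f g : closed_subspace M -> M f -> M g -> M (f - g).
Proof. by move=> [_ lM _] Mf Mg; rewrite -scaleN1r addrC; exact: lM. Qed.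

Lemma closed_subspaceZ M a f : closed_subspace M -> M f -> M (a *: f).
Proof. by move=> [M0 lM _] Mf; rewrite -[_ *: _]addr0; exact: lM. Qed.

Lemma closed_subspaceD M f g : closed_subspace M -> M f -> M g -> M (f + g).
Proof. by move=> [_ lM _] Mf Mg; rewrite -[f]scale1r; exact: lM. Qed.

Section projection.
Variables (M : set (L2 R)) (clM : closed_subspace M).

(** A sequence of [M] that minimizes the distance to [f] up to [8 ^ - n]
    converges: by the parallelogram identity, applied to the midpoint of two
    consecutive terms, its increments are as small as the minimization errors.
    Moving [m n] along [h] cannot gain more than the error [e n], and this
    bounds the inner product of [f - m n] with [h]. *)
Lemma orth_proj_ex f : exists g, M g /\ forall h, M h -> inprod (f - g) h = 0.
Proof.
have [M0 lM cM] := clM.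
pose D := [set nsq (f - m) | m in M].
have Dlb : has_lbound D by exists 0 => _ [m _ <-]; exact: nsq_ge0.
have D0 : D !=set0 by exists (nsq (f - 0)), 0.
pose e n : R := 2^-1 ^+ (3 * n).
have e0 n : 0 < e n by rewrite exprn_gt0// invr_gt0.
have eS n : e n.+1 <= e n.
  by rewrite /e ler_wiXn2l ?invr_ge0 ?invf_le1 ?ler1n ?leq_mul.
have /choice[m mP] : forall n, exists m, M m /\ nsq (f - m) < inf D + e n.
  move=> n; have [_ [m Mm <-] h] := inf_adherent (e0 n) (conj D0 Dlb).
  by exists m.
have Dge h : M h -> inf D <= nsq (f - h).
  by move=> Mh; apply: ge_inf => //; exists h.
have [|g mg] := @L2_fast_complete R m 4.
  move=> n; have [Mn hn] := mP n; have [Mn1 hn1] := mP n.+1.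
  pose h := 2^-1 *: (m n + m n.+1).
  have Mh : M h by apply: closed_subspaceZ => //; exact: closed_subspaceD.
  have := nsq_parallelogram (f - m n) (f - m n.+1).
  have -> : f - m n - (f - m n.+1) = m n.+1 - m n.
    by rewrite opprB addrC addrA subrK.
  have -> : f - m n + (f - m n.+1) = 2 *: (f - h).
    rewrite /h scalerBr scalerA divff ?pnatr_eq0// scale1r scaler_nat mulr2n.
    by rewrite opprD addrACA.
  rewrite nsqZ; have := Dge _ Mh; have := eS n; rewrite /= -/(e n).
  have -> : normc (2 : C) ^+ 2 = 4.
    by rewrite normc_sqr /= -[LHS]/((1 + 1) ^+ 2 + (0 + 0) ^+ 2); ring.
  move: hn hn1; clearbody e D; clear.
  move: (inf D) (e n) (e n.+1) (nsq _) (nsq _) (nsq _) (nsq _).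
  by move=> *; lra.
have Mg : M g by apply: (cM m) => // n; exact: (mP n).1.
exists g; split => // h Mh.
have [h0|h0] := eqVneq (nsq h) 0; first by rewrite (nsq_eq0 h0) inprod0r.
have hp : 0 < nsq h by rewrite lt0r h0 nsq_ge0.
have res n : normc (inprod (f - m n) h) ^+ 2 <= e n * nsq h.
  have [Mn hn] := mP n.
  have := nsq_residual (f - m n) h0; set c := _ / _ => hc.
  rewrite -ler_pdivrMr//.
  have : M (m n + c *: h) by apply: closed_subspaceD => //; exact: closed_subspaceZ.
  move=> /Dge; rewrite opprD addrA hc; lra.
suff : normc (inprod (f - g) h) ^+ 2 <= 0.
  by move=> h2; apply: eq0_normc; apply/eqP; rewrite -sqrf_eq0 eq_le h2 sqr_ge0.
pose v n := 2 * (e n * nsq h) + 2 * normc (inprod (m n - g) h) ^+ 2.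
apply: (@cst_le_cvg0 _ v) => [n|].
  have -> : f - g = (f - m n) - (g - m n) by rewrite opprB addrA subrK.
  rewrite inprodBl (le_trans (normcB_sqr_le _ _))// lerD//.
    by rewrite ler_pM2l.
  by rewrite -opprB inprodNl normcN.
have eN : e @ \oo --> (0 : R).
  rewrite /e; under eq_fun do rewrite exprM.
  apply: cvg_expr; rewrite ger0_norm ?exprn_ge0 ?invr_ge0//.
  by rewrite exprn_ilt1 ?invr_ge0 ?invf_lt1 ?ltr1n.
have : v @ \oo --> 2 * (0 * nsq h) + 2 * 0.
  by apply: cvgD; apply: cvgMr; [exact: cvgMl|exact: inprod_cvg].
by rewrite mul0r !mulr0 addr0.
Qed.

Lemma orth_projP f :
  M (orth_proj M f) /\ forall h, M h -> inprod (f - orth_proj M f) h = 0.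
Proof.
have [g Mg] := orth_proj_ex f.
exact: (@xgetPex _ 0 [set g | M g /\ forall h, M h -> inprod (f - g) h = 0]
  (ex_intro _ g Mg)).
Qed.

Lemma orth_proj_uniq f g : M g -> (forall h, M h -> inprod (f - g) h = 0) ->
  orth_proj M f = g.
Proof.
move=> Mg fg; have [Mp fp] := orth_projP f.
apply/eqP; rewrite -subr_eq0; apply/eqP/nsq_eq0.
set p := orth_proj M f in Mp fp *.
have Mpg : M (p - g) by exact: closed_subspaceB.
have : inprod (p - g) (p - g) = 0.
  have {1}-> : p - g = (f - g) - (f - p) by rewrite opprB [RHS]addrC addrA subrK.
  by rewrite inprodBl fg// fp// subrr.
by rewrite inprodff => -[].
Qed.

End projection.

End projections.

(** * Multiplication operators *)

Section multiplication.
Variable R : realType.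
Local Notation C := R[i].
Local Notation mu := (circle_measure R).
Implicit Types (f g h : L2 R) (phi psi : Linf R).

Lemma mulopDr phi f g : mulop phi (f + g) = mulop phi f + mulop phi g.
Proof. by apply: val_inj; exact: mulrDr. Qed.

Lemma mulopZr (c : C) phi f : mulop phi (c *: f) = c *: mulop phi f.
Proof. by apply: val_inj; rewrite /= -scalerAr. Qed.

Lemma mulopBr phi f g : mulop phi (f - g) = mulop phi f - mulop phi g.
Proof. by rewrite mulopDr -scaleN1r mulopZr scaleN1r. Qed.

Lemma mulop0 phi : mulop phi 0 = 0.
Proof. by apply: val_inj; exact: mulr0. Qed.

Lemma mulopDl phi psi f : mulop (phi + psi) f = mulop phi f + mulop psi f.
Proof. by apply: val_inj; exact: mulrDl. Qed.

Lemma mulopZl (c : C) phi f : mulop (c *: phi) f = c *: mulop phi f.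
Proof. by apply: val_inj; rewrite /= -scalerAl. Qed.

Lemma mulopBl phi psi f : mulop (phi - psi) f = mulop phi f - mulop psi f.
Proof. by rewrite mulopDl -scaleN1r mulopZl scaleN1r. Qed.

Lemma mulopM phi psi f : mulop (phi * psi) f = mulop phi (mulop psi f).
Proof. by apply: val_inj; rewrite /= mulrA. Qed.

Lemma mulop1 f : mulop 1 f = f.
Proof. by apply: val_inj; exact: mul1r. Qed.

Lemma mulop_Linf phi psi : mulop phi (Linf_L2 psi) = Linf_L2 (phi * psi).
Proof. exact: val_inj. Qed.

Lemma mulopC phi psi f : mulop phi (mulop psi f) = mulop psi (mulop phi f).
Proof. by rewrite -!mulopM mulrC. Qed.

Lemma mulop_Linf_L2 phi psi : mulop phi (Linf_L2 psi) = mulop psi (Linf_L2 phi).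
Proof. by rewrite !mulop_Linf mulrC. Qed.

Lemma Linf_L2_inj : injective (@Linf_L2 R).
Proof. by move=> phi psi /(congr1 val) h; apply: val_inj. Qed.

Lemma Linf_ae phi psi : {ae mu, forall t, phi t = psi t} -> phi = psi.
Proof.
move=> h; apply: val_inj.
by rewrite /= -[LHS]L0_reprK -[RHS]L0_reprK; apply/clsP.
Qed.

Lemma Linf_conjE phi : {ae mu, forall t, Linf_conj phi t = (phi t)^*}.
Proof. exact: cls_repr. Qed.

Lemma Linf_mulE phi psi : {ae mu, forall t, (phi * psi : Linf R) t = phi t * psi t}.
Proof. exact: (L0_reprM (Linf_val phi) (Linf_val psi)). Qed.

Lemma mulopE phi f : {ae mu, forall t, mulop phi f t = phi t * f t}.
Proof. exact: (L0_reprM (Linf_val phi) (L2_val f)). Qed.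

Lemma zexpE k : {ae mu, forall t, zexp R k t = cis (k%:~R * t)}.
Proof. exact: cls_repr. Qed.

Lemma Linf_1E : {ae mu, forall t, (1 : Linf R) t = 1}.
Proof. by have := @cls_repr R 1; rewrite cls1. Qed.

Lemma Linf_conjK : involutive (@Linf_conj R).
Proof.
move=> phi; apply: Linf_ae.
by apply: ae_imp2 (Linf_conjE (Linf_conj phi)) (Linf_conjE phi) => t -> ->;
  exact: conjcK.
Qed.

Lemma cis0 : cis 0 = 1 :> C. Proof. by rewrite /cis cos0 sin0. Qed.

Lemma cisD (x y : R) : cis (x + y) = cis x * cis y.
Proof.
rewrite /cis cosD sinD; apply/eqP; rewrite eq_complex /=.
by apply/andP; split; apply/eqP; ring.
Qed.

Lemma cisN (x : R) : cis (- x) = (cis x)^*.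
Proof. by rewrite /cis cosN sinN. Qed.

Lemma normc_cis (x : R) : normc (cis x) = 1.
Proof. by rewrite /= cos2Dsin2 sqrtr1. Qed.

Lemma zexpD k l : zexp R (k + l) = zexp R k * zexp R l.
Proof.
apply: Linf_ae.
apply: ae_imp2 (Linf_mulE (zexp R k) (zexp R l)) _ => [t -> h|]; first exact: h.
apply: ae_imp2 (zexpE (k + l)) _ => [t -> h|]; first exact: h.
by apply: ae_imp2 (zexpE k) (zexpE l) => t -> ->; rewrite intrD mulrDl cisD.
Qed.

Lemma zexp_0 : zexp R 0 = 1.
Proof.
apply: Linf_ae; apply: ae_imp2 (zexpE 0) Linf_1E => t -> ->.
by rewrite mul0r cis0.
Qed.

Lemma Linf_conj_zexp k : Linf_conj (zexp R k) = zexp R (- k).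
Proof.
apply: Linf_ae; apply: ae_imp2 (Linf_conjE (zexp R k)) _ => [t -> h|]; first exact: h.
by apply: ae_imp2 (zexpE k) (zexpE (- k)) => t -> ->; rewrite intrN mulNr cisN.
Qed.

Lemma inprod_mulop phi f g :
  inprod (mulop phi f) g = inprod f (mulop (Linf_conj phi) g).
Proof.
rewrite (@inprodE _ (mulop phi f) g (fun t => phi t * f t) g).
- rewrite (@inprodE _ f (mulop (Linf_conj phi) g) f (fun t => (phi t)^* * g t)).
  + congr cint; apply/funext => t.
    rewrite [((phi t)^* * g t)^*](rmorphM conjc) mulrA; congr (_ * _).
    by rewrite mulrC; congr (_ * _); rewrite [RHS]conjcK.
  + exact: cmeas_fun.
  + by apply: cmeasM; [apply: cmeasC|]; exact: cmeas_fun.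
  + exact: aeW.
  + apply: ae_imp2 (mulopE (Linf_conj phi) g) (Linf_conjE phi) => t -> -> //.
- by apply: cmeasM; exact: cmeas_fun.
- exact: cmeas_fun.
- exact: mulopE.
- exact: aeW.
Qed.

Lemma inprod_ext g h : (forall f, inprod f g = inprod f h) -> g = h.
Proof.
move=> gh; apply/eqP; rewrite -subr_eq0; apply/eqP/nsq_eq0.
by have := inprodff (g - h); rewrite inprodBr gh subrr => -[].
Qed.

(** The adjoint is defined by choice; it is identified through the uniqueness
    of the vector representing a functional. *)
Lemma adjoint_mulop phi : adjoint (mulop phi) = mulop (Linf_conj phi).
Proof.
apply/funext => g; apply: inprod_ext => f; rewrite -inprod_mulop.
have -> // : inprod (mulop phi f) g = inprod f (adjoint (mulop phi) g).
apply: (@xgetPex _ 0 [set h | forall f, inprod (mulop phi f) g = inprod f h]).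
by exists (mulop (Linf_conj phi) g) => f'; exact: inprod_mulop.
Qed.

(** [|phi| = 1] a.e., in the algebraic form that makes [M_phi] unitary with
    inverse [M_(conj phi)]. *)
Definition unimodular phi := Linf_conj phi * phi = 1.

Lemma unimodular_zexp k : unimodular (zexp R k).
Proof. by rewrite /unimodular Linf_conj_zexp -zexpD addNr zexp_0. Qed.

Lemma unimodularP phi : {ae mu, forall t, normc (phi t) = 1} -> unimodular phi.
Proof.
move=> h; apply: Linf_ae.
apply: ae_imp2 (Linf_mulE (Linf_conj phi) phi) _ => [t -> e|]; first exact: e.
apply: ae_imp2 Linf_1E _ => [t -> e|]; first exact: e.
apply: ae_imp2 (Linf_conjE phi) h => t -> e.
by rewrite mulrC mulcC_normc e expr1n.
Qed.

Lemma unimodularK phi f : unimodular phi -> mulop (Linf_conj phi) (mulop phi f) = f.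
Proof. by move=> u; rewrite -mulopM u mulop1. Qed.

Lemma unimodularKC phi f : unimodular phi -> mulop phi (mulop (Linf_conj phi) f) = f.
Proof. by move=> u; rewrite mulopC unimodularK. Qed.

Lemma unimodular_inprod phi f g : unimodular phi ->
  inprod (mulop phi f) (mulop phi g) = inprod f g.
Proof. by move=> u; rewrite inprod_mulop unimodularK. Qed.

Lemma unimodular_nsq phi f : unimodular phi -> nsq (mulop phi f) = nsq f.
Proof.
by move=> u; apply: complexI; rewrite -!inprodff unimodular_inprod.
Qed.

Lemma nsq_mulop_le phi : exists B : R, forall f, nsq (mulop phi f) <= B * nsq f.
Proof.
have /inLinfP[M phiM] := valP phi; exists (M ^+ 2) => f.
rewrite /nsq -RintegralZl//; last exact: L2_integr.
apply: ae_le_Rint; [exact: L2_integr|by apply: integrZ; exact: L2_integr|].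
apply: ae_imp2 (mulopE phi f) phiM => t -> h.
rewrite normcM exprMn ler_wpM2r ?sqr_ge0// ler_pXn2r ?nnegrE ?normc_ge0//.
by rewrite (le_trans _ h)// normc_ge0.
Qed.

Definition L2bounded (T : L2 R -> L2 R) :=
  exists B : R, forall f, nsq (T f) <= B * nsq f.

Lemma bounded_opP (T : L2 R -> L2 R) : bounded_op T -> L2bounded T.
Proof.
move=> [B hB]; exists (B ^+ 2) => f.
have B0 : 0 <= B * L2norm f by apply: le_trans (hB f); exact: sqrtr_ge0.
have := hB f; rewrite -(@ler_pXn2r _ 2)// ?nnegrE ?sqrtr_ge0//.
by rewrite exprMn /L2norm !sqr_sqrtr//; exact: nsq_ge0.
Qed.

Lemma L2cvg_bounded (T : {linear L2 R -> L2 R}) (u : nat -> L2 R) f :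
  L2bounded T -> L2cvg u f -> L2cvg (fun n => T (u n)) (T f).
Proof.
move=> [B TB] uf; apply: (@squeeze_cvgr _ _ _ _ (cst 0)
  (fun n => B * nsq (u n - f))); last 2 first.
- exact: cvg_cst.
- have : (fun n => B * nsq (u n - f)) @ \oo --> B * 0 by apply: cvgMr.
  by rewrite mulr0.
by near=> n; apply/andP; split; [exact: nsq_ge0|rewrite -raddfB; exact: TB].
Unshelve. all: by end_near. Qed.

Lemma mulop_linear phi : linear (mulop phi).
Proof. by move=> c f g; rewrite mulopDr mulopZr. Qed.

HB.instance Definition _ phi :=
  GRing.isLinear.Build C (L2 R) (L2 R) _ (mulop phi) (mulop_linear phi).

Lemma L2cvg_uniq (u : nat -> L2 R) f g : L2cvg u f -> L2cvg u g -> f = g.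
Proof.
move=> uf ug; apply/eqP; rewrite -subr_eq0; apply/eqP/nsq_eq0/eqP.
rewrite eq_le nsq_ge0 andbT.
apply: (@cst_le_cvg0 _ _ (fun n => 2 * nsq (u n - g) + 2 * nsq (u n - f))).
  move=> n; have -> : f - g = (u n - g) - (u n - f) by rewrite opprB [RHS]addrC addrA subrK.
  by rewrite -(nsqN (u n - f)); exact: nsqD_le.
have : (fun n => 2 * nsq (u n - g) + 2 * nsq (u n - f)) @ \oo --> 2 * (0:R) + 2 * 0.
  by apply: cvgD; apply: cvgMr.
by rewrite !mulr0 addr0.
Qed.

Lemma inprod_lim0 (u : nat -> L2 R) f h : (forall n, inprod (u n) h = 0) ->
  L2cvg u f -> inprod f h = 0.
Proof.
move=> uh uf; apply: eq0_normc; apply/eqP; rewrite -sqrf_eq0 eq_le sqr_ge0 andbT.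
apply: (cst_le_cvg0 _ (inprod_cvg h uf)) => n.
by rewrite inprodBl uh sub0r normcN.
Qed.

(** With this, an identity between bounded operators need only be checked on a
    family that spans a dense subspace of [M]. *)
Lemma closed_subspace_eq (M : set (L2 R)) (S T : {linear L2 R -> L2 R}) :
  closed_subspace M -> L2bounded S -> L2bounded T ->
  closed_subspace [set f | M f /\ S f = T f].
Proof.
move=> clM bS bT; have [M0 lM cM] := clM; split.
- by split => //; rewrite !raddf0.
- move=> a f g [Mf ef] [Mg eg]; split; first exact: lM.
  by rewrite !linearP ef eg.
- move=> u f Mu uf; split; first by apply: cM uf => n; case: (Mu n).
  apply: (@L2cvg_uniq (fun n => S (u n))); first exact: L2cvg_bounded.
  rewrite (_ : (fun n => S (u n)) = (fun n => T (u n))).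
    exact: L2cvg_bounded.
  by apply/funext => n; case: (Mu n).
Qed.

End multiplication.

(** * Positivity tested against trigonometric polynomials *)

Section circle_lebesgue.
Variable R : realType.
Local Notation C := R[i].
Local Notation mu := (circle_measure R).
Local Notation leb := (@lebesgue_measure R).
Local Notation tau := (2 * pi : R).

Lemma integr_lebesgue (f : R -> R) : integr f ->
  leb.-integrable `[0, tau] (EFin \o f).
Proof.
move=> /integrableP[mf f1]; apply/integrableP; split.
  exact: measurable_funTS.
move: f1; rewrite integral_uniform//; last exact: measurableT_comp.
rewrite subr0 !ltey; apply: contraNN => /eqP ->.
by rewrite gt0_muley ?eqxx// lte_fin invr_gt0 ltr0_2pi.
Qed.

(** Passing to Lebesgue measure on one period gives access to the fundamental
    theorem of calculus. *)
Lemma Rint_lebesgue (f : R -> R) : integr f ->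
  \int[mu]_t f t = (2 * pi)^-1 * \int[leb]_(t in `[0, tau]) f t.
Proof.
move=> fi; have fl := integr_lebesgue fi.
have mf := measurable_int _ fi.
rewrite /Rintegral [X in fine X]integralE [in RHS]integralE.
rewrite !integral_uniform//; [|exact: measurable_funeneg|exact: measurable_funepos].
have P : (\int[leb]_(x in `[0%R, tau]) ((EFin \o f)^\+ x) \is a fin_num)%E.
  exact: integrable_pos_fin_num.
have N : (\int[leb]_(x in `[0%R, tau]) ((EFin \o f)^\- x) \is a fin_num)%E.
  exact: integrable_neg_fin_num.
by rewrite subr0 -(fineK P) -(fineK N) -!EFinM -!EFinB /= mulrBr.
Qed.

Lemma ae_lebesgue (P : R -> Prop) :
  {ae leb, forall t, P t} -> {ae mu, forall t, P t}.
Proof.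
have /null_content_dominatesP h := dominates_uniform_prob (ltr0_2pi R).
by move=> [A [mA A0 sA]]; exists A; split => //; exact: h.
Qed.

Lemma ae_circle_itv : {ae mu, forall t, 0 < t < tau}.
Proof.
have FF := ae_filter_ringOfSetsType mu.
have h1 : {ae mu, forall t, 0 <= t <= tau}.
  exists (~` `[0, tau]); split; first exact: measurableC.
    rewrite -[LHS]/(uniform_prob _ _) /uniform_prob integral_uniform_pdf.
    by rewrite setICl integral_set0.
  by move=> t /= h; rewrite in_itv.
have h2 (a : R) : {ae mu, forall t, t != a}.
  apply: ae_lebesgue; exists [set a]; split => //.
    exact: lebesgue_measure_set1.
  by move=> t /= /negP; rewrite negbK => /eqP.
apply: filterS3 h1 (h2 0) (h2 tau) => t /andP[t0 tt] n0 nt.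
by rewrite !lt_neqAle t0 tt nt eq_sym n0.
Qed.

End circle_lebesgue.

Section arcs.
Variable R : realType.
Local Notation tau := (2 * pi : R).

(** A trigonometric polynomial of degree one with values between [0] and [1]
    that is below [1 / 2] exactly on the arc of centre [s] and half-width [d];
    the powers [(1 - arcfun ^ n) ^ (2 ^ n)] then converge to the indicator
    function of that arc, because [2 ^ n * arcfun ^ n] tends to [0] on the arc
    and to infinity off its closure. *)
Definition arcfun (s d t : R) : R := 2^-1 - (cos (t - s) - cos d) / 4.
Definition arcpoly (s d : R) (n : nat) (t : R) : R :=
  (1 - arcfun s d t ^+ n) ^+ (2 ^ n).

Lemma arcfun_01 s d t : 0 <= arcfun s d t <= 1.
Proof.
rewrite /arcfun; have := cos_le1 (t - s); have := cos_geN1 (t - s).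
by have := cos_le1 d; have := cos_geN1 d; lra.
Qed.

Lemma arcpoly_01 s d n t : 0 <= arcpoly s d n t <= 1.
Proof.
have /andP[y0 y1] := arcfun_01 s d t; rewrite /arcpoly.
have yn0 : 0 <= arcfun s d t ^+ n by exact: exprn_ge0.
have yn1 : arcfun s d t ^+ n <= 1 by exact: exprn_ile1.
by rewrite exprn_ge0 ?exprn_ile1//; lra.
Qed.

Lemma bernoulli_le (x : R) n : 0 <= x <= 1 -> 1 - n%:R * x <= (1 - x) ^+ n.
Proof.
move=> /andP[x0 x1]; elim: n => [|n ih]; first by rewrite mul0r subr0 expr0.
rewrite exprS; apply: (@le_trans _ _ ((1 - x) * (1 - n%:R * x))).
  have := ler0n R n; rewrite -natr1; nra.
by rewrite ler_wpM2l// subr_ge0.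
Qed.

Lemma bernoulli_ge (x : R) n : 0 <= x <= 1 -> (1 + n%:R * x) * (1 - x) ^+ n <= 1.
Proof.
move=> /andP[x0 x1]; elim: n => [|n ih]; first by rewrite mul0r addr0 mul1r expr0.
apply: le_trans ih; rewrite exprS mulrA ler_wpM2r ?exprn_ge0 ?subr_ge0//.
by have := ler0n R n; rewrite -natr1; nra.
Qed.

(** Bernoulli: [1 - (2 y) ^ n <= (1 - y ^ n) ^ (2 ^ n) <= 1]. *)
Lemma pow_cvg1 (y : R) : 0 <= y < 2^-1 ->
  (fun n => (1 - y ^+ n) ^+ (2 ^ n)) @ \oo --> (1 : R).
Proof.
move=> /andP[y0 y2].
have yn n : 0 <= y ^+ n <= 1.
  by rewrite exprn_ge0//= exprn_ile1// (le_trans (ltW y2))// invf_le1 ?ler1n.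
apply: (@squeeze_cvgr _ _ _ _ (fun n => 1 - (2 * y) ^+ n) (cst 1)).
- near=> n; apply/andP; split.
    by rewrite exprMn -natrX; exact: bernoulli_le.
  by have /andP[? ?] := yn n; apply: exprn_ile1; rewrite ?subr_ge0// gerBl.
- rewrite -[X in _ --> X]subr0; apply: cvgB; first exact: cvg_cst.
  by apply: cvg_expr; rewrite ger0_norm; lra.
- exact: cvg_cst.
Unshelve. all: by end_near. Qed.

(** Bernoulli for the inverse: [(1 - y ^ n) ^ (2 ^ n) <= 1 / (2 y) ^ n]. *)
Lemma pow_cvg0 (y : R) : 2^-1 < y <= 1 ->
  (fun n => (1 - y ^+ n) ^+ (2 ^ n)) @ \oo --> (0 : R).
Proof.
move=> /andP[y2 y1].
have y0 : 0 < y by apply: lt_trans y2; rewrite invr_gt0.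
have yn n : 0 <= y ^+ n <= 1 by rewrite exprn_ge0 ?exprn_ile1// ltW.
apply: (@squeeze_cvgr _ _ _ _ (cst 0) (fun n => (2 * y)^-1 ^+ n)).
- near=> n; apply/andP; split.
    by have /andP[_ ?] := yn n; apply: exprn_ge0; rewrite subr_ge0.
  rewrite exprVn -[leRHS]mul1r ler_pdivlMr ?exprn_gt0 ?mulr_gt0//.
  apply: le_trans (bernoulli_ge (2 ^ n) (yn n)).
  rewrite [leRHS]mulrC ler_wpM2l//.
    by have /andP[_ ?] := yn n; apply: exprn_ge0; rewrite subr_ge0.
  by rewrite exprMn natrX lerDr.
- exact: cvg_cst.
- apply: cvg_expr; rewrite ger0_norm ?invr_ge0 ?mulr_ge0 ?(ltW y0)//.
  by rewrite invf_lt1 ?mulr_gt0//; lra.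
Unshelve. all: by end_near. Qed.

(** The cosine decreases from [0] to [pi] and is even and [2 pi]-periodic, so
    comparing cosines compares distances to [s] on the circle. *)
Lemma cos_arc (a b t : R) : 0 <= a -> a < b -> b <= tau -> 0 < t < tau ->
  let s := (a + b) / 2 in let d := (b - a) / 2 in
  (a < t < b -> cos d < cos (t - s)) /\
  ((t < a \/ b < t) -> cos (t - s) < cos d).
Proof.
move=> a0 ab bt /andP[t0 tt] s d.
have p0 := pi_gt0 R.
have ab2 : a = s - d /\ b = s + d by rewrite /s /d; split; lra.
case: ab2 => ea eb; move: (s) (d) ea eb => {}s {}d ea eb.
have cle (x y : R) : 0 <= x -> x < y -> y <= pi -> cos y < cos x.
  by move=> x0 xy yp; rewrite ltr_cos// in_itv/=; apply/andP; split; lra.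
split.
- move=> /andP[at_ tb]; have [ts|ts] := leP 0 (t - s).
    by apply: cle; lra.
  by rewrite -(cosN (t - s)); apply: cle; lra.
- have cN x : cos x = cos (tau - x).
    by rewrite -cosN -[LHS]cosD2pi; congr cos; rewrite mulr2n; ring.
  move=> h; have [ts|ts] := leP 0 (t - s).
    have [tp|tp] := leP (t - s) pi; first by apply: cle; lra.
    by rewrite (cN (t - s)); apply: cle; lra.
  have [tp|tp] := leP (s - t) pi; first by rewrite -(cosN (t - s)); apply: cle; lra.
  by rewrite -(cosN (t - s)) (cN (- _)); apply: cle; lra.
Qed.

Variable q : R -> R.
Local Notation mu := (circle_measure R).
Local Notation leb := (@lebesgue_measure R).

Lemma measurable_arcpoly s d n : measurable_fun setT (arcpoly s d n).
Proof.
have cy : continuous (arcfun s d).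
  move=> t; apply: cvgB; first exact: cvg_cst.
  apply: cvgMl; apply: cvgB; last exact: cvg_cst.
  apply: continuous_comp; last exact: continuous_cos.
  by apply: cvgB; [exact: cvg_id|exact: cvg_cst].
apply: measurable_funX; apply: measurable_funB; first exact: measurable_cst.
by apply: measurable_funX; exact: continuous_measurable_fun.
Qed.

Hypotheses (qi : integr q)
  (qpos : forall s d n, 0 <= \int[mu]_t (q t * arcpoly s d n t ^+ 2)).

Lemma integr_patch (D : set R) : measurable D -> integr (q \_ D).
Proof.
move=> mD; rewrite /integr -restrict_EFin; apply/integrable_restrict => //.
by rewrite setTI; apply: integrableS qi => //; exact: measurableT.
Qed.

(** [q] times the squares of the arc polynomials is dominated by [|q|] and
    converges to [q] on the arc and to [0] off it. *)
Lemma arc_integral_ge0 (a b : R) : 0 <= a -> a < b -> b <= tau ->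
  0 <= \int[mu]_t (q \_ `]a, b]) t.
Proof.
move=> a0 ab bt; pose s := (a + b) / 2; pose d := (b - a) / 2.
pose f_ n t := (q t * arcpoly s d n t ^+ 2)%:E.
have mq : measurable_fun setT q := (measurable_EFinP _ _).1 (measurable_int _ qi).
have [] := @dominated_convergence _ _ _ mu setT measurableT f_
  (EFin \o (q \_ `]a, b])) (EFin \o (fun t => `|q t|)).
- move=> n; apply/measurable_EFinP; apply: measurable_funM => //.
  by apply: measurable_funX; exact: measurable_arcpoly.
- exact: measurable_int (integr_patch (measurable_itv _)).
- have h (c : R) : {ae mu, forall t, t != c}.
    apply: ae_lebesgue; exists [set c]; split => //.
      exact: lebesgue_measure_set1.
    by move=> t /= /negP; rewrite negbK => /eqP.
  have FF := ae_filter_ringOfSetsType mu.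
  apply: filterS3 (ae_circle_itv R) (h a) (h b) => t t2 ta tb _.
  have [inside outside] := cos_arc a0 ab bt t2.
  have /andP[y0 y1] := arcfun_01 s d t.
  rewrite /f_ /=; apply: cvg_EFin; first exact: nearW.
  rewrite /comp/=; case: (boolP (a < t < b)) => tab.
    rewrite patchE mem_set; last by rewrite /= in_itv/=; case/andP: tab => -> /ltW ->.
    have {2}-> : q t = q t * 1 ^+ 2 by rewrite expr1n mulr1.
    apply: cvgMr; suff : arcpoly s d n t @[n --> \oo] --> (1 : R) by move=> h1; apply: cvgM.
    apply: pow_cvg1; rewrite y0/= /arcfun; have := inside tab; rewrite -/s -/d; lra.
  have tab' : t < a \/ b < t.
    move: tab; rewrite negb_and -!leNgt => /orP[h1|h1]; [left|right].
      by rewrite lt_neqAle ta.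
    by rewrite lt_neqAle eq_sym tb.
  rewrite patchE memNset; last first.
    by rewrite /= in_itv/= => /andP[t1 t2']; case: tab'; lra.
  have -> : point = q t * 0 ^+ 2 :> R by rewrite expr0n mulr0.
  apply: cvgMr; suff : arcpoly s d n t @[n --> \oo] --> (0 : R) by move=> h1; apply: cvgM.
  apply: pow_cvg0; rewrite y1 andbT /arcfun; have := outside tab'; rewrite -/s -/d; lra.
- exact: integrable_norm.
- apply: aeW => t n _; rewrite /f_ abse_EFin lee_fin normrM.
  have /andP[p0 p1] := arcpoly_01 s d n t.
  by rewrite ler_piMr// ger0_norm ?sqr_ge0// exprn_ile1.
move=> _ _ cv; rewrite /Rintegral fine_ge0//.
rewrite -(cvg_lim _ cv)//; apply: lime_ge; first by apply/cvg_ex; eexists; exact: cv.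
apply: nearW => n; rewrite -[X in (_ <= X)%E]fineK ?lee_fin; first exact: qpos.
apply: (integrable_fin_num measurableT); apply: (integr_le _ _ (integrable_norm qi)).
  by apply: measurable_funM => //; apply: measurable_funX; exact: measurable_arcpoly.
move=> t; rewrite normrM; have /andP[p0 p1] := arcpoly_01 s d n t.
by rewrite ler_piMr// ger0_norm ?sqr_ge0// exprn_ile1.
Qed.

(** Every arc integral is nonnegative, so the primitive is nondecreasing and
    its derivative, which is [q] a.e., is nonnegative. *)
Lemma arc_positivity : {ae mu, forall t, 0 <= q t}.
Proof.
pose g := q \_ `[0, tau].
have gi : leb.-integrable setT (EFin \o g).
  rewrite -restrict_EFin; apply/integrable_restrict => //.
  by rewrite setTI; exact: integr_lebesgue.
have giS y : leb.-integrable `]-oo, y] (EFin \o g).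
  by apply: integrableS gi => //; exact: measurableT.
have gloc : locally_integrable setT g.
  by apply: integrable_locally => //; exact: integr_lebesgue.
have := FTC1Ny giS gloc; set F := fun x => _ => dF.
have Fmono (x y : R) : 0 < x -> x < y -> y < tau -> F x <= F y.
  move=> x0 xy yt; rewrite -subr_ge0 /F Rintegral_itvB//; last first.
    by rewrite bnd_simp ltW.
  have := arc_integral_ge0 (ltW x0) xy (ltW yt).
  rewrite Rint_lebesgue; last exact: integr_patch.
  rewrite pmulr_rge0 ?invr_gt0 ?ltr0_2pi// -Rintegral_mkcondr.
  rewrite setIidr; last first.
    move=> t /=; rewrite !in_itv/= => /andP[t1 t2].
    by rewrite (ltW (lt_trans x0 t1)) (le_trans t2 (ltW yt)).
  suff -> : \int[leb]_(t in `]x, y]) g t = \int[leb]_(t in `]x, y]) q t by [].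
  apply: eq_Rintegral => t /set_mem/=; rewrite in_itv/=.
  move=> /andP[t1 t2]; rewrite /g patchE mem_set//= in_itv/=.
  by rewrite (ltW (lt_trans x0 t1)) (le_trans t2 (ltW yt)).
apply: ae_imp2 (ae_lebesgue dF) (ae_circle_itv R) => x [dx gx] /andP[x0 xt].
have <- : g x = q x by rewrite /g patchE mem_set//= in_itv/= !ltW.
have dpos : 0 < Num.min x (tau - x) by rewrite lt_min x0 subr_gt0.
rewrite -gx derive1E /derive; apply: limr_ge; first exact: dx.
near=> h.
have h0 : h != 0 by near: h; exact: nbhs_dnbhs_neq.
have : `|h| < Num.min x (tau - x) by near: h; exact: dnbhs0_lt.
rewrite lt_min ltr_norml => /andP[/andP[h1 h2]]; rewrite ltr_norml => /andP[h3 h4].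
rewrite [h *: 1]mulr1 /= -[_ *: _]/(h^-1 * (F (h + x) - F x)).
have [hp|hn|/eqP] := ltgtP h 0; last by rewrite (negbTE h0).
  rewrite nmulr_rge0 ?invr_lt0// subr_le0.
  by apply: Fmono; lra.
rewrite pmulr_rge0 ?invr_gt0// subr_ge0.
by apply: Fmono; lra.
Unshelve. all: by end_near. Qed.

End arcs.

Section trig_polynomials.
Variable R : realType.
Local Notation C := R[i].
Local Notation mu := (circle_measure R).

(** [arcfun] by Euler's formula, as a bounded function on the circle. *)
Definition arcfunL (s d : R) : Linf R :=
  (2^-1 + cos d / 4)%:C%:A - ((8^-1)%:C * cis (- s)) *: zexp R 1
  - ((8^-1)%:C * cis s) *: zexp R (-1).

Definition arcpolyL (s d : R) (n : nat) : Linf R :=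
  (1 - arcfunL s d ^+ n) ^+ (2 ^ n).

Lemma Linf_scaleE (c : C) (phi : Linf R) :
  {ae mu, forall t, (c *: phi : Linf R) t = c * phi t}.
Proof. exact: (L0_reprZ c (Linf_val phi)). Qed.

Lemma Linf_subE (phi psi : Linf R) :
  {ae mu, forall t, (phi - psi : Linf R) t = phi t - psi t}.
Proof. exact: (L0_reprB (Linf_val phi) (Linf_val psi)). Qed.

Lemma Linf_expE (phi : Linf R) n :
  {ae mu, forall t, (phi ^+ n : Linf R) t = phi t ^+ n}.
Proof.
elim: n => [|n ih]; first exact: Linf_1E.
rewrite exprS; apply: ae_imp2 (Linf_mulE phi (phi ^+ n)) ih => t -> ->.
by rewrite exprS.
Qed.

Lemma arcfunLE s d : {ae mu, forall t, arcfunL s d t = (arcfun s d t)%:C}.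
Proof.
set a := (2^-1 + cos d / 4)%:C; set b := (8^-1)%:C * cis (- s).
set c := (8^-1)%:C * cis s.
rewrite -[arcfunL s d]/(a%:A - b *: zexp R 1 - c *: zexp R (-1)).
apply: ae_imp2 (Linf_subE (a%:A - b *: zexp R 1) (c *: zexp R (-1))) _ => [t -> e|]; first exact: e.
apply: ae_imp2 (Linf_subE (a%:A) (b *: zexp R 1)) _ => [t -> e|]; first exact: e.
apply: ae_imp2 (Linf_scaleE b (zexp R 1)) _ => [t -> e|]; first exact: e.
apply: ae_imp2 (Linf_scaleE c (zexp R (-1))) _ => [t -> e|]; first exact: e.
apply: ae_imp2 (Linf_scaleE a 1) _ => [t -> e|]; first exact: e.
apply: ae_imp2 (Linf_1E R) _ => [t -> e|]; first exact: e.
apply: ae_imp2 (zexpE R 1) (zexpE R (-1)) => t -> ->.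
rewrite mulr1 -!mulrA -!cisD intrN mulN1r mul1r.
rewrite /arcfun /a; apply/eqP; rewrite eq_complex /=.
have -> : - s + t = t - s by rewrite addrC.
have -> : s - t = - (t - s) by rewrite opprB.
by rewrite cosN sinN; apply/andP; split; apply/eqP; field.
Qed.

Lemma RC_exp (x : R) n : (x ^+ n)%:C = x%:C ^+ n.
Proof. exact: (rmorphXn (real_complex R)). Qed.

Lemma RC_sub (x y : R) : (x - y)%:C = x%:C - y%:C.
Proof. exact: (rmorphB (real_complex R)). Qed.

Lemma arcpolyLE s d n :
  {ae mu, forall t, arcpolyL s d n t = (arcpoly s d n t)%:C}.
Proof.
apply: ae_imp2 (Linf_expE (1 - arcfunL s d ^+ n) (2 ^ n)) _ => [t -> e|]; first exact: e.
apply: ae_imp2 (Linf_subE 1 (arcfunL s d ^+ n)) _ => [t -> e|]; first exact: e.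
apply: ae_imp2 (Linf_expE (arcfunL s d) n) _ => [t -> e|]; first exact: e.
apply: ae_imp2 (Linf_1E R) (arcfunLE s d) => t -> ->.
by rewrite /arcpoly RC_exp (RC_sub 1) RC_exp.
Qed.

(** The functions that multiply [S] into itself form an algebra containing [z]
    and its conjugate, hence all trigonometric polynomials. *)
Lemma shift_invariant_arcpoly (S : set (Linf R)) :
  S 1 -> (forall (a : C) p q, S p -> S q -> S (a *: p + q)) ->
  (forall p, S p -> S (zexp R 1 * p)) -> (forall p, S p -> S (zexp R (-1) * p)) ->
  forall s d n, S (arcpolyL s d n) /\ S (arcpolyL s d n ^+ 2).
Proof.
move=> S1 Slin Sz Szb s d n.
pose A := [set p : Linf R | forall x, S x -> S (p * x)].
have A1 : A 1 by move=> x; rewrite mul1r.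
have Alin (a : C) p q : A p -> A q -> A (a *: p + q).
  by move=> Ap Aq x Sx; rewrite mulrDl -scalerAl; apply: Slin; [exact: Ap|exact: Aq].
have AM p q : A p -> A q -> A (p * q).
  by move=> Ap Aq x Sx; rewrite -mulrA; apply: Ap; exact: Aq.
have AX p m : A p -> A (p ^+ m).
  by move=> Ap; elim: m => [|m ih]; rewrite ?expr0// exprS; exact: AM.
have AN (a : C) p q : A p -> A q -> A (q - a *: p).
  by move=> Ap Aq; rewrite addrC -scaleNr; exact: Alin.
have A0 : A 0 by rewrite -(subrr 1) -[X in 1 - X]scale1r; exact: AN.
have Ay : A (arcfunL s d).
  apply: (AN); first exact: Szb.
  by apply: (AN); [exact: Sz|rewrite -[_%:A]addr0; exact: Alin].
have AP : A (arcpolyL s d n).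
  by apply: (AX); rewrite -[arcfunL _ _ ^+ n]scale1r; apply: AN => //; exact: AX.
split; first by rewrite -[arcpolyL _ _ _]mulr1; exact: AP.
by rewrite -[_ ^+ 2]mulr1; apply: (AX _ 2%N AP).
Qed.

Lemma L2_cintegr (f : L2 R) : cintegr f.
Proof.
apply: (@cintegr_le _ _ (fun t => 1 + normc (f t) ^+ 2)); first exact: cmeas_fun.
  move=> t; have := sqr_ge0 (normc (f t) - 1); have := normc_ge0 (f t).
  by move: (normc _) => x; nra.
apply: integrD; last exact: L2_integr.
exact: finite_measure_integrable_cst.
Qed.

Lemma integrMl_bounded (p f : R -> R) : measurable_fun setT p ->
  (forall t, 0 <= p t <= 1) -> integr f -> integr (fun t => f t * p t).
Proof.
move=> mp p01 fi; apply: (integr_le _ _ (integrable_norm fi)).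
  by apply: measurable_funM => //; exact: (measurable_EFinP _ _).1 (measurable_int _ fi).
by move=> t; have /andP[p0 p1] := p01 t; rewrite normrM ler_piMr// ger0_norm.
Qed.

Lemma arcpoly2_01 s d n (t : R) : 0 <= arcpoly s d n t ^+ 2 <= 1.
Proof.
by have /andP[p0 p1] := arcpoly_01 s d n t; rewrite sqr_ge0/= exprn_ile1.
Qed.

Lemma measurable_arcpoly2 s d n :
  measurable_fun setT (fun t : R => arcpoly s d n t ^+ 2).
Proof. by apply: measurable_funX; exact: measurable_arcpoly. Qed.

Lemma inprod_arcpoly f s d n :
  inprod (mulop (arcpolyL s d n ^+ 2) f) (Linf_L2 1) =
  (\int[mu]_t (complex.Re (f t) * arcpoly s d n t ^+ 2)) +i*
  (\int[mu]_t (complex.Im (f t) * arcpoly s d n t ^+ 2)).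
Proof.
have pm : (fun t => (arcpoly s d n t ^+ 2)%:C) \in @cmeas R.
  by apply/cmeasP; split => /=; [exact: measurable_arcpoly2|exact: measurable_cst].
rewrite (@inprodE _ _ _ (fun t => (arcpoly s d n t ^+ 2)%:C * f t) (fun=> 1)).
- congr (_ +i* _); apply: eq_Rintegral => t _; case: (f t) => a b /=; ring.
- by apply: cmeasM => //; exact: cmeas_fun.
- exact: cmeas_cst.
- apply: ae_imp2 (mulopE (arcpolyL s d n ^+ 2) f) _ => [t -> e|]; first exact: e.
  apply: ae_imp2 (Linf_expE (arcpolyL s d n) 2) (arcpolyLE s d n) => t -> ->.
  by rewrite RC_exp.
- exact: Linf_1E.
Qed.

(** The functions [p] for which [p f] has vanishing Fourier coefficients are
    stable under both shifts, so [f] is orthogonal to the squares of the arc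
    polynomials. Positivity then applies to the real and imaginary parts of [f]
    and to their opposites. *)
Lemma fourier_uniqueness (f : L2 R) : (forall k, fourier f k = 0) -> f = 0.
Proof.
move=> f0.
pose S := [set p : Linf R | forall k, fourier (mulop p f) k = 0].
have S2 s d n : S (arcpolyL s d n ^+ 2).
  apply: (fun a b c e => (@shift_invariant_arcpoly S a b c e s d n).2).
  - by move=> k; rewrite mulop1.
  - move=> a p q Sp Sq k; rewrite /fourier mulopDl mulopZl inprodDl inprodZl.
    by rewrite [inprod _ _]Sp [X in _ + X]Sq mulr0 addr0.
  - move=> p Sp k; rewrite /fourier mulopM inprod_mulop Linf_conj_zexp mulop_Linf.
    by rewrite -zexpD; exact: Sp.
  - move=> p Sp k; rewrite /fourier mulopM inprod_mulop Linf_conj_zexp mulop_Linf.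
    by rewrite -zexpD; exact: Sp.
have h s d n : inprod (mulop (arcpolyL s d n ^+ 2) f) (Linf_L2 1) = 0.
  by rewrite -zexp_0; exact: S2.
have [ri ii] := L2_cintegr f.
have ae0 q : integr q -> (forall s d n, \int[mu]_t (q t * arcpoly s d n t ^+ 2) = 0) ->
    {ae mu, forall t, q t = 0}.
  move=> qi q0.
  have h1 : {ae mu, forall t, 0 <= q t}.
    by apply: arc_positivity => // s d n; rewrite q0.
  have h2 : {ae mu, forall t, 0 <= - q t}.
    apply: arc_positivity => [|s d n]; first exact: integrN.
    under eq_Rintegral do rewrite mulNr -mulN1r.
    rewrite RintegralZl ?q0 ?mulr0//.
    apply: integrMl_bounded => //; first exact: measurable_arcpoly2.
    exact: arcpoly2_01.
  apply: ae_imp2 h1 h2 => t; rewrite oppr_ge0 => q1 q2.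
  by apply/eqP; rewrite eq_le q1 q2.
apply: nsq_eq0; rewrite (@nsqE _ f (fun=> 0)).
- by under eq_Rintegral do rewrite normc0 expr0n; rewrite Rintegral_cst// mul0r.
- exact: cmeas_cst.
apply: ae_imp2 (ae0 _ ri _) (ae0 _ ii _) => [t||].
- by case: (f t) => a b /= -> ->.
- by move=> s d n; have := h s d n; rewrite inprod_arcpoly => -[].
- by move=> s d n; have := h s d n; rewrite inprod_arcpoly => -[].
Qed.

(** The hypothesis says that [B - |chi| ^ 2] is nonnegative when integrated
    against the squares of the arc polynomials, hence a.e. nonnegative. *)
Lemma bounded_multiplier (chi : L2 R) (B : R) :
  (forall s d n, nsq (mulop (arcpolyL s d n) chi) <=
                 B * nsq (Linf_L2 (arcpolyL s d n))) ->
  exists psi : Linf R, Linf_L2 psi = chi.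
Proof.
move=> hB.
suff chiL : (chi : L0 R) \in @inLinf R by exists (MkLinf chiL); exact: val_inj.
have q0 : {ae mu, forall t, 0 <= B - normc (chi t) ^+ 2}.
  have ci : integr (fun=> B) by exact: finite_measure_integrable_cst.
  apply: arc_positivity => [|s d n].
    by apply: integrB => //; exact: L2_integr.
  have pm : (fun t => (arcpoly s d n t)%:C) \in @cmeas R.
    by apply/cmeasP; split => /=; [exact: measurable_arcpoly|exact: measurable_cst].
  have := hB s d n.
  rewrite (@nsqE _ _ (fun t => (arcpoly s d n t)%:C * chi t)); last 2 first.
  - by apply: cmeasM => //; exact: cmeas_fun.
  - apply: ae_imp2 (mulopE (arcpolyL s d n) chi) (arcpolyLE s d n) => t -> -> //.
  rewrite (@nsqE _ _ (fun t => (arcpoly s d n t)%:C))//; last exact: arcpolyLE.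
  have nr (x : R) : normc x%:C ^+ 2 = x ^+ 2 by rewrite normc_sqr /= expr0n addr0.
  under eq_Rintegral do rewrite normcM exprMn nr mulrC.
  under [in X in _ <= X]eq_Rintegral do rewrite nr.
  under [in X in _ -> X]eq_Rintegral do rewrite mulrBl.
  rewrite RintegralB//; last 2 first.
  - by apply: integrMl_bounded => //; [exact: measurable_arcpoly2|exact: arcpoly2_01].
  - apply: integrMl_bounded; [exact: measurable_arcpoly2|exact: arcpoly2_01|].
    exact: L2_integr.
  rewrite subr_ge0 RintegralZl//.
  have -> : (fun t => arcpoly s d n t ^+ 2) = (fun t => 1 * arcpoly s d n t ^+ 2).
    by apply/funext => t; rewrite mul1r.
  apply: integrMl_bounded; [exact: measurable_arcpoly2|exact: arcpoly2_01|].
  exact: finite_measure_integrable_cst.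
apply/inLinfP; exists (Num.sqrt B); apply: ae_imp q0 => t.
rewrite subr_ge0 => h; rewrite -[leLHS]ger0_norm ?normc_ge0// -sqrtr_sqr.
exact: ler_wsqrtr.
Qed.

End trig_polynomials.

(** * Second-order estimates for analytic functions *)

Section real_bounds.
Variable R : realType.
Implicit Types x : R.

Lemma expR_quad x : `|x| <= 2^-1 -> `|expR x - 1 - x| <= 2 * x ^+ 2.
Proof.
rewrite ler_norml => /andP[x1 x2].
have h1 : 1 + x <= expR x by exact: expR_ge1Dx.
have h2 : 1 - x <= expR (- x) by exact: expR_ge1Dx.
have e0 := expR_gt0 x.
have : expR x * (1 - x) <= 1.
  by rewrite -[leRHS](expRxMexpNx_1 x) ler_wpM2l// ltW.
rewrite ler_norml => h3; apply/andP; split; first by nra.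
have : expR x - 1 - x <= x ^+ 2 * expR x by nra.
have : expR x <= 2 by nra.
by have := sqr_ge0 x; nra.
Qed.

Lemma sin_abs x : `|sin x| <= `|x|.
Proof.
wlog x0 : x / 0 <= x.
  move=> h; have [/h//|/ltW] := leP 0 x.
  by rewrite -oppr_ge0 => /h; rewrite sinN !normrN.
have [|c _] := @MVT_segment R sin cos 0 x x0.
  exact/continuous_subspaceT/continuous_sin.
rewrite sin0 !subr0 => ->; rewrite normrM ler_piMl//.
by rewrite ler_norml cos_geN1 cos_le1.
Qed.

Lemma cos_quad x : `|cos x - 1| <= x ^+ 2.
Proof.
have -> : cos x - 1 = - 2 * sin (x / 2) ^+ 2.
  have {1}-> : x = x / 2 *+ 2 by rewrite mulr2n; field.
  by rewrite cos_mulr2n cos2sin2 mulr2n; ring.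
rewrite normrM normrX normrN (@ger0_norm _ 2)//.
have := sin_abs (x / 2); have : `|x / 2| ^+ 2 = x ^+ 2 / 4.
  by rewrite real_normK ?num_real// expr_div_n -natrX.
have := normr_ge0 (sin (x / 2)); have := sqr_ge0 x.
move: `|sin _| `|x / 2| => a b; nra.
Qed.

Lemma sin_quad x : `|x| <= 1 -> `|sin x - x| <= x ^+ 2.
Proof.
wlog x0 : x / 0 <= x.
  move=> h; have [/h//|/ltW] := leP 0 x.
  rewrite -oppr_ge0 => /h; rewrite sinN -opprB opprK addrC normrN sqrrN.
  by rewrite normrN.
move=> x1; have [|c] := @MVT_segment R (fun y => sin y - y) (fun y => cos y - 1) 0 x x0.
  apply/continuous_subspaceT => y; apply: cvgB; first exact: continuous_sin.
  exact: cvg_id.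
rewrite in_itv/= => /andP[c0 cx]; rewrite sin0 !subr0 => ->.
rewrite normrM (ger0_norm x0).
have := cos_quad c; move: x1; rewrite (ger0_norm x0) => x1.
have := normr_ge0 (cos c - 1); move: `|cos c - 1| => a; nra.
Qed.

End real_bounds.

Section complex_estimates.
Variable R : realType.
Local Notation C := R[i].

Lemma normc_le_abs (a b : R) : normc (a +i* b) <= `|a| + `|b|.
Proof.
rewrite -(@ler_pXn2r _ 2)// ?nnegrE ?normc_ge0 ?addr_ge0// normc_sqr /=.
have := normr_ge0 a; have := normr_ge0 b.
rewrite -(real_normK (num_real a)) -(real_normK (num_real b)).
by move: `|a| `|b| => x y; nra.
Qed.

Lemma normcRC (x : R) : normc x%:C = `|x|.
Proof. by rewrite /= expr0n addr0 sqrtr_sqr. Qed.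

(** The increment of the exponential along the real direction, compensated by
    the one along the imaginary direction. *)
Definition cr_exp (x : R) : C := ((expR x)%:C - 1) + 'i * (cis x - 1).

Lemma cr_exp_quad x : `|x| <= 2^-1 -> normc (cr_exp x) <= 4 * x ^+ 2.
Proof.
move=> x2; have -> : cr_exp x = (expR x - 1 - x - (sin x - x)) +i* (cos x - 1).
  by apply/eqP; rewrite eq_complex /=; apply/andP; split; apply/eqP; ring.
apply: le_trans (normc_le_abs _ _) _.
have h1 := expR_quad x2.
have h2 := @sin_quad _ x (le_trans x2 _).
have h3 := cos_quad x.
apply: (@le_trans _ _ (`|expR x - 1 - x| + `|sin x - x| + `|cos x - 1|)).
  by rewrite lerD2r; exact: ler_normB.
have := h2 _; move: `|expR _ - 1 - x| `|sin x - x| `|cos x - 1| h1 h3 {h2} => a b c h1 h3 h2.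
have : b <= x ^+ 2 by apply: h2; lra.
lra.
Qed.

Lemma expR1_lin (x : R) : `|x| <= 2^-1 -> `|expR x - 1| <= 2 * `|x|.
Proof.
move=> x2; have h := expR_quad x2.
have -> : expR x - 1 = (expR x - 1 - x) + x by ring.
apply: le_trans (ler_normD _ _) _.
move: h x2; rewrite -[x ^+ 2](real_normK (num_real x)); have := normr_ge0 x.
by move: `|x| `|_ - x| => a b; nra.
Qed.

Lemma cis1_lin (x : R) : normc (cis x - 1) <= 2 * `|x|.
Proof.
have -> : cis x - 1 = (cos x - 1) +i* sin x.
  by apply/eqP; rewrite eq_complex /= subr0 !eqxx.
rewrite -(@ler_pXn2r _ 2)// ?nnegrE ?normc_ge0 ?mulr_ge0// normc_sqr /=.
have -> : (cos x - 1) ^+ 2 + sin x ^+ 2 = 2 * - (cos x - 1).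
  by rewrite sin2cos2; ring.
rewrite exprMn real_normK ?num_real//.
have := cos_quad x; rewrite ler_norml => /andP[+ _].
by have := sqr_ge0 x; lra.
Qed.

Lemma cis_lin (x y : R) : normc (cis x - cis y) <= 2 * `|x - y|.
Proof.
have -> : cis x - cis y = cis y * (cis (x - y) - 1).
  by rewrite mulrBr mulr1 -cisD [y + _]addrC subrK.
by rewrite normcM normc_cis mul1r cis1_lin.
Qed.

(** Convergence with real tolerances, which combine directly with estimates on
    [normc]. *)
Definition ccvg (u : nat -> C) (l : C) :=
  forall e : R, 0 < e -> exists N, forall n, (N <= n)%N -> normc (u n - l) < e.

Lemma ccvg_le (u : nat -> C) l b : ccvg u l -> (forall n, normc (u n) <= b) ->
  normc l <= b.
Proof.
move=> ul ub; apply/ler_addgt0Pr => e e0; have [N /(_ N (leqnn N)) h] := ul e e0.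
have -> : l = u N - (u N - l) by rewrite opprB addrC subrK.
by rewrite (le_trans (normcD_le _ _))// normcN lerD// ltW.
Qed.

Lemma ccvgD u v l m : ccvg u l -> ccvg v m -> ccvg (fun n => u n + v n) (l + m).
Proof.
move=> ul vm e e0; have e20 : 0 < e / 2 by rewrite divr_gt0.
have [N hN] := ul _ e20; have [M hM] := vm _ e20.
exists (maxn N M) => n; rewrite geq_max => /andP[Nn Mn].
rewrite opprD addrACA (le_lt_trans (normcD_le _ _))// [ltRHS]splitr ltrD//.
  exact: hN.
exact: hM.
Qed.

Lemma ccvgZ (c : C) u l : ccvg u l -> ccvg (fun n => c * u n) (c * l).
Proof.
move=> ul e e0.
have c0 : 0 < normc c + 1 by rewrite ltr_wpDl// normc_ge0.
have [N hN] := ul (e / (normc c + 1)) (divr_gt0 e0 c0).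
exists N => n /hN h; rewrite -mulrBr normcM.
rewrite ltr_pdivlMr// in h; apply: le_lt_trans h.
by rewrite mulrC ler_wpM2l ?normc_ge0// lerDl.
Qed.

Lemma ccvgB u v l m : ccvg u l -> ccvg v m -> ccvg (fun n => u n - v n) (l - m).
Proof.
move=> ul vm; rewrite -mulN1r; under [X in ccvg X]eq_fun do rewrite -mulN1r.
by apply: ccvgD => //; exact: ccvgZ.
Qed.

(** By induction, the remainder at [n + 1] is [w'] times the remainder at [n]
    plus [n w ^ (n - 1) (w' - w) ^ 2]. Writing [rho ^ n / rho ^ 2] for the
    power of exponent [n - 2] covers [n < 2] as well. *)
Lemma monomial_taylor (w w' : C) (rho : R) n : 0 < rho -> normc w <= rho ->
  normc w' <= rho ->
  normc (w' ^+ n - w ^+ n - n%:R * w ^+ n.-1 * (w' - w)) <=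
  n%:R ^+ 2 * rho ^+ n / rho ^+ 2 * normc (w' - w) ^+ 2.
Proof.
move=> r0 wr wr'.
have nX (m : nat) : normc (w ^+ m) <= rho ^+ m.
  elim: m => [|m ih]; first by rewrite !expr0 normc1.
  by rewrite !exprS normcM ler_pM// normc_ge0.
have nn (m : nat) : normc (m%:R : C) = m%:R.
  by rewrite -(rmorph_nat (real_complex R)) normcRC normr_nat.
elim: n => [|n ih].
  by rewrite !expr0 subrr mul0r mul0r subrr normc0 expr0n mul0r mul0r mul0r.
have -> : w' ^+ n.+1 - w ^+ n.+1 - n.+1%:R * w ^+ n.+1.-1 * (w' - w) =
  w' * (w' ^+ n - w ^+ n - n%:R * w ^+ n.-1 * (w' - w)) +
  n%:R * w ^+ n.-1 * (w' - w) ^+ 2.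
  rewrite /= -natr1 !exprS; case: n {ih} => [|n] /=; first by rewrite !expr0; ring.
  by rewrite !exprS; ring.
apply: le_trans (normcD_le _ _) _; rewrite !normcM.
set d := normc (w' - w) in ih *.
apply: (@le_trans _ _ (rho * (n%:R ^+ 2 * rho ^+ n / rho ^+ 2 * d ^+ 2) +
    n%:R * rho ^+ n / rho * d ^+ 2)).
  rewrite lerD//; first by rewrite ler_pM// normc_ge0.
  rewrite -expr2 ler_wpM2r ?sqr_ge0//.
  rewrite nn -mulrA; case: n {ih} => [|n] /=; first by rewrite !mul0r.
  by rewrite ler_wpM2l// exprS mulrAC divff ?mul1r// gt_eqF.
have d0 : 0 <= d ^+ 2 by exact: sqr_ge0.
have -> : rho * (n%:R ^+ 2 * rho ^+ n / rho ^+ 2 * d ^+ 2) =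
    n%:R ^+ 2 * rho ^+ n.+1 / rho ^+ 2 * d ^+ 2.
  rewrite (exprS rho n); move: (rho ^+ n) (n%:R ^+ 2 : R) => q m.
  by rewrite !mulrA [rho * m]mulrC.
have -> : n%:R * rho ^+ n / rho * d ^+ 2 = n%:R * rho ^+ n.+1 / rho ^+ 2 * d ^+ 2.
  rewrite (exprS rho n); congr (_ * _); rewrite -!mulrA; congr (_ * _).
  by move: (rho ^+ n) => q; field; rewrite gt_eqF.
rewrite -!mulrDl ler_wpM2r// ler_wpM2r ?invr_ge0 ?exprn_ge0 ?(ltW r0)//.
rewrite ler_wpM2r ?exprn_ge0 ?(ltW r0)// -natr1; have := ler0n R n; nra.
Qed.

(** Bounded terms at radius [8 rho] leave, at radius [rho], room for weights
    growing like [4 ^ n]: the quotient is geometric of ratio [1 / 2]. *)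
Lemma power_sum_le (a : nat -> C) (M rho : R) (c : nat -> R) N : 0 < rho ->
  (forall n, normc (a n) * (8 * rho) ^+ n <= M) ->
  (forall n, 0 <= c n <= 4 ^+ n) ->
  \sum_(k < N) normc (a k) * (c k * rho ^+ k) <= 2 * M.
Proof.
move=> r0 aM c4.
have M0 : 0 <= M.
  by apply: le_trans (aM 0%N); rewrite mulr_ge0 ?normc_ge0// exprn_ge0// mulr_ge0// ltW.
apply: (@le_trans _ _ (2 * M - 2 * M * 2^-1 ^+ N)); last first.
  by rewrite gerBl !mulr_ge0// exprn_ge0// invr_ge0.
elim: N => [|N ih]; first by rewrite big_ord0 expr0 mulr1 subrr.
rewrite big_ord_recr /=.
suff : normc (a N) * (c N * rho ^+ N) <= M * 2^-1 ^+ N.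
  by move: ih; rewrite exprS; move: (\sum_(_ < _) _) (_ * (_ * _)) => x y; lra.
have /andP[c0 c4'] := c4 N.
rewrite (_ : 2^-1 ^+ N = 4 ^+ N * 8^-1 ^+ N); last first.
  by rewrite -exprMn; congr (_ ^+ _); field.
rewrite (_ : _ * (_ * _) = normc (a N) * (8 * rho) ^+ N * (c N * 8^-1 ^+ N)).
  by rewrite ler_pM// ?ler_wpM2r ?mulr_ge0 ?normc_ge0 ?exprn_ge0 ?invr_ge0 ?mulr_ge0 ?(ltW r0).
by rewrite exprMn exprVn; field; rewrite expf_neq0.
Qed.

Lemma cvg_ccvg (u : nat -> C) (l : C) :
  (u : nat -> C^o) @ \oo --> (l : C^o) -> ccvg u l.
Proof.
move=> ul e e0.
have e0' : (0 : C) < e%:C by rewrite ltcR.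
have [N _ hN] := @cvgr_dist_lt C C^o nat _ _ u l ul _ e0'.
exists N => n Nn; have := hN n Nn.
by rewrite /= -ltcR -[normc (u n - l)]normcN opprB.
Qed.

Lemma ccvg_increment_bounded (u : nat -> C) l : ccvg u l ->
  exists M, forall n, normc (u n.+1 - u n) <= M.
Proof.
move=> ul; have [N hN] := ul 1 ltr01.
exists (2 + \sum_(k < N) normc (u k.+1 - u k)) => n.
have [Nn|nN] := leqP N n.
  have h1 := hN _ Nn; have h2 := hN _ (leqW Nn).
  have -> : u n.+1 - u n = (u n.+1 - l) - (u n - l) by rewrite opprB addrA subrK.
  apply: (@le_trans _ _ 2); last by rewrite lerDl sumr_ge0// => k _; exact: normc_ge0.
  apply: le_trans (normcD_le _ _) _; rewrite normcN.
  by rewrite -[2]/(1 + 1) lerD// ltW.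
rewrite (bigD1 (Ordinal nN))//= addrCA lerDl addr_ge0// sumr_ge0// => k _.
exact: normc_ge0.
Qed.

(** Differentiability of a power series is used only through second-order
    Taylor estimates. These hold for its partial sums with a common constant on
    a smaller disk, and the inequalities deduced from them pass to the limit. *)
Lemma analytic_C11 (F : C -> C) (z0 : C) : analytic_at F z0 ->
  exists rho B (P : nat -> C -> C), [/\ 0 < rho, 0 <= B,
    forall z, normc (z - z0) <= rho -> ccvg (P^~ z) (F z) &
    forall N z, normc (z - z0) <= rho ->
      exists L, [/\ normc L <= B, normc (P N z) <= B &
        forall z', normc (z' - z0) <= rho ->
          normc (P N z' - P N z - L * (z' - z)) <= B * normc (z' - z) ^+ 2]].
Proof.
move=> [a [r [r0 aF]]].
(* The terms are bounded at radius [r / 2 = 8 rho], where the series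
   converges. *)
pose rho := r / 16.
have rho0 : 0 < rho by rewrite divr_gt0.
pose P N z := \sum_(k < N) a k * (z - z0) ^+ k.
have PF z : normc (z - z0) < r -> ccvg (P^~ z) (F z).
  move=> zr; have := cvg_ccvg (aF z zr); rewrite /P.
  suff -> : series (fun n => a n * (z - z0) ^+ n : C^o) =
            (fun N => \sum_(k < N) a k * (z - z0) ^+ k) by [].
  by apply/funext => N; rewrite seriesEord.
have [M hM] : exists M, forall n, normc (a n) * (8 * rho) ^+ n <= M.
  have zr : normc (z0 + (r / 2)%:C - z0) < r.
    by rewrite addrC addKr normcRC ger0_norm ?divr_ge0 ?ltW//; lra.
  have [M hM] := ccvg_increment_bounded (PF _ zr).
  exists M => n; have := hM n; rewrite /P big_ord_recr /= [X in normc (X - _)]addrC addrK normcM.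
  rewrite [z0 + _]addrC addrK (_ : 8 * rho = r / 2); last by rewrite /rho; field.
  suff -> : normc ((r / 2)%:C ^+ n) = (r / 2) ^+ n by [].
  by rewrite -(rmorphXn (real_complex R)) normcRC ger0_norm// exprn_ge0// divr_ge0// ltW.
have M0 : 0 <= M.
  by apply: le_trans (hM 0%N); rewrite mulr_ge0 ?normc_ge0// exprn_ge0// mulr_ge0// ltW.
have ksum c N := @power_sum_le a M rho c N rho0 hM.
have k4 (k : nat) : (k%:R : R) <= 2 ^+ k by rewrite -natrX ler_nat ltnW// ltn_expl.
have k44 (k : nat) : (k%:R : R) ^+ 2 <= 4 ^+ k.
  have -> : 4 = 2 ^+ 2 :> R by rewrite -natrX.
  rewrite -exprM mulnC exprM.
  by rewrite ler_pXn2r// ?nnegrE ?exprn_ge0.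
pose B := 2 * M * (1 + rho^-1 + (rho ^+ 2)^-1).
have i1 : 0 <= rho^-1 by rewrite invr_ge0 ltW.
have i2 : 0 <= (rho ^+ 2)^-1 by rewrite invr_ge0 sqr_ge0.
have normX (w : C) k : normc w <= rho -> normc (w ^+ k) <= rho ^+ k.
  move=> wr; elim: k => [|m ih]; first by rewrite !expr0 normc1.
  by rewrite !exprS normcM ler_pM// normc_ge0.
have nn (m : nat) : normc (m%:R : C) = m%:R.
  by rewrite -(rmorph_nat (real_complex R)) normcRC normr_nat.
have nsum N (f : nat -> C) (g : nat -> R) : (forall k, normc (f k) <= g k) ->
    normc (\sum_(k < N) f k) <= \sum_(k < N) g k.
  move=> fg; elim: N => [|N ih]; first by rewrite !big_ord0 normc0.
  by rewrite !big_ord_recr/= (le_trans (normcD_le _ _))// lerD.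
exists rho, B, P; split => //.
- by rewrite mulr_ge0 ?mulr_ge0// !addr_ge0.
- by move=> z zr; apply: PF; apply: le_lt_trans zr _; rewrite /rho; lra.
move=> N z zr; exists (\sum_(k < N) a k * (k%:R * (z - z0) ^+ k.-1)); split.
- apply: (@le_trans _ _ (\sum_(k < N) normc (a k) * (k%:R * rho ^+ k) / rho)).
    apply: (nsum N (fun k => a k * (k%:R * (z - z0) ^+ k.-1))
      (fun k => normc (a k) * (k%:R * rho ^+ k) / rho)) => k.
    rewrite normcM -mulrA ler_wpM2l ?normc_ge0// normcM nn.
    case: k => [|k]; first by rewrite !mul0r.
    rewrite -mulrA ler_wpM2l// exprS mulrAC divff ?mul1r; first exact: normX.
    by rewrite gt_eqF.
  rewrite -mulr_suml; apply: (@le_trans _ _ (2 * M / rho)).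
    rewrite ler_wpM2r//; apply: (ksum (fun k => k%:R)) => k.
    by rewrite ler0n (le_trans (k4 k))// lerXn2r ?nnegrE// ler_nat.
  by rewrite ler_wpM2l ?mulr_ge0// addrAC lerDr addr_ge0.
- apply: (@le_trans _ _ (\sum_(k < N) normc (a k) * (1 * rho ^+ k))).
    apply: (nsum N (fun k => a k * (z - z0) ^+ k)
      (fun k => normc (a k) * (1 * rho ^+ k))) => k.
    by rewrite mul1r normcM ler_wpM2l ?normc_ge0// normX.
  apply: (@le_trans _ _ (2 * M)).
    by apply: (ksum (fun=> 1)) => k; rewrite ler01 exprn_ege1// ler1n.
  by rewrite -[leLHS]mulr1 ler_wpM2l ?mulr_ge0// -addrA lerDl addr_ge0.
- move=> z' zr'.
  have -> : P N z' - P N z - (\sum_(k < N) a k * (k%:R * (z - z0) ^+ k.-1)) * (z' - z)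
    = \sum_(k < N) a k * ((z' - z0) ^+ k - (z - z0) ^+ k
        - k%:R * (z - z0) ^+ k.-1 * ((z' - z0) - (z - z0))).
    rewrite /P mulr_suml -!sumrB; apply: eq_bigr => k _.
    have -> : z' - z0 - (z - z0) = z' - z by ring.
    by ring.
  apply: (@le_trans _ _ (\sum_(k < N) normc (a k) * (k%:R ^+ 2 * rho ^+ k) *
      ((rho ^+ 2)^-1 * normc (z' - z) ^+ 2))).
    apply: (nsum N (fun k => a k * ((z' - z0) ^+ k - (z - z0) ^+ k
        - k%:R * (z - z0) ^+ k.-1 * ((z' - z0) - (z - z0))))
      (fun k => normc (a k) * (k%:R ^+ 2 * rho ^+ k) *
      ((rho ^+ 2)^-1 * normc (z' - z) ^+ 2))) => k.
    rewrite normcM -!mulrA ler_wpM2l ?normc_ge0//.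
    have := monomial_taylor k rho0 zr zr'.
    have -> : z' - z0 - (z - z0) = z' - z by ring.
    by rewrite !mulrA.
  rewrite -mulr_suml mulrA ler_wpM2r ?sqr_ge0//.
  apply: (@le_trans _ _ (2 * M / rho ^+ 2)).
    by rewrite ler_wpM2r//; apply: (ksum (fun k => k%:R ^+ 2)) => k; rewrite sqr_ge0 k44.
  by rewrite ler_wpM2l ?mulr_ge0// lerDr addr_ge0.
Qed.

End complex_estimates.

(** * Cauchy-Riemann equations without derivatives *)

Section cauchy_riemann.
Variable R : realType.
Local Notation C := R[i].
Local Notation tau := (2 * pi : R).

(** For [G z = z ^ k * F z] in logarithmic polar coordinates [z = e^(s + it)],
    this is [z ^ (-k)] times the radial increment of [G] plus ['i] times its
    angular increment; it is quadratic in [h] by the Cauchy-Riemann equations. *)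
Definition crE (k : int) (F : C -> C) (z : C) (h : R) : C :=
  ((expR (k%:~R * h))%:C * F (z * (expR h)%:C) - F z) +
  'i * (cis (k%:~R * h) * F (z * cis h) - F z).

Let crE_ring1 (a b c d i : C) : a * (b - 1) + i * (c * (d - 1)) =
  a * b - 1 + i * (c * d - 1) - (a - 1 + i * (c - 1)).
Proof. ring. Qed.

Let crE_ring2 (a b c d i L z u u1 u2 : C) :
  a * u1 - u + i * (c * u2 - u) =
  u * (a - 1 + i * (c - 1)) + L * z * (a * (b - 1) + i * (c * (d - 1))) +
  a * (u1 - u - L * (z * b - z)) + i * (c * (u2 - u - L * (z * d - z))).
Proof. ring. Qed.

(** The first-order part of [crE] is the sum of [u z * k] and [L * z] times
    [h + 'i * ('i * h) = 0]; what remains are the second-order parts of the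
    exponentials, collected in [cr_exp], and the Taylor remainders of [u]. *)
Lemma crE_bound (k : int) : exists delta K : R, [/\ 0 < delta, 0 <= K &
  forall u (z L : C) (B h : R), normc z <= 1 -> `|h| <= delta ->
    normc L <= B -> normc (u z) <= B ->
    normc (u (z * (expR h)%:C) - u z - L * (z * (expR h)%:C - z)) <=
      B * normc (z * (expR h)%:C - z) ^+ 2 ->
    normc (u (z * cis h) - u z - L * (z * cis h - z)) <=
      B * normc (z * cis h - z) ^+ 2 ->
    normc (crE k u z h) <= K * B * h ^+ 2].
Proof.
set m : R := `|k%:~R| + 1.
have m1 : 1 <= m by rewrite lerDr.
have m0 : 0 < m by apply: lt_le_trans m1.
exists (2 * m)^-1, (12 * m ^+ 2 + 12); split.
- by rewrite invr_gt0 mulr_gt0.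
- by rewrite addr_ge0// mulr_ge0// sqr_ge0.
move=> u z L B h z1 hd LB uB r1B r2B.
have B0 : 0 <= B by exact: le_trans (normc_ge0 _) LB.
have mh : m * `|h| <= 2^-1.
  by rewrite mulrC -ler_pdivlMr// -invfM.
have h0 := normr_ge0 h.
have h2 : `|h| <= 2^-1 by apply: le_trans mh; rewrite ler_peMl.
have kh x : `|x| <= m -> `|x * h| <= 2^-1.
  by move=> xm; apply: le_trans mh; rewrite normrM ler_wpM2r.
have km : `|k%:~R : R| <= m by rewrite /m lerDl.
have k1m : `|k%:~R + 1 : R| <= m by rewrite /m (le_trans (ler_normD _ _))// normr1.
set r1 := u (z * (expR h)%:C) - u z - L * (z * (expR h)%:C - z) in r1B.
set r2 := u (z * cis h) - u z - L * (z * cis h - z) in r2B.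
have crD : (expR (k%:~R * h))%:C * ((expR h)%:C - 1) +
    'i * (cis (k%:~R * h) * (cis h - 1)) =
    cr_exp ((k%:~R + 1) * h) - cr_exp (k%:~R * h).
  rewrite /cr_exp mulrDl mul1r expRD cisD (rmorphM (real_complex R)).
  exact: crE_ring1.
have -> : crE k u z h = u z * cr_exp (k%:~R * h) +
    L * z * (cr_exp ((k%:~R + 1) * h) - cr_exp (k%:~R * h)) +
    (expR (k%:~R * h))%:C * r1 + 'i * (cis (k%:~R * h) * r2).
  rewrite -crD /crE /r1 /r2 /cr_exp.
  exact: crE_ring2.
have crb x : `|x| <= m -> normc (cr_exp (x * h)) <= 4 * m ^+ 2 * h ^+ 2.
  move=> xm; apply: le_trans (cr_exp_quad (kh _ xm)) _.
  rewrite exprMn mulrA ler_wpM2r ?sqr_ge0// ler_wpM2l//.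
  by rewrite -[x ^+ 2](real_normK (num_real x)) ler_pXn2r// nnegrE ltW.
have zz (c : C) : normc (c - 1) <= 2 * `|h| -> normc (z * c - z) ^+ 2 <= 4 * h ^+ 2.
  move=> c1; rewrite -{2}[z]mulr1 -mulrBr normcM exprMn.
  have -> : 4 * h ^+ 2 = 1 * (2 * `|h|) ^+ 2.
    by rewrite exprMn real_normK ?num_real// mul1r -natrX.
  by rewrite ler_pM ?sqr_ge0// ?exprn_ile1 ?normc_ge0// ler_pXn2r// nnegrE ?normc_ge0 ?mulr_ge0.
have r1b : normc r1 <= B * (4 * h ^+ 2).
  apply: le_trans r1B _; rewrite ler_wpM2l//; apply: zz.
  by rewrite -(rmorph1 (real_complex R)) -(rmorphB (real_complex R)) normcRC expR1_lin.
have r2b : normc r2 <= B * (4 * h ^+ 2).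
  by apply: le_trans r2B _; rewrite ler_wpM2l//; apply: zz; exact: cis1_lin.
have ek : normc (expR (k%:~R * h))%:C <= 2.
  rewrite normcRC; have := expR1_lin (kh _ km); have := kh _ km.
  rewrite (ger0_norm (expR_ge0 _)) => a b.
  have := le_trans (ler_norm _) b; lra.
have i1 : normc ('i : C) = 1 by rewrite /= expr0n expr1n add0r sqrtr1.
rewrite (_ : (12 * m ^+ 2 + 12) * B * h ^+ 2 = B * (4 * m ^+ 2 * h ^+ 2) +
  B * 1 * (4 * m ^+ 2 * h ^+ 2 + 4 * m ^+ 2 * h ^+ 2) +
  2 * (B * (4 * h ^+ 2)) + 1 * (1 * (B * (4 * h ^+ 2)))); last by ring.
apply: le_trans (normcD_le _ _) _; apply: lerD; last first.
  by rewrite !normcM i1 !mul1r normc_cis mul1r.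
apply: le_trans (normcD_le _ _) _; apply: lerD; last first.
  by rewrite normcM ler_pM ?normc_ge0.
apply: le_trans (normcD_le _ _) _; apply: lerD.
  by rewrite normcM ler_pM ?normc_ge0// crb.
rewrite !normcM ler_pM ?mulr_ge0 ?normc_ge0//; first by rewrite ler_pM ?normc_ge0.
by apply: le_trans (normcD_le _ _) _; rewrite normcN lerD// crb.
Qed.

(** The bound is required for every [M] above the local constant [M0], so that
    finitely many local constants have a common one. *)
Lemma crE_near (k : int) (F : C -> C) (r t0 : R) : 0 <= r <= 1 ->
  analytic_at F (r%:C * cis t0) ->
  exists M0 : R, 0 < M0 /\ forall t M h : R, `|t - t0| < M0^-1 -> M0 <= M ->
    `|h| < M^-1 -> normc (crE k F (r%:C * cis t) h) <= M * h ^+ 2.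
Proof.
move=> /andP[r0 r1] /analytic_C11[rho [B [P [rho0 B0 PF PC]]]].
have [delta [K [d0 K0 hK]]] := crE_bound k.
exists (4 / rho + delta^-1 + K * B + 1 + 2).
have p1 : 0 < 4 / rho by rewrite divr_gt0.
have p2 : 0 < delta^-1 by rewrite invr_gt0.
have p3 : 0 <= K * B by rewrite mulr_ge0.
split; first by lra.
set M0 := (X in X^-1).
move=> t M h tM MM hM.
have M00 : 0 < M0 by rewrite /M0; lra.
have Mp : 0 < M by apply: lt_le_trans MM.
have small (x : R) c : 0 < c -> `|x| < M0^-1 -> c <= M0 -> `|x| <= c^-1.
  by move=> c0 xM cM; rewrite (le_trans (ltW xM))// lef_pV2.
have hM0 : `|h| < M0^-1 by apply: lt_le_trans hM _; rewrite lef_pV2.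
have h4 : `|h| <= rho / 4 by rewrite -[rho / 4]invrK invf_div; apply: small => //; rewrite /M0; lra.
have t4 : `|t - t0| <= rho / 4.
  by rewrite -[rho / 4]invrK invf_div; apply: small => //; rewrite /M0; lra.
have hd : `|h| <= delta by rewrite -[delta]invrK; apply: small => //; rewrite /M0; lra.
have h2 : `|h| <= 2^-1 by apply: small => //; rewrite /M0; lra.
set z := r%:C * cis t; set z0 := r%:C * cis t0 in PF PC.
have nr : normc r%:C <= 1 by rewrite normcRC ger0_norm.
have z1 : normc z <= 1 by rewrite normcM normc_cis mulr1.
have zz0 : normc (z - z0) <= rho / 2.
  rewrite -mulrBr normcM; apply: (@le_trans _ _ (1 * (2 * (rho / 4)))); last by lra.
  rewrite ler_pM ?normc_ge0// (le_trans (cis_lin _ _))// ler_wpM2l//.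
have near (c : C) : normc (c - 1) <= 2 * `|h| -> normc (z * c - z0) <= rho.
  move=> c1; have -> : z * c - z0 = z * (c - 1) + (z - z0) by ring.
  apply: le_trans (normcD_le _ _) _; rewrite normcM.
  apply: (@le_trans _ _ (1 * (2 * (rho / 4)) + rho / 2)); last by lra.
  by rewrite lerD// ler_pM ?normc_ge0// (le_trans c1)// ler_wpM2l.
have na : normc (z * (expR h)%:C - z0) <= rho.
  apply: near.
  by rewrite -(rmorph1 (real_complex R)) -(rmorphB (real_complex R)) normcRC expR1_lin.
have nb : normc (z * cis h - z0) <= rho by apply: near; exact: cis1_lin.
have nz : normc (z - z0) <= rho by apply: le_trans zz0 _; lra.
apply: (@le_trans _ _ (K * B * h ^+ 2)); last first.
  by rewrite ler_wpM2r ?sqr_ge0//; apply: le_trans MM; rewrite /M0; lra.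
apply: (@ccvg_le _ (fun N => crE k (P N) z h)).
  rewrite /crE; apply: ccvgD.
    by apply: ccvgB; [apply: ccvgZ|]; exact: PF.
  by apply: ccvgZ; apply: ccvgB; [apply: ccvgZ|]; exact: PF.
move=> N; have [L [LB PB LP]] := PC N z nz.
by apply: (hK (P N) z L B h) => //; exact: LP.
Qed.

(** Compactness of the circle. *)
Lemma crE_uniform (k : int) (F : C -> C) (r : R) : 0 <= r < 1 ->
  (forall z, normc z < 1 -> analytic_at F z) ->
  exists M : R, 0 < M /\ forall t h : R, 0 <= t <= tau ->
    `|h| < M^-1 -> normc (crE k F (r%:C * cis t) h) <= M * h ^+ 2.
Proof.
move=> /andP[r0 r1] aF.
have nz t : normc (r%:C * cis t) < 1.
  by rewrite normcM normc_cis mulr1 normcRC ger0_norm.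
have := @segment_compact R 0 tau => /compact_near_coveringP.
pose Q M t := forall h : R, `|h| < M^-1 ->
  normc (crE k F (r%:C * cis t) h) <= M * h ^+ 2.
move=> /(_ R (pinfty_nbhs R) Q _) cov.
have loc : forall x, `[0, tau]%classic x -> \forall x' \near x & M \near +oo, Q M x'.
  move=> x _; have r01 : 0 <= r <= 1 by rewrite r0 ltW.
  have [M0 [M00 hM]] := crE_near k r01 (aF _ (nz x)).
  exists (ball x M0^-1, [set M | M0 <= M]) => /=.
    split; first by apply: nbhsx_ballx; rewrite invr_gt0.
    by apply: nbhs_pinfty_ge; rewrite num_real.
  move=> [x' M] /= [bx MM] h hh; apply: hM => //.
  by rewrite distrC.
have pos : \forall M \near +oo, 0 < (M : R) by apply: nbhs_pinfty_gt; rewrite num_real.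
have [M [M0 hM]] := filter_ex (filterI pos (cov loc)).
by exists M; split => // t h t01 hh; apply: hM => //=; rewrite in_itv.
Qed.

Lemma analytic_continuous (F : C -> C) z0 : analytic_at F z0 ->
  forall e : R, 0 < e -> exists2 d : R, 0 < d &
    forall z, normc (z - z0) < d -> normc (F z - F z0) < e.
Proof.
move=> /analytic_C11[rho [B [P [rho0 B0 PF PC]]]] e e0.
have B1 : 0 < 2 * B + 1 by lra.
exists (Num.min rho (Num.min 1 (e / (2 * B + 1)))).
  by rewrite !lt_min rho0 ltr01 divr_gt0.
move=> z; rewrite !lt_min => /and3P[zr z1 ze].
have n0 := normc_ge0 (z - z0).
apply: (@le_lt_trans _ _ (2 * B * normc (z - z0))); last first.
  rewrite ltr_pdivlMr// in ze; apply: le_lt_trans ze.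
  by rewrite mulrC ler_wpM2l// lerDl.
apply: (@ccvg_le _ (fun N => P N z - P N z0)).
  by apply: ccvgB; apply: PF; [exact: ltW|rewrite subrr normc0 ltW].
move=> N; have [|L [LB _ /(_ z (ltW zr)) h]] := PC N z0.
  by rewrite subrr normc0 ltW.
have -> : P N z - P N z0 = (P N z - P N z0 - L * (z - z0)) + L * (z - z0) by ring.
apply: le_trans (normcD_le _ _) _; rewrite normcM.
move: h LB z1 n0; move: (normc (_ - _ - _)) (normc (z - z0)) (normc L) => x y l.
move=> hx ly y1 y0; apply: le_trans (lerD hx (ler_wpM2r y0 ly)) _.
have : B * y ^+ 2 <= B * y by rewrite ler_wpM2l// expr2 ler_piMr// ltW.
by lra.
Qed.

End cauchy_riemann.

(** * Circle means of analytic functions *)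

Section rotation.
Variable R : realType.
Local Notation mu := (circle_measure R).
Local Notation leb := (@lebesgue_measure R).
Local Notation tau := (2 * pi : R).

(** Quadratic increments force the derivative to vanish. *)
Lemma quad_increment_cst (f : R -> R) :
  (forall s : R, s < 0 -> exists M : R, 0 < M /\ forall h : R, `|h| < M^-1 ->
     `|f (s + h) - f s| <= M * h ^+ 2) ->
  forall s s' : R, s < 0 -> s' < 0 -> f s = f s'.
Proof.
move=> hf.
have df (s : R) : s < 0 -> is_derive s 1 f 0.
  move=> s0; have [M [M0 hM]] := hf s s0.
  have cv : h^-1 *: (f (h *: 1 + s) - f s) @[h --> 0^'] --> (0 : R).
    apply/cvgrPdist_lt => e e0; near=> h.
    have h0 : h != 0 by near: h; exact: nbhs_dnbhs_neq.
    have h1 : `|h| < M^-1 by near: h; apply: dnbhs0_lt; rewrite invr_gt0.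
    have h2 : `|h| < e / M by near: h; apply: dnbhs0_lt; rewrite divr_gt0.
    rewrite sub0r normrN [h *: 1]mulr1 normrM normfV [h + s]addrC.
    have hp : 0 < `|h| by rewrite normr_gt0.
    rewrite mulrC ltr_pdivrMr//; apply: le_lt_trans (hM h h1) _.
    rewrite -(real_normK (num_real h)) expr2 mulrA ltr_pM2r//.
    by rewrite mulrC -ltr_pdivlMr.
  apply: DeriveDef; first by apply/cvg_ex; exists 0.
  by apply: cvg_lim => //; exact: cv.
have main (s s' : R) : s < s' -> s' < 0 -> f s = f s'.
  move=> ss s0.
  have dfs x : x \in `]s, s'[ -> is_derive x 1 f 0.
    by rewrite in_itv/= => /andP[_ xs]; apply: df; exact: lt_trans s0.
  have [|c _] := @MVT R f (fun=> 0) s s' ss dfs.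
    apply: derivable_within_continuous => x; rewrite in_itv/= => /andP[_ xs].
    by have [] := df x (le_lt_trans xs s0).
  by rewrite mul0r => /eqP; rewrite subr_eq0 => /eqP.
move=> s s' s0 s0'; have [ss|ss|->//] := ltgtP s s'; first exact: main.
by rewrite (main _ _ ss).
Unshelve. all: by end_near. Qed.

(** The integral of a [2 pi]-periodic function over a window of length [2 pi]
    has zero derivative with respect to the position of the window. *)
Lemma circle_rotation (g : R -> R) (h : R) : continuous g ->
  (forall t, g (t + tau) = g t) -> (exists B : R, forall t, `|g t| <= B) ->
  \int[mu]_t g (t + h) = \int[mu]_t g t.
Proof.
move=> gc gp [B gB].
(* A base point to the left of both windows. *)
pose A : R := - (`|h| + 1).
pose Phi x := \int[leb]_(t in `[A, x]) g t.
have dPhi x : A < x -> is_derive x 1 Phi (g x).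
  move=> Ax; have x1 : x < x + 1 by rewrite ltrDl.
  have gi : leb.-integrable `[A, x + 1] (EFin \o g).
    apply: continuous_compact_integrable; first exact: segment_compact.
    exact: continuous_subspaceT.
  have [d1 d2] := @continuous_FTC1_closed _ g A x (x + 1) x1 gi Ax (gc x).
  by apply: DeriveDef; [exact: d1|rewrite -derive1E; exact: d2].
have dshift x y : A < x + y -> is_derive x 1 (fun t => Phi (t + y)) (g (x + y)).
  move=> Axy; have ds : is_derive x 1 (fun t : R => t + y) 1.
    by rewrite -[X in is_derive _ _ _ X]addr0; exact: is_deriveD.
  have := @is_derive1_comp R Phi (fun t => t + y) x _ _ (dPhi _ Axy) ds.
  by rewrite mulr1.
have p0 := ltr0_2pi R.
have intg x : `|x| <= `|h| -> \int[mu]_t g (t + x) = tau^-1 * (Phi (tau + x) - Phi x).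
  move=> xh; rewrite Rint_lebesgue; last first.
    apply: (@integr_le _ _ (fun=> B)) => //.
      apply: continuous_measurable_fun => t; apply: (@continuous_comp _ _ _ (fun t => t + x) g); last exact: gc.
      by apply: cvgD; [exact: cvg_id|exact: cvg_cst].
    exact: finite_measure_integrable_cst.
  congr (_ * _).
  have Ax t : 0 <= t -> A < t + x.
    move=> t0; have := xh; rewrite ler_norml => /andP[x1 _].
    by rewrite /A; lra.
  have dt t : 0 <= t -> derivable (fun t => Phi (t + x)) t 1.
    by move=> t0; have [] := dshift t x (Ax t t0).
  rewrite /Rintegral (@continuous_FTC2 _ (fun t => g (t + x)) (fun t => Phi (t + x)) 0 tau)//.
  - by rewrite add0r.
  - apply: continuous_subspaceT => t; apply: (@continuous_comp _ _ _ (fun t => t + x) g); last exact: gc.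
    by apply: cvgD; [exact: cvg_id|exact: cvg_cst].
  - have ct t : 0 <= t -> {for t, continuous (fun t => Phi (t + x))}.
      by move=> t0; apply/differentiable_continuous/derivable1_diffP; exact: dt.
    split.
    + by move=> t; rewrite in_itv/= => /andP[t0 _]; apply: dt; exact: ltW.
    + by apply: cvg_at_right_filter; apply: ct.
    + by apply: cvg_at_left_filter; apply: ct; exact: ltW.
  - move=> t; rewrite in_itv/= => /andP[t0 _]; rewrite derive1E.
    by have [_ ->] := dshift t x (Ax t (ltW t0)).
rewrite intg//; rewrite -[RHS](_ : \int[mu]_t g (t + 0) = _); last first.
  by apply: eq_Rintegral => t _; rewrite addr0.
rewrite intg ?normr0//; congr (_ * _).
pose c x := Phi (x + tau) - Phi x.
have dc x : A < x -> is_derive x 1 c 0.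
  move=> Ax; have d1 : is_derive x 1 (fun t => Phi (t + tau)) (g (x + tau)).
    by apply: dshift; lra.
  have := is_deriveB d1 (dPhi x Ax).
  by rewrite gp subrr.
have cc a b : A < a -> a < b -> c a = c b.
  move=> Aa ab.
  have dcs x : x \in `]a, b[ -> is_derive x 1 c 0.
    by rewrite in_itv/= => /andP[ax _]; apply: dc; exact: lt_trans ax.
  have [|y _] := @MVT R c (fun=> 0) a b ab dcs.
    apply: derivable_within_continuous => x; rewrite in_itv/= => /andP[ax _].
    by have [] := dc x (lt_le_trans Aa ax).
  by rewrite mul0r => /eqP; rewrite subr_eq0 => /eqP.
have A0 : A < 0 by rewrite /A oppr_lt0 ltr_wpDl.
have Ah : A < h by rewrite /A; have := ler_norm (- h); rewrite normrN; lra.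
rewrite !(addrC tau) -/(c h) -/(c 0).
have [hh|hh|->//] := ltgtP h 0; first exact: cc.
by rewrite (cc _ _ A0 hh).
Qed.

End rotation.

Section circle_means.
Variable R : realType.
Local Notation C := R[i].
Local Notation mu := (circle_measure R).
Local Notation tau := (2 * pi : R).

Definition ccontinuous (u : R -> C) := forall t (e : R), 0 < e ->
  exists2 d : R, 0 < d & forall t', `|t' - t| < d -> normc (u t' - u t) < e.

Lemma ccontinuous_ReIm u : ccontinuous u ->
  continuous (fun t => complex.Re (u t)) /\ continuous (fun t => complex.Im (u t)).
Proof.
move=> uc.
have near t (e : R) : 0 < e -> \forall t' \near t, normc (u t' - u t) < e.
  move=> e0; have [d d0 ud] := uc t e e0.
  by apply: filterS (nbhsx_ballx t d d0) => t'; rewrite /ball/= distrC => /ud.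
split=> t; apply/cvgrPdist_lt => e e0; apply: filterS (near t e e0) => t' h.
- by rewrite distrC -complex_ReB (le_lt_trans (Re_le_normc _)).
- by rewrite distrC -complex_ImB (le_lt_trans (Im_le_normc _)).
Qed.

Lemma ccontinuous_cmeas u : ccontinuous u -> u \in @cmeas R.
Proof.
move=> /ccontinuous_ReIm[ru iu]; apply/cmeasP.
by split; exact: continuous_measurable_fun.
Qed.

Lemma ccontinuousM u v : (exists B : R, forall t, normc (u t) <= B) ->
  (exists B : R, forall t, normc (v t) <= B) ->
  ccontinuous u -> ccontinuous v -> ccontinuous (fun t => u t * v t).
Proof.
move=> [A uA] [B vB] uc vc t e e0.
have A0 : 0 <= A by exact: le_trans (normc_ge0 _) (uA 0).
have B0 : 0 <= B by exact: le_trans (normc_ge0 _) (vB 0).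
have K0 : 0 < A + B + 1 by lra.
have [d d0 ud] := uc t _ (divr_gt0 e0 K0).
have [d' d0' vd] := vc t _ (divr_gt0 e0 K0).
exists (Num.min d d'); first by rewrite lt_min d0.
move=> t'; rewrite lt_min => /andP[/ud hu /vd hv].
have -> : u t' * v t' - u t * v t = (u t' - u t) * v t' + u t * (v t' - v t) by ring.
apply: le_lt_trans (normcD_le _ _) _; rewrite !normcM.
set q := e / _ in hu hv.
have q0 : 0 < q by rewrite divr_gt0.
apply: (@le_lt_trans _ _ (q * B + A * q)).
  by rewrite lerD// ler_pM ?normc_ge0// ltW.
have -> : e = q * (A + B + 1) by rewrite /q divfK// gt_eqF.
by nra.
Qed.

Lemma ccontinuous_cis (k : R) : ccontinuous (fun t => cis (k * t)).
Proof.
move=> t e e0; have K0 : 0 < 2 * `|k| + 1 by rewrite ltr_wpDl// mulr_ge0.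
exists (e / (2 * `|k| + 1)); first exact: divr_gt0.
move=> t'; rewrite ltr_pdivlMr// => h; apply: le_lt_trans (cis_lin _ _) _.
rewrite -mulrBr normrM; apply: le_lt_trans h.
by rewrite mulrA mulrC ler_wpM2l// lerDl.
Qed.

(** The factor [2] comes from bounding real and imaginary parts separately. *)
Lemma cint_bound (u : R -> C) (b : R) : cintegr u ->
  {ae mu, forall t, normc (u t) <= b} -> normc (cint u) <= 2 * b.
Proof.
move=> [ru iu] ub.
have bi : integr (fun=> b) by exact: finite_measure_integrable_cst.
have half (f : R -> R) : integr f -> {ae mu, forall t, `|f t| <= b} ->
    `|\int[mu]_t f t| <= b.
  move=> fi fb; apply: le_trans (le_normr_Rintegral _ fi) _ => //.
  apply: le_trans (ae_le_Rint (integrable_norm fi) bi fb) _.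
  rewrite Rintegral_cst// -[leRHS]mulr1 le_eqVlt; apply/orP; left; apply/eqP.
  by congr (_ * _); apply: (congr1 fine (probability_setT mu)).
apply: le_trans (normc_le_abs _ _) _.
rewrite [leRHS](mulr_natl b 2) [leRHS]mulr2n; apply: lerD; apply: half => //.
- by apply: ae_imp ub => t; apply: le_trans; exact: Re_le_normc.
- by apply: ae_imp ub => t; apply: le_trans; exact: Im_le_normc.
Qed.

Variable F : C -> C.
Variable B : R.
Hypothesis aF : forall z, normc z < 1 -> analytic_at F z.
Hypothesis FB : forall z, normc z < 1 -> normc (F z) <= B.

Lemma normc_polar (r t : R) : 0 <= r -> normc (r%:C * cis t) = r.
Proof. by move=> r0; rewrite normcM normc_cis mulr1 normcRC ger0_norm. Qed.

(** The [(-k)]-th Fourier coefficient of [F] on the circle of radius [r]. *)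
Definition circle_mean (k : int) (r : R) : C :=
  cint (fun t => cis (k%:~R * t) * F (r%:C * cis t)).

Lemma ccontinuous_circle (r : R) : 0 <= r < 1 ->
  ccontinuous (fun t => F (r%:C * cis t)).
Proof.
move=> /andP[r0 r1] t e e0.
have z1 : normc (r%:C * cis t) < 1 by rewrite normc_polar.
have [d d0 hd] := analytic_continuous (aF z1) e0.
exists (d / 2); first by rewrite divr_gt0.
move=> t' h; apply: hd; rewrite -mulrBr normcM normcRC ger0_norm//.
have := cis_lin t' t; have := normc_ge0 (cis t' - cis t).
move: (normc _) h => x; move: `|_| => y h x0 xy.
by nra.
Qed.

Lemma normc_circle_le (r : R) (k : int) t : 0 <= r < 1 ->
  normc (cis (k%:~R * t) * F (r%:C * cis t)) <= B.
Proof.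
by move=> /andP[r0 r1]; rewrite normcM normc_cis mul1r FB// normc_polar.
Qed.

Lemma ccontinuous_mode (k : int) (r : R) : 0 <= r < 1 ->
  ccontinuous (fun t => cis (k%:~R * t) * F (r%:C * cis t)).
Proof.
move=> r01; apply: ccontinuousM.
- by exists 1 => t; rewrite normc_cis.
- by exists B => t; have := normc_circle_le 0 t r01; rewrite mul0r cis0 mul1r.
- exact: ccontinuous_cis.
- exact: ccontinuous_circle.
Qed.

Lemma cintegr_mode (k : int) (r : R) : 0 <= r < 1 ->
  cintegr (fun t => cis (k%:~R * t) * F (r%:C * cis t)).
Proof.
move=> r01; apply: (@cintegr_le _ _ (fun=> B)).
- exact/ccontinuous_cmeas/ccontinuous_mode.
- by move=> t; exact: normc_circle_le.
- exact: finite_measure_integrable_cst.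
Qed.

Lemma cis_tau (k : int) (t : R) : cis (k%:~R * (t + tau)) = cis (k%:~R * t).
Proof.
rewrite mulrDr cisD; suff -> : cis (k%:~R * tau) = 1 by rewrite mulr1.
have c1 : cis tau = 1 by rewrite mulr_natl /cis cos2pi sin2pi.
have cn (n : nat) : cis (n%:R * tau) = 1.
  elim: n => [|n ih]; first by rewrite mul0r cis0.
  by rewrite -natr1 mulrDl mul1r cisD ih c1 mulr1.
case: k => n; first exact: cn.
by rewrite NegzE intrN mulNr cisN -pmulrn cn; exact: conjc1.
Qed.

Lemma circle_mean_rotation (k : int) (r h : R) : 0 <= r < 1 ->
  cint (fun t => cis (k%:~R * (t + h)) * F (r%:C * cis (t + h))) = circle_mean k r.
Proof.
move=> r01; have [cr ci] := ccontinuous_ReIm (ccontinuous_mode k r01).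
have c1 t : cis (t + tau) = cis t by have := cis_tau 1 t; rewrite !mul1r.
congr (_ +i* _).
- apply: (circle_rotation h cr) => [t|]; first by rewrite cis_tau c1.
  by exists B => t; apply: le_trans (Re_le_normc _) _; exact: normc_circle_le.
- apply: (circle_rotation h ci) => [t|]; first by rewrite cis_tau c1.
  by exists B => t; apply: le_trans (Im_le_normc _) _; exact: normc_circle_le.
Qed.

(** The circle mean of [z ^ k * F z] over the circle of radius [exp s]: the
    logarithm of the radius is the coordinate in which the Cauchy-Riemann
    equations relate radial and angular increments by the factor ['i]. *)
Definition log_mean (k : int) (s : R) : C :=
  (expR (k%:~R * s))%:C * circle_mean k (expR s).

Let log_ring1 (E1 E i a b : C) :
  E1 * a - E * b = E1 * a + (- E - i * E) * b + i * E * b.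
Proof. ring. Qed.

Let log_ring2 (E a c d i f0 f1 f2 : C) :
  E * a * (c * f1) + (- E - i * E) * (c * f0) + i * E * (c * d * f2) =
  E * c * (a * f1 - f0 + i * (d * f2 - f0)).
Proof. ring. Qed.

(** The increment in [s] is the mean of a radial increment, which [crE] turns
    into an angular one up to an error of second order; angular increments have
    mean zero by rotation invariance. *)
Lemma log_mean_quad (k : int) (s : R) : s < 0 -> exists M : R, 0 < M /\
  forall h, `|h| < M^-1 ->
    normc (log_mean k (s + h) - log_mean k s) <= M * h ^+ 2.
Proof.
move=> s0; pose r := expR s.
have r01 : 0 <= r < 1 by rewrite expR_ge0 expR_lt1.
have [M [M0 hM]] := crE_uniform k r01 aF.
pose N := 2 * expR (k%:~R * s) * M + M + `|s|^-1.
have e0 := expR_gt0 (k%:~R * s).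
have is0 : 0 < `|s|^-1 by rewrite invr_gt0 normr_gt0 lt_eqF.
have eM : 0 < 2 * expR (k%:~R * s) * M by rewrite !mulr_gt0.
have eN : 2 * expR (k%:~R * s) * M <= N by rewrite /N; lra.
have N0 : 0 < N by apply: lt_le_trans eN.
exists N; split => // h hN.
have hM' : `|h| < M^-1 by apply: lt_le_trans hN _; rewrite lef_pV2 ?posrE// /N; lra.
have sh0 : s + h < 0.
  have : `|h| < `|s|.
    by apply: lt_le_trans hN _; rewrite -[leRHS]invrK lef_pV2 ?posrE// /N; lra.
  by rewrite (ltr0_norm s0) ltr_norml => /andP[_]; lra.
have rh01 : 0 <= expR (s + h) < 1 by rewrite expR_ge0 expR_lt1.
pose u0 t := cis (k%:~R * t) * F (r%:C * cis t).
pose u1 t := cis (k%:~R * t) * F ((expR (s + h))%:C * cis t).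
pose u2 t := u0 (t + h).
have i0 : cintegr u0 by exact: cintegr_mode.
have i1 : cintegr u1 by exact: cintegr_mode.
have i2 : cintegr u2.
  apply: (@cintegr_le _ _ (fun=> B)).
  - apply: ccontinuous_cmeas => t e ee.
    have [d d0 hd] := ccontinuous_mode k r01 (t + h) ee.
    by exists d => // t' tt'; apply: hd; rewrite opprD addrACA subrr addr0.
  - by move=> t; exact: normc_circle_le.
  - exact: finite_measure_integrable_cst.
pose E := (expR (k%:~R * s))%:C; pose E1 := (expR (k%:~R * (s + h)))%:C.
have -> : log_mean k (s + h) - log_mean k s =
  cint (fun t => E1 * u1 t + (- E - 'i * E) * u0 t + 'i * E * u2 t).
  have rot : cint u2 = cint u0 by exact: circle_mean_rotation.
  rewrite cintD; [|by apply: cintegrD; exact: cintegrZ|exact: cintegrZ].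
  rewrite cintD; [|exact: cintegrZ|exact: cintegrZ].
  rewrite (cintZ _ i1) (cintZ _ i0) (cintZ _ i2) rot.
  rewrite -[log_mean k (s + h)]/(E1 * cint u1) -[log_mean k s]/(E * cint u0).
  exact: log_ring1.
apply: (@le_trans _ _ (2 * (expR (k%:~R * s) * (M * h ^+ 2)))); last first.
  rewrite (_ : 2 * (_ * _) = 2 * expR (k%:~R * s) * M * h ^+ 2).
    by apply: ler_wpM2r; [exact: sqr_ge0|exact: eN].
  by rewrite !mulrA.
apply: cint_bound.
  by apply: cintegrD; [apply: cintegrD|]; exact: cintegrZ.
apply: ae_imp (ae_circle_itv R) => t /andP[t0 tt].
have -> : E1 * u1 t + (- E - 'i * E) * u0 t + 'i * E * u2 t =
  E * cis (k%:~R * t) * crE k F (r%:C * cis t) h.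
  have e1 : E1 = E * (expR (k%:~R * h))%:C.
    by rewrite /E1 /E mulrDr expRD; exact: (rmorphM (real_complex R)).
  have e2 : cis (k%:~R * (t + h)) = cis (k%:~R * t) * cis (k%:~R * h).
    by rewrite mulrDr cisD.
  have e3 : (expR (s + h))%:C * cis t = r%:C * cis t * (expR h)%:C.
    by rewrite expRD [(_ * _)%:C](rmorphM (real_complex R)) mulrAC.
  have e4 : r%:C * cis (t + h) = r%:C * cis t * cis h by rewrite cisD mulrA.
  rewrite /u2 /u1 /u0 /crE e1 e2 e3 e4; exact: log_ring2.
rewrite !normcM normc_cis mulr1 normcRC (gtr0_norm e0) ler_wpM2l ?(ltW e0)//.
by apply: hM => //; rewrite !ltW.
Qed.

Lemma log_mean_cst (k : int) (s s' : R) : s < 0 -> s' < 0 ->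
  log_mean k s = log_mean k s'.
Proof.
move=> s0 s0'; apply/eqP; rewrite eq_complex; apply/andP; split; apply/eqP.
- apply: (@quad_increment_cst _ (fun s => complex.Re (log_mean k s))) => // x x0.
  have [M [M0 hM]] := log_mean_quad k x0; exists M; split => // h hh.
  by rewrite -complex_ReB (le_trans (Re_le_normc _))// hM.
- apply: (@quad_increment_cst _ (fun s => complex.Im (log_mean k s))) => // x x0.
  have [M [M0 hM]] := log_mean_quad k x0; exists M; split => // h hh.
  by rewrite -complex_ImB (le_trans (Im_le_normc _))// hM.
Qed.

End circle_means.

(** * Boundary values of inner functions *)

Section boundary_values.
Variable R : realType.
Local Notation C := R[i].
Local Notation mu := (circle_measure R).
Local Notation tau := (2 * pi : R).

(** Rotation by [pi / k] changes the sign of [z ^ k]. *)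
Lemma cint_cis (k : int) : k != 0 -> cint (fun t : R => cis (k%:~R * t)) = 0.
Proof.
move=> k0; set I := cint _.
have kR : (k%:~R : R) != 0 by rewrite intr_eq0.
have [cr ci] := ccontinuous_ReIm (@ccontinuous_cis R k%:~R).
pose h : R := pi / k%:~R.
have rot : cint (fun t => cis (k%:~R * (t + h))) = I.
  congr (_ +i* _).
  - apply: (circle_rotation h cr) => [t|]; first by rewrite cis_tau.
    by exists 1 => t; rewrite ler_norml cos_geN1 cos_le1.
  - apply: (circle_rotation h ci) => [t|]; first by rewrite cis_tau.
    by exists 1 => t; rewrite ler_norml sin_geN1 sin_le1.
have cm : cintegr (fun t : R => cis (k%:~R * t)).
  apply: (@cintegr_le _ _ (fun=> 1)).
  - exact/ccontinuous_cmeas/ccontinuous_cis.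
  - by move=> t; rewrite normc_cis.
  - exact: finite_measure_integrable_cst.
have : I = - I.
  rewrite -{1}rot -mulN1r -cintZ//; congr cint; apply/funext => t.
  rewrite mulrDr cisD mulrC; congr (_ * _).
  by rewrite /h mulrC divfK// /cis cospi sinpi; apply/eqP; rewrite eq_complex /= oppr0 !eqxx.
move=> /eqP; rewrite -subr_eq0 opprK -mulr2n -scaler_nat scaler_eq0.
by rewrite pnatr_eq0 /= => /eqP.
Qed.

Lemma fourier_zexp (n m : int) :
  fourier (Linf_L2 (zexp R n)) m = (n == m)%:R.
Proof.
rewrite /fourier (@inprodE _ _ _ (fun t => cis (n%:~R * t)) (fun t => cis (m%:~R * t))).
- have -> : (fun t => cis (n%:~R * t) * (cis (m%:~R * t))^*) =
            (fun t : R => cis ((n - m)%:~R * t)).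
    by apply/funext => t; rewrite -cisN -cisD intrB mulrBl.
  have [->|nm] := eqVneq n m; last by rewrite cint_cis// subr_eq0.
  rewrite subrr; under [X in cint X]eq_fun do rewrite mul0r cis0.
  rewrite /cint /= Rintegral_cst// Rintegral_cst// mul0r mul1r.
  by congr (_ +i* _); exact: (congr1 fine (probability_setT mu)).
- exact: cmeas_cis.
- exact: cmeas_cis.
- exact: zexpE.
- exact: zexpE.
Qed.

Lemma cint_dominated (u : nat -> R -> C) (v : R -> C) (B : R) :
  (forall n, u n \in @cmeas R) -> v \in @cmeas R ->
  (forall n t, normc (u n t) <= B) ->
  {ae mu, forall t, ccvg (u^~ t) (v t)} ->
  ccvg (fun n => cint (u n)) (cint v).
Proof.
move=> um vm uB uv.
have bi : integr (fun=> B) by exact: finite_measure_integrable_cst.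
have real (f : nat -> R -> R) (g : R -> R) : (forall n, measurable_fun setT (f n)) ->
    measurable_fun setT g -> (forall n t, `|f n t| <= B) ->
    {ae mu, forall t, f^~ t @ \oo --> g t} ->
    (fun n => \int[mu]_t f n t) @ \oo --> \int[mu]_t g t.
  move=> fm gm fB fg.
  have [] := @dominated_convergence _ _ _ mu setT measurableT
    (fun n => EFin \o f n) (EFin \o g) (EFin \o (fun=> B)).
  - by move=> n; apply/measurable_EFinP; exact: fm.
  - exact/measurable_EFinP.
  - by apply: ae_imp fg => t ft _; apply: cvg_EFin => //; exact: nearW.
  - exact: bi.
  - by apply: aeW => t n _; rewrite abse_EFin lee_fin.
  - move=> gi _ cv; rewrite /Rintegral; apply: fine_cvg.
    by rewrite fineK//; exact: integrable_fin_num.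
have ccv_real (a : nat -> C) (l : C) : ccvg a l ->
    (fun n => complex.Re (a n)) @ \oo --> complex.Re l /\
    (fun n => complex.Im (a n)) @ \oo --> complex.Im l.
  move=> al; split; apply/cvgrPdist_lt => e e0; have [N hN] := al e e0;
    exists N => // n /= Nn; rewrite distrC.
  - by rewrite -complex_ReB (le_lt_trans (Re_le_normc _))// hN.
  - by rewrite -complex_ImB (le_lt_trans (Im_le_normc _))// hN.
have /cmeasP[vr vi] := vm.
have cr : (fun n => \int[mu]_t complex.Re (u n t)) @ \oo --> \int[mu]_t complex.Re (v t).
  apply: real => //.
  - by move=> n; have /cmeasP[] := um n.
  - by move=> n t; rewrite (le_trans (Re_le_normc _)).
  - by apply: ae_imp uv => t /ccv_real[].
have ci : (fun n => \int[mu]_t complex.Im (u n t)) @ \oo --> \int[mu]_t complex.Im (v t).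
  apply: real => //.
  - by move=> n; have /cmeasP[] := um n.
  - by move=> n t; rewrite (le_trans (Im_le_normc _)).
  - by apply: ae_imp uv => t /ccv_real[].
move=> e e0; have e2 : 0 < e / 2 by rewrite divr_gt0.
have [N _ hN] := @cvgr_dist_lt _ _ _ _ _ _ _ cr _ e2.
have [M _ hM] := @cvgr_dist_lt _ _ _ _ _ _ _ ci _ e2.
exists (maxn N M) => n; rewrite geq_max => /andP[Nn Mn].
have -> : cint (u n) - cint v =
  (\int[mu]_t complex.Re (u n t) - \int[mu]_t complex.Re (v t)) +i*
  (\int[mu]_t complex.Im (u n t) - \int[mu]_t complex.Im (v t)) by [].
apply: le_lt_trans (normc_le_abs _ _) _; rewrite [ltRHS]splitr; apply: ltrD.
- by rewrite distrC; exact: (hN n Nn).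
- by rewrite distrC; exact: (hM n Mn).
Qed.

Lemma ccvg_uniq (u : nat -> C) l m : ccvg u l -> ccvg u m -> l = m.
Proof.
move=> ul um; apply/eqP; rewrite -subr_eq0; apply/eqP/eq0_normc/eqP.
rewrite eq_le normc_ge0 andbT.
by apply: (ccvg_le (ccvgB ul um)) => n; rewrite subrr normc0.
Qed.

Variable theta : inner_function R.
Let b := inner_bdry theta.
Let aF := @inner_analytic R theta.

(** The means of [z ^ k * theta z] do not depend on the radius; dominated
    convergence along radii increasing to [1] identifies their common value
    with a Fourier coefficient of the boundary function. *)
Lemma inner_log_mean (k : int) (s : R) : s < 0 ->
  log_mean theta k s = fourier (Linf_L2 b) (- k).
Proof.
move=> s0; have [B FB] := inner_bounded theta.
pose x n : R := n.+1%:R^-1.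
have x0 n : 0 < x n by rewrite invr_gt0.
have xcv : x @ \oo --> (0 : R) by exact: cvg_harmonic.
pose r n := expR (- x n).
have r01 n : 0 <= r n < 1 by rewrite expR_ge0 expR_lt1 oppr_lt0 x0.
have expcv (c : R) : (fun n => expR (c * x n)) @ \oo --> (1 : R).
  rewrite -expR0 -(mulr0 c); apply: continuous_cvg; first exact: continuous_expR.
  exact: cvgMr.
have rcv : r @ \oo --> (1 : R)^'-.
  move=> U [e /= e0 hU].
  have [N _ hN] := @cvgr_dist_lt _ _ _ _ _ _ _ (expcv (-1)) e e0.
  exists N => // n Nn; apply: hU; last by have /andP[] := r01 n.
  by have := hN n Nn; rewrite /ball /= mulN1r.
have bm : (fun t => cis (k%:~R * t) * b t) \in @cmeas R.
  by apply: cmeasM; [exact: cmeas_cis|exact: cmeas_fun].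
have B0 : 0 <= B.
  by apply: le_trans (FB 0 _); rewrite ?normc_ge0// normc0.
have mean_cvg : ccvg (fun n => circle_mean theta k (r n))
                     (cint (fun t => cis (k%:~R * t) * b t)).
  apply: (@cint_dominated _ _ B) => //.
  - by move=> n; apply: ccontinuous_cmeas; exact: (ccontinuous_mode aF FB k (r01 n)).
  - by move=> n t; exact: normc_circle_le.
  - apply: ae_imp (inner_radial theta) => t ht; apply: ccvgZ.
    by apply: cvg_ccvg; exact: (cvg_comp _ _ rcv ht).
have -> : fourier (Linf_L2 b) (- k) = cint (fun t => cis (k%:~R * t) * b t).
  rewrite /fourier (@inprodE _ _ _ b (fun t => cis ((- k)%:~R * t))).
  - congr cint; apply/funext => t; rewrite mulrC intrN mulNr cisN.
    by congr (_ * _); exact: conjcK.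
  - exact: cmeas_fun.
  - exact: cmeas_cis.
  - exact: aeW.
  - exact: zexpE.
have E n : circle_mean theta k (r n) = log_mean theta k s * (expR (k%:~R * x n))%:C.
  have xn0 : - x n < 0 by rewrite oppr_lt0.
  rewrite (log_mean_cst aF FB k s0 xn0) /log_mean mulrAC -(rmorphM (real_complex R)).
  by rewrite -expRD -mulrDr addNr mulr0 expR0 mul1r.
have E1 : ccvg (fun n => (expR (k%:~R * x n))%:C) 1.
  move=> e e0; have [N _ hN] := @cvgr_dist_lt _ _ _ _ _ _ _ (expcv k%:~R) e e0.
  exists N => n Nn; have := hN n Nn; rewrite distrC /= => h.
  by rewrite subr0 expr0n addr0 sqrtr_sqr.
have := ccvgZ (log_mean theta k s) E1; rewrite mulr1 -(funext E) => cvgL.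
exact: ccvg_uniq cvgL mean_cvg.
Qed.

(** For [k > 0] the coefficient of index [- k] is the mean of [z ^ k * theta z]
    over a circle of any radius [exp s], so it is at most a constant times
    [exp (k s)]; let the radius shrink to [0]. *)
Lemma inner_bdry_H2 : H2 (Linf_L2 b).
Proof.
move=> n n0; rewrite -[n]opprK; have : 0 < - n by rewrite oppr_gt0.
move: (- n) => {n n0} k k0.
have [B FB] := inner_bounded theta.
have B0 : 0 <= B by apply: le_trans (FB 0 _); rewrite ?normc_ge0// normc0.
apply: eq0_normc; apply/eqP; rewrite eq_le normc_ge0 andbT leNgt; apply/negP => c0.
set c := normc _ in c0.
pose x := 2 * B / c.
have x0 : 0 <= x by rewrite divr_ge0 ?mulr_ge0// ltW.
(* [exp (k s) <= 1 / (1 + x + 1)] is small enough to contradict the choice of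
   [x]. *)
pose s := - (x + 1).
have s0 : s < 0 by rewrite oppr_lt0 ltr_wpDl.
have r01 : 0 <= expR s < 1 by rewrite expR_ge0 expR_lt1.
have k1 : (1 : R) <= k%:~R by rewrite ler1z -gtz0_ge1.
have : c <= expR (k%:~R * s) * (2 * B).
  rewrite /c -(inner_log_mean k s0) /log_mean normcM normcRC ger0_norm ?expR_ge0//.
  rewrite ler_wpM2l ?expR_ge0//; apply: cint_bound.
    exact: (cintegr_mode aF FB k r01).
  by apply: aeW => t; exact: normc_circle_le.
apply/negP; rewrite -ltNge.
have e1 : expR (k%:~R * s) * (1 + (x + 1)) <= 1.
  apply: (@le_trans _ _ (expR s * expR (- s))); last by rewrite -expRD subrr expR0.
  rewrite ler_pM ?expR_ge0 ?addr_ge0//.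
    by rewrite ler_expR; nra.
  by rewrite /s opprK; exact: expR_ge1Dx.
have e0 := expR_gt0 (k%:~R * s).
have -> : 2 * B = x * c by rewrite /x divfK// gt_eqF.
nra.
Qed.

(** An inequality at one point would persist on an arc, of positive measure. *)
Lemma ae_cst_everywhere (u : R -> C) (c : C) : ccontinuous u ->
  {ae mu, forall t, u t = c} -> forall t, 0 <= t < tau -> u t = c.
Proof.
move=> uc [A [mA A0 sA]] t0 /andP[t00 t0t].
apply/eqP; rewrite -subr_eq0; apply/negP => /negP n0.
have e0 : 0 < normc (u t0 - c).
  by rewrite lt_neqAle normc_ge0 andbT eq_sym; apply: contra n0 => /eqP /eq0_normc ->.
have [d d0 hd] := uc t0 _ e0.
pose b' := Num.min (t0 + d) tau.
have tb : t0 < b' by rewrite lt_min t0t andbT ltrDl.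
have IA : `]t0, b'[ `<=` A.
  move=> t /=; rewrite in_itv/= lt_min => /andP[tt /andP[td _]]; apply: sA => /= ut.
  have := hd t; rewrite ut -normcN opprB ltxx => h.
  have : `|t - t0| < d by rewrite gtr0_norm ?subr_gt0// ltrBlDl.
  by move/h.
have : (mu `]t0, b'[ <= mu A)%E by rewrite le_measure ?inE.
rewrite A0 -[X in (X <= _)%E]/(uniform_prob _ _) /uniform_prob.
rewrite (@eq_integral _ _ _ _ _ (fun=> (tau^-1)%:E)); last first.
  move=> t; rewrite inE/= in_itv/= lt_min => /andP[tt /andP[_ t2]].
  by rewrite /uniform_pdf (ltW (le_lt_trans t00 tt)) (ltW t2) subr0.
rewrite integral_cst//= lebesgue_measure_itv/= lte_fin tb -EFinD -EFinM lee_fin.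
by rewrite leNgt mulr_gt0// ?invr_gt0 ?ltr0_2pi// subr_gt0.
Qed.

Lemma polar_form (z : C) : 0 < normc z ->
  exists t, 0 <= t < tau /\ z = (normc z)%:C * cis t.
Proof.
set r := normc z => r0; have p0 := pi_gt0 R.
have unit : exists t, 0 <= t < tau /\ z / r%:C = cis t.
  have : normc (z / r%:C) = 1.
    by rewrite normcM normcV normcRC gtr0_norm// divff// gt_eqF.
  case: (z / r%:C) => x y h.
  have xy : x ^+ 2 + y ^+ 2 = 1.
    by have := normc_sqr (x +i* y); rewrite h expr1n /= => <-.
  have x1 : -1 <= x <= 1 by apply/andP; split; have := sqr_ge0 y; nra.
  have [/andP[a0 ap] ca] := acos_def x1.
  have sa0 : 0 <= sin (acos x) by apply: sin_ge0_pi; rewrite a0.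
  have sa2 : sin (acos x) ^+ 2 = y ^+ 2 by rewrite sin2cos2 ca -xy addrC addKr.
  have [y0|y0] := leP 0 y.
    exists (acos x); split; first by apply/andP; split => //; lra.
    rewrite /cis ca; congr (_ +i* _); apply/eqP.
    by rewrite -(eqrXn2 (n := 2))// sa2.
  exists (tau - acos x); split.
    rewrite subr_ge0 ltrBlDr ltrDl; apply/andP; split; first lra.
    rewrite lt_neqAle a0 andbT eq_sym; apply/eqP => e.
    by move: sa2; rewrite e sin0 expr0n => /esym/eqP; rewrite sqrf_eq0 lt_eqF.
  rewrite -[tau - _]addrC [X in cis X](_ : _ = - acos x + pi *+ 2).
    have e : - y = sin (acos x).
      apply/eqP; rewrite -(eqrXn2 (n := 2)) ?sqrrN ?sa2//.
      by rewrite oppr_ge0 ltW.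
    by rewrite /cis cosD2pi sinD2pi cosN sinN ca -e opprK.
  by rewrite mulr2n; ring.
have [t [t0 e]] := unit; exists t; split => //.
by rewrite -e mulrC divfK// (inj_eq (@complexI R)) gt_eqF.
Qed.

(** If the boundary function is the constant [c], the circle means of
    [z ^ k * theta z] show that [theta] has the Fourier coefficients of [c] on
    every smaller circle, hence equals [c] there by uniqueness and
    continuity. *)
Lemma inner_bdry_nonconstant : nonconstant theta -> forall c : C, b <> c%:A.
Proof.
move=> nct c bc; apply: nct; exists c.
have [B FB] := inner_bounded theta.
have fc n : fourier (Linf_L2 b) n = c * (n == 0)%:R.
  have -> : Linf_L2 b = c *: Linf_L2 (zexp R 0) by rewrite zexp_0 bc; exact: val_inj.
  by rewrite /fourier inprodZl [inprod _ _]fourier_zexp eq_sym.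
have circ r t : 0 < r < 1 -> 0 <= t < tau -> theta (r%:C * cis t) = c.
  move=> /andP[r0 r1] t01.
  have r01 : 0 <= r < 1 by rewrite ltW.
  have uc := ccontinuous_circle aF r01.
  apply: (ae_cst_everywhere uc) t01.
  pose v := cls (CMFun (ccontinuous_cmeas uc)).
  have vE : {ae mu, forall t, v t = theta (r%:C * cis t)} by exact: cls_repr.
  have vL : v \in @inLinf R.
    apply/inLinfP; exists B; apply: ae_imp vE => t' ->.
    by rewrite FB// normc_polar// ltW.
  have v0 : Linf_L2 (MkLinf vL) - c *: Linf_L2 (zexp R 0) = 0.
    apply: fourier_uniqueness => n.
    rewrite /fourier inprodBl inprodZl [inprod (Linf_L2 (zexp _ _)) _]fourier_zexp.
    have s0 : ln r < 0 by rewrite ln_lt0// r0.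
    have re : expR (ln r) = r by rewrite lnK ?posrE.
    have := inner_log_mean (- n) s0; rewrite opprK fc /log_mean re.
    have -> : inprod (Linf_L2 (MkLinf vL)) (Linf_L2 (zexp R n)) = circle_mean theta (- n) r.
      rewrite (@inprodE _ _ _ (fun t => theta (r%:C * cis t)) (fun t => cis (n%:~R * t))) //.
      - congr cint; apply/funext => t'; rewrite mulrC intrN mulNr cisN //.
      - exact: ccontinuous_cmeas.
      - exact: cmeas_cis.
      - exact: zexpE.
    have en : (expR ((- n)%:~R * ln r))%:C != 0.
      by rewrite (inj_eq (@complexI R)) expR_eq0.
    rewrite [0 == n]eq_sym; have [->|n0] := eqVneq n 0.
      by rewrite oppr0 mul0r expR0 mul1r => ->; rewrite subrr.
    rewrite mulr0 => /eqP; rewrite mulf_eq0 (negbTE en) /= => /eqP ->.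
    by rewrite subr0.
  have e : v = c *: (1 : L0 R).
    by have := congr1 (@L2_val R) (subr0_eq v0); rewrite zexp_0.
  apply: ae_imp2 vE _ => [t' <- h|]; first exact: h.
  rewrite e; apply: ae_imp2 (L0_reprZ c 1) (Linf_1E R) => t' -> ht.
  by rewrite [X in _ * X]ht mulr1.
move=> z z1; have [z0|z0] := eqVneq (normc z) 0; last first.
  have zp : 0 < normc z by rewrite lt_neqAle eq_sym z0 normc_ge0.
  have [t [t01 ->]] := polar_form zp.
  by apply: circ => //; rewrite zp.
have -> : z = 0 by exact: eq0_normc.
have a0 : analytic_at theta 0 by apply: aF; rewrite normc0.
apply/eqP; rewrite -subr_eq0; apply/negP => /negP n0.
have e0 : 0 < normc (theta 0 - c).
  by rewrite lt_neqAle normc_ge0 andbT eq_sym; apply: contra n0 => /eqP /eq0_normc ->.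
have [d d0 hd] := analytic_continuous a0 e0.
pose x := Num.min (d / 2) 2^-1.
have x0 : 0 < x by rewrite lt_min divr_gt0//= invr_gt0.
have xd : x < d by rewrite gt_min; apply/orP; left; lra.
have x1 : x < 1 by rewrite gt_min; apply/orP; right; lra.
have := hd x%:C; rewrite subr0 normcRC gtr0_norm// => /(_ xd).
rewrite -[x%:C]mulr1 -(cis0 R) circ ?x0 ?lexx ?ltr0_2pi//.
by rewrite -normcN opprB ltxx.
Qed.

End boundary_values.

(** * Hardy spaces *)

Section subspaces.
Variable R : realType.
Local Notation C := R[i].
Implicit Types (f g h : L2 R) (M N : set (L2 R)).

Definition ortho M : set (L2 R) := [set f | forall g, M g -> inprod f g = 0].

Lemma closed_ortho M : closed_subspace (ortho M).
Proof.
split.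
- by move=> g _; exact: inprod0l.
- move=> a f g Mf Mg h Mh; rewrite inprodDl inprodZl.
  by rewrite [inprod f h]Mf// [inprod g h]Mg// mulr0 addr0.
- by move=> u f Mu uf g Mg; apply: (inprod_lim0 _ uf) => n; exact: Mu.
Qed.

Lemma closed_subspaceI M N : closed_subspace M -> closed_subspace N ->
  closed_subspace (M `&` N).
Proof.
move=> [M0 Ml Mc] [N0 Nl Nc]; split => //.
- by move=> a f g [Mf Nf] [Mg Ng]; split; [exact: Ml|exact: Nl].
- by move=> u f u_ uf; split; [apply: Mc uf|apply: Nc uf] => n; case: (u_ n).
Qed.

Lemma closed_subspace_preim M (T : {linear L2 R -> L2 R}) : L2bounded T ->
  closed_subspace M -> closed_subspace [set f | M (T f)].
Proof.
move=> bT [M0 Ml Mc]; split.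
- by rewrite /= raddf0.
- by move=> a f g Mf Mg; rewrite /= linearP; exact: Ml.
- by move=> u f Mu uf; apply: Mc (L2cvg_bounded bT uf) => n; exact: Mu.
Qed.

(** The residual of the projection onto [N] lies in [M] and is orthogonal to
    [N]. *)
Lemma closed_subspace_total M N : closed_subspace M -> closed_subspace N ->
  N `<=` M -> (forall f, M f -> ortho N f -> f = 0) -> M `<=` N.
Proof.
move=> clM clN NM tot f Mf; have [Np fp] := orth_projP clN f.
rewrite (_ : f = orth_proj N f)//; apply/eqP; rewrite -subr_eq0; apply/eqP.
apply: tot; last exact: fp.
by apply: closed_subspaceB => //; exact: NM.
Qed.

Lemma orth_projD M f g : closed_subspace M ->
  orth_proj M (f + g) = orth_proj M f + orth_proj M g.
Proof.
move=> clM; have [Mf fp] := orth_projP clM f; have [Mg gp] := orth_projP clM g.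
apply: orth_proj_uniq => //; first exact: closed_subspaceD.
move=> h Mh.
have -> : f + g - (orth_proj M f + orth_proj M g) =
  (f - orth_proj M f) + (g - orth_proj M g) by rewrite opprD addrACA.
exact: etrans (inprodDl _ _ _) (etrans (congr2 +%R (fp h Mh) (gp h Mh)) (addr0 _)).
Qed.

Lemma orth_projZ M (a : C) f : closed_subspace M ->
  orth_proj M (a *: f) = a *: orth_proj M f.
Proof.
move=> clM; have [Mf fp] := orth_projP clM f.
apply: orth_proj_uniq => //; first exact: closed_subspaceZ.
by move=> h Mh; rewrite -scalerBr inprodZl fp// mulr0.
Qed.

Lemma nsq_orth f g : inprod f g = 0 -> nsq (f + g) = nsq f + nsq g.
Proof. by move=> fg; rewrite nsqD fg mulr0 addr0. Qed.

Lemma orth_proj_in M f : closed_subspace M -> M f -> orth_proj M f = f.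
Proof.
by move=> clM Mf; apply: orth_proj_uniq => // h _; rewrite subrr inprod0l.
Qed.

Lemma orth_proj_ortho M f : closed_subspace M -> ortho M f -> orth_proj M f = 0.
Proof.
move=> clM of_; have [M0 _ _] := clM.
by apply: orth_proj_uniq => // h Mh; rewrite subr0 of_.
Qed.

End subspaces.

Section hardy_spaces.
Variable R : realType.
Local Notation C := R[i].
Implicit Types (f g h : L2 R).
Local Notation e_ n := (Linf_L2 (zexp R n)).
Local Notation Mz n := (mulop (zexp R n)).

Lemma fourier_shift (n m : int) f : fourier (Mz n f) m = fourier f (m - n).
Proof.
by rewrite /fourier inprod_mulop Linf_conj_zexp mulop_Linf -zexpD addrC.
Qed.

Lemma mulop_zexp n m f : Mz n (Mz m f) = Mz (n + m) f.
Proof. by rewrite -mulopM -zexpD. Qed.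

Lemma mulop_zexp_e n m : Mz n (e_ m) = e_ (n + m).
Proof. by rewrite mulop_Linf -zexpD. Qed.

Lemma mulop_zexp0 f : Mz 0 f = f.
Proof. by rewrite zexp_0 mulop1. Qed.

Lemma closed_H2 : closed_subspace (@H2 R).
Proof.
have -> : @H2 R = ortho [set g | exists2 n : int, n < 0 & g = e_ n].
  apply/seteqP; split => f.
    by move=> Hf g [n n0 ->]; exact: Hf.
  by move=> of_ n n0; apply: of_; exists n.
exact: closed_ortho.
Qed.

Definition H2minus : set (L2 R) := ortho (@H2 R).

Lemma closed_H2minus : closed_subspace H2minus.
Proof. exact: closed_ortho. Qed.

Lemma H2_zexp (n : int) : 0 <= n -> H2 (e_ n).
Proof.
move=> n0 m m0; rewrite fourier_zexp; case: eqP => // nm.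
by move: m0; rewrite -nm ltNge n0.
Qed.

Lemma H2minus_zexp (n : int) : n < 0 -> H2minus (e_ n).
Proof. by move=> n0 g Hg; rewrite inprodC [inprod _ _](Hg n n0); exact: conjc0. Qed.

Lemma H2_shift (n : int) f : 0 <= n -> H2 f -> H2 (Mz n f).
Proof.
by move=> n0 Hf m m0; rewrite fourier_shift; apply: Hf; lia.
Qed.

Lemma H2minus_shift (n : int) f : n <= 0 -> H2minus f -> H2minus (Mz n f).
Proof.
move=> n0 Hf g Hg; rewrite inprod_mulop Linf_conj_zexp; apply: Hf.
by apply: H2_shift => //; rewrite oppr_ge0.
Qed.

Lemma ortho_all_zexp f : (forall n, inprod f (e_ n) = 0) -> f = 0.
Proof. exact: fourier_uniqueness. Qed.

(** Density of the polynomials in [H2], as an induction principle: an element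
    of [H2] orthogonal to all of them has no Fourier coefficients. *)
Lemma H2_ind (N : set (L2 R)) : closed_subspace N -> N `<=` @H2 R ->
  (forall n : int, 0 <= n -> N (e_ n)) -> @H2 R `<=` N.
Proof.
move=> clN NH Ne; apply: closed_subspace_total => //; first exact: closed_H2.
move=> f Hf of_; apply: ortho_all_zexp => n; have [n0|n0] := leP 0 n.
  by apply: of_; exact: Ne.
exact: Hf.
Qed.

(** The same for [H2-] and the polynomials in the conjugate of [z]. *)
Lemma H2minus_ind (N : set (L2 R)) : closed_subspace N -> N `<=` H2minus ->
  (forall n : int, n < 0 -> N (e_ n)) -> H2minus `<=` N.
Proof.
move=> clN NH Ne; apply: closed_subspace_total => //; first exact: closed_H2minus.
move=> f Hf of_; apply: ortho_all_zexp => n; have [n0|n0] := leP 0 n.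
  by apply: Hf; exact: H2_zexp.
by apply: of_; exact: Ne.
Qed.

Lemma Pplus_H2 f : H2 (Pplus f).
Proof. exact: (orth_projP closed_H2 f).1. Qed.

Lemma Pminus_H2minus f : H2minus (Pminus f).
Proof. exact: (orth_projP closed_H2 f).2. Qed.

Lemma PminusD f g : Pminus (f + g) = Pminus f + Pminus g.
Proof.
by rewrite /Pminus /Pplus orth_projD ?opprD; [rewrite addrACA|exact: closed_H2].
Qed.

Lemma PminusZ (a : C) f : Pminus (a *: f) = a *: Pminus f.
Proof.
by rewrite /Pminus /Pplus orth_projZ ?scalerBr//; exact: closed_H2.
Qed.

Lemma Pminus_H2 f : H2 f -> Pminus f = 0.
Proof.
by move=> Hf; rewrite /Pminus /Pplus orth_proj_in ?subrr//; exact: closed_H2.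
Qed.

Lemma Pminus_id f : H2minus f -> Pminus f = f.
Proof.
move=> Hf; rewrite /Pminus /Pplus orth_proj_ortho ?subr0//; exact: closed_H2.
Qed.

Lemma nsq_Pminus_le f : nsq (Pminus f) <= nsq f.
Proof.
have -> : nsq f = nsq (Pminus f + Pplus f) by rewrite /Pminus subrK.
rewrite nsq_orth; first by rewrite lerDl nsq_ge0.
by apply: Pminus_H2minus; exact: Pplus_H2.
Qed.

Lemma nsq_zexp (n : int) f : nsq (Mz n f) = nsq f.
Proof. by apply: unimodular_nsq; exact: unimodular_zexp. Qed.

Let eps_split (x y c e : R) : 0 <= x -> x * (4 * (c + 1)) < e -> y < e / 4 ->
  2 * (c * x) + 2 * y < e.
Proof.
move=> x0 h1 h2.
have -> : 2 * (c * x) + 2 * y = (x * (4 * (c + 1)) - 4 * x) / 2 + 2 * y by field.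
move: h1; move: (x * _) => w h1; lra.
Qed.

Let eps_split3 (x y e : R) : x < e / 4 -> y < e / 4 -> 2 * x + 2 * y < e.
Proof. lra. Qed.

(** High powers of [z] push every function into [H2]. A given [z ^ m] is moved
    into [H2] exactly, and the property passes to linear combinations and,
    [Pminus M_(z ^ n)] being a contraction for every [n], to limits. *)
Lemma Pminus_shift_cvg0 f :
  (fun n : nat => nsq (Pminus (Mz n f))) @ \oo --> (0 : R).
Proof.
pose N : set (L2 R) := [set f | forall e : R, 0 < e ->
  exists K, forall n : nat, (K <= n)%N -> nsq (Pminus (Mz n f)) < e].
suff Nf : N f.
  apply/cvgrPdist_lt => e e0; have [K hK] := Nf e e0; exists K => // n Kn.
  by rewrite sub0r normrN ger0_norm ?nsq_ge0//; exact: hK.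
suff [clN totN] : closed_subspace N /\
    (forall g, [set: L2 R] g -> ortho N g -> g = 0).
  have clT : closed_subspace [set: L2 R] by split.
  have h := closed_subspace_total clT clN (fun _ _ => I) totN.
  exact: h f I.
split; last first.
- move=> g _ og; apply: ortho_all_zexp => m; apply: og => e e0.
  exists `|m|%N => n mn; rewrite mulop_zexp_e Pminus_H2 ?nsq0//.
  by apply: H2_zexp; lia.
split.
- by move=> e e0; exists 0%N => n _; rewrite mulop0 Pminus_H2 ?nsq0//;
    have [] := closed_H2.
- move=> a g h Ng Nh e e0.
  have A0 : 0 < 4 * (normc a ^+ 2 + 1) by rewrite mulr_gt0// ltr_wpDl// sqr_ge0.
  have [K hK] := Ng _ (divr_gt0 e0 A0).
  have [L hL] := Nh (e / 4) (divr_gt0 e0 (ltr0n _ 4)).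
  exists (maxn K L) => n; rewrite geq_max => /andP[/hK h1 /hL h2].
  rewrite mulopDr mulopZr PminusD PminusZ.
  apply: le_lt_trans (nsqD_le _ _) _; rewrite nsqZ.
  rewrite ltr_pdivlMr// in h1.
  exact: eps_split (nsq_ge0 _) h1 h2.
- move=> u g Nu ug e e0.
  have e4 : 0 < e / 4 by rewrite divr_gt0.
  have [j _ hj] := @cvgr_dist_lt _ _ _ _ _ _ _ ug _ e4.
  have [K hK] := Nu j _ e4; exists K => n /hK h1.
  have := hj j (leqnn j); rewrite sub0r normrN ger0_norm ?nsq_ge0// => h2.
  have -> : Pminus (Mz n g) =
      Pminus (Mz n (u j)) + (-1) *: Pminus (Mz n (u j - g)).
    rewrite -PminusZ -mulopZr -PminusD -mulopDr scaleN1r; congr (Pminus (mulop _ _)).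
    by rewrite opprB addrC subrK.
  apply: le_lt_trans (nsqD_le _ _) _; rewrite scaleN1r nsqN.
  apply: eps_split3 h1 (le_lt_trans _ h2).
  by rewrite -(nsq_zexp n (u j - g)); exact: nsq_Pminus_le.
Qed.

Lemma H2_backward f : H2 f -> H2 (Mz (-1) (f - fourier f 0 *: e_ 0)).
Proof.
move=> Hf m m0; rewrite fourier_shift opprK /fourier inprodBl inprodZl.
rewrite [inprod (e_ 0) _]fourier_zexp.
have [m1|m1] := eqVneq m (-1); first by rewrite m1 addNr mulr1 subrr.
have m10 : m + 1 < 0 by lia.
by rewrite [inprod f _]Hf// eq_sym (lt_eqF m10) mulr0 subr0.
Qed.

End hardy_spaces.

(** * Symbols, and the model space *)

Section symbols.
Variable R : realType.
Local Notation C := R[i].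
Implicit Types (f g h : L2 R) (X : {linear L2 R -> L2 R}).
Local Notation e_ n := (Linf_L2 (zexp R n)).
Local Notation Mz n := (mulop (zexp R n)).

Lemma L2bounded_comp (S T : L2 R -> L2 R) : L2bounded S -> L2bounded T ->
  L2bounded (S \o T).
Proof.
move=> [A SA] [B TB]; exists (Num.max A 0 * B) => f /=.
apply: le_trans (SA (T f)) _; rewrite -mulrA.
apply: le_trans (_ : Num.max A 0 * nsq (T f) <= _).
  by rewrite ler_wpM2r ?nsq_ge0// le_max lexx.
by rewrite ler_wpM2l// le_max lexx orbT.
Qed.

(** When [X] acts as multiplication by [chi] on the one-sided family
    [v * z ^ (s n)], [s = 1] or [-1], the function [chi] is bounded: any
    trigonometric polynomial is moved into that family by a high power of
    [z ^ s], which changes no norm, so that [chi] multiplies trigonometric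
    polynomials with the bound of [X]. *)
Lemma bounded_symbol X (v : Linf R) (s : int) (chi : L2 R) :
  L2bounded X -> unimodular v -> `|s|%N = 1%N ->
  (forall n : nat, X (Linf_L2 (v * zexp R (s * n%:Z))) =
    mulop (v * zexp R (s * n%:Z)) chi) ->
  exists psi, Linf_L2 psi = chi.
Proof.
move=> [B XB] uv s1 Xv.
pose S : set (Linf R) := [set p | exists N0 : nat, forall N : nat, (N0 <= N)%N ->
  X (Linf_L2 (v * zexp R (s * N%:Z) * p)) = mulop (v * zexp R (s * N%:Z) * p) chi].
have S1 : S 1 by exists 0%N => N _; rewrite mulr1; exact: Xv.
have Slin (a : C) p q : S p -> S q -> S (a *: p + q).
  move=> [N1 h1] [N2 h2]; exists (maxn N1 N2) => N.
  rewrite geq_max => /andP[/h1 {}h1 /h2 {}h2].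
  rewrite mulrDr -scalerAr mulopDl mulopZl -h1 -h2 -linearP.
  by congr (X _); exact: val_inj.
have Sz (k : int) p : `|k|%N = 1%N -> S p -> S (zexp R k * p).
  move=> k1 [N0 h]; exists N0.+1 => N N0N.
  have [M NM ->] : exists2 M : nat, (N0 <= M)%N &
      v * zexp R (s * N%:Z) * (zexp R k * p) = v * zexp R (s * M%:Z) * p.
    have [M NM sM] : exists2 M : nat, (N0 <= M)%N & s * N%:Z + k = s * M%:Z.
      have [sk|sk] : s = k \/ s = - k by lia.
        by exists N.+1; [lia|rewrite sk; nia].
      by exists N.-1; [lia|rewrite sk; nia].
    by exists M => //; rewrite mulrA -[_ * _ * zexp R k]mulrA -zexpD sM.
  exact: h.
apply: (@bounded_multiplier _ chi B) => t d n.
have [[N0 h] _] := @shift_invariant_arcpoly _ S S1 Slin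
  (fun p => Sz 1 p erefl) (fun p => Sz (-1) p erefl) t d n.
have u1 := unimodular_zexp R (s * N0%:Z).
have nE f : nsq (mulop (v * zexp R (s * N0%:Z)) f) = nsq f.
  by rewrite mulopM (unimodular_nsq _ uv) (unimodular_nsq _ u1).
have := XB (Linf_L2 (v * zexp R (s * N0%:Z) * arcpolyL t d n)).
by rewrite (h N0 (leqnn _)) mulopM -mulop_Linf !nE.
Qed.

Section inner.
Variable theta : inner_function R.
Local Notation b := (inner_bdry theta).
Local Notation P_theta := (orth_proj (thetaH2 theta)).
Local Notation P_K := (orth_proj (model_space theta)).
Local Notation k0 := (k0tilde theta).

Let ub : unimodular b. Proof. exact: unimodularP (inner_unimodular theta). Qed.

Lemma mulop_inner_H2 f : H2 f -> H2 (mulop b f).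
Proof.
move=> Hf; suff [] : [set f | H2 f /\ H2 (mulop b f)] f by [].
move: f Hf; apply: H2_ind.
- apply: closed_subspaceI; first exact: closed_H2.
  apply: (@closed_subspace_preim _ _ (mulop b)); last exact: closed_H2.
  exact: nsq_mulop_le.
- by move=> f [].
- move=> n n0; split; first exact: H2_zexp.
  by rewrite /= mulop_Linf_L2; apply: H2_shift => //; exact: inner_bdry_H2.
Qed.

Lemma thetaH2P f : thetaH2 theta f <-> H2 (mulop (Linf_conj b) f).
Proof.
split=> [[h Hh <-]|Hf]; first by rewrite unimodularK.
by exists (mulop (Linf_conj b) f) => //; rewrite unimodularKC.
Qed.

Lemma thetaH2_mul h : H2 h -> thetaH2 theta (mulop b h).
Proof. by move=> Hh; exists h. Qed.

Lemma thetaH2_inner : thetaH2 theta (Linf_L2 b).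
Proof.
have -> : Linf_L2 b = mulop b (e_ 0) by rewrite mulop_Linf zexp_0 mulr1.
by apply: thetaH2_mul; exact: H2_zexp.
Qed.

Lemma thetaH2_H2 f : thetaH2 theta f -> H2 f.
Proof. by move=> [h Hh <-]; exact: mulop_inner_H2. Qed.

Lemma thetaH2_shift f : thetaH2 theta f -> thetaH2 theta (Mz 1 f).
Proof.
by move=> [h Hh <-]; rewrite mulopC; apply: thetaH2_mul; exact: H2_shift.
Qed.

Lemma closed_thetaH2 : closed_subspace (thetaH2 theta).
Proof.
have -> : thetaH2 theta = [set f | H2 (mulop (Linf_conj b) f)].
  by apply/seteqP; split=> f /thetaH2P.
apply: (@closed_subspace_preim _ _ (mulop (Linf_conj b))); last exact: closed_H2.
exact: nsq_mulop_le.
Qed.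

Lemma closed_model_space : closed_subspace (model_space theta).
Proof. exact: closed_subspaceI (closed_H2 R) (closed_ortho _). Qed.

Lemma model_space_ortho k h : model_space theta k -> H2 h ->
  inprod k (mulop b h) = 0.
Proof. by move=> [_ ok] Hh; apply: ok; exact: thetaH2_mul. Qed.

Let sub00 (x y : C) : x = 0 -> y = 0 -> x - y = 0.
Proof. by move=> -> ->; rewrite subr0. Qed.

Lemma inprod_ortho_sym f g : inprod f g = 0 -> inprod g f = 0.
Proof. by move=> fg; rewrite inprodC fg; exact: conjc0. Qed.

Lemma model_space_residual f : H2 f -> model_space theta (f - P_theta f).
Proof.
move=> Hf; have [Tp fp] := orth_projP closed_thetaH2 f; split=> //.
exact: (closed_subspaceB (closed_H2 R) Hf (thetaH2_H2 Tp)).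
Qed.

(** [H2] is the orthogonal sum of [theta H2] and [K_theta]. *)
Lemma Pplus_split f : Pplus f = P_theta f + P_K f.
Proof.
have [Tt ft] := orth_projP closed_thetaH2 f.
have [Kk fk] := orth_projP closed_model_space f.
have [HK oK] := Kk.
apply: orth_proj_uniq; first exact: closed_H2.
  exact: (closed_subspaceD (closed_H2 R) (thetaH2_H2 Tt) HK).
move=> h Hh; have [Th _] := orth_projP closed_thetaH2 h.
have Kh := model_space_residual Hh.
have split_ (p q t : L2 R) : inprod (f - (p + q)) h =
    inprod (f - p - q) t + inprod (f - q - p) (h - t).
  by rewrite (addrAC f (- q)) -inprodDr (addrC t) subrK opprD addrA.
have e1 : inprod (f - P_theta f - P_K f) (P_theta h) = 0.
  by rewrite inprodBl; exact: sub00 (ft _ Th) (oK _ Th).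
have e2 : inprod (f - P_K f - P_theta f) (h - P_theta h) = 0.
  rewrite inprodBl; apply: sub00 (fk _ Kh) _.
  by apply: inprod_ortho_sym; exact: Kh.2.
exact: etrans (split_ _ _ (P_theta h)) (etrans (congr2 +%R e1 e2) (addr0 _)).
Qed.

(** Both conditions of the theorem have this shape, so that each of them splits
    into three independent conditions on [theta H2], [K_theta] and [H2-]. *)
Lemma blocksP X (A K0 T : L2 R -> L2 R) : A 0 = 0 -> K0 0 = 0 -> T 0 = 0 ->
  (forall f, X f = A (P_theta f) + K0 (P_K f) + T (Pminus f)) <->
  [/\ forall f, thetaH2 theta f -> X f = A f,
      forall f, model_space theta f -> X f = K0 f &
      forall f, H2minus f -> X f = T f].
Proof.
move=> A0 K00 T0; split=> [h|[hA hK hT] f]; last first.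
  have [Tt _] := orth_projP closed_thetaH2 f.
  have [Kk _] := orth_projP closed_model_space f.
  rewrite -hA// -hK// -hT; last exact: Pminus_H2minus.
  by rewrite -!raddfD -Pplus_split /Pminus addrC subrK.
split=> f Mf; rewrite h.
- rewrite orth_proj_in//; last exact: closed_thetaH2.
  rewrite orth_proj_ortho; [|exact: closed_model_space|]; last first.
    by move=> g [_ og]; apply: inprod_ortho_sym; exact: og.
  by rewrite Pminus_H2 ?K00 ?T0 ?addr0//; exact: thetaH2_H2.
- rewrite [P_theta f]orth_proj_ortho; [|exact: closed_thetaH2|exact: Mf.2].
  rewrite orth_proj_in//; last exact: closed_model_space.
  by rewrite Pminus_H2 ?A0 ?T0 ?addr0 ?add0r//; exact: Mf.1.
- rewrite [P_theta f]orth_proj_ortho; [|exact: closed_thetaH2|]; last first.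
    by move=> g /thetaH2_H2; exact: Mf.
  rewrite orth_proj_ortho; [|exact: closed_model_space|]; last first.
    by move=> g [Hg _]; exact: Mf.
  by rewrite Pminus_id// A0 K00 !add0r.
Qed.

Lemma H2_inprod_zbar f : H2 f -> inprod f (e_ (-1)) = 0.
Proof. by move=> Hf; exact: Hf. Qed.

(** A function in [H2] is orthogonal to [conj z], so it does not see the
    constant subtracted from [theta]. *)
Lemma inprod_k0 (a : C) f : H2 f ->
  inprod f (Linf_L2 (Linf_conj (zexp R 1) * (b - a%:A))) =
  inprod (Mz 1 f) (Linf_L2 b).
Proof.
move=> Hf; rewrite inprod_mulop mulop_Linf mulrBr -scalerAr mulr1.
have -> : Linf_L2 (Linf_conj (zexp R 1) * b - a *: Linf_conj (zexp R 1)) =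
    Linf_L2 (Linf_conj (zexp R 1) * b) - a *: Linf_L2 (Linf_conj (zexp R 1)).
  exact: val_inj.
rewrite inprodBr inprodZr Linf_conj_zexp.
by rewrite [inprod f (e_ _)]H2_inprod_zbar// mulr0 subr0.
Qed.

(** The compressed shift: [z k] leaves [K_theta] only along [theta]. Indeed,
    for [h] in [H2], write [h = h(0) + z h1] with [h1] in [H2]; then
    [z k] is orthogonal to [theta z h1], so that [theta h] sees of [z k] only
    its inner product with [theta], up to the factor [conj h(0)], and the same
    holds for [theta] itself. *)
Lemma model_space_shift k : model_space theta k ->
  model_space theta (Mz 1 k - inprod k k0 *: Linf_L2 b).
Proof.
move=> Kk; have [Hk _] := Kk.
rewrite [inprod k k0]inprod_k0//; split.
  apply: (closed_subspaceB (closed_H2 R)); first exact: H2_shift.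
  exact: (closed_subspaceZ _ (closed_H2 R) (inner_bdry_H2 theta)).
move=> _ [h Hh <-]; set c := inprod (Mz 1 k) _; set a := fourier h 0.
pose h1 := Mz (-1) (h - a *: e_ 0).
have hE : h = a *: e_ 0 + Mz 1 h1.
  by rewrite mulop_zexp mulop_zexp0 addrC subrK.
have bE : Linf_L2 b = mulop b (e_ 0) by rewrite mulop_Linf zexp_0 mulr1.
have e1 : inprod (Mz 1 k) (mulop b h) = a^* * c.
  rewrite hE mulopDr mulopZr inprodDr inprodZr mulopC -bE.
  rewrite [inprod (Mz 1 k) (Mz 1 _)]unimodular_inprod; last exact: unimodular_zexp.
  by rewrite [inprod k _]model_space_ortho ?addr0//; exact: H2_backward.
have e2 : inprod (Linf_L2 b) (mulop b h) = a^*.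
  by rewrite bE unimodular_inprod// inprodC.
rewrite inprodBl inprodZl; apply/eqP; rewrite subr_eq0; apply/eqP.
exact: etrans e1 (etrans (mulrC _ _) (congr1 (fun x => c * x) (esym e2))).
Qed.

(** The vector [k = conj z * (theta - a)], [a] the zeroth Fourier coefficient
    of [theta], lies in [K_theta]; by [inprod_k0] its inner product with [k0]
    is its own squared norm, which vanishes only if [theta = a]. This is the
    place where [theta] has to be non-constant. *)
Lemma model_space_k0_nonorthogonal : nonconstant theta ->
  exists2 k, model_space theta k & inprod k k0 != 0.
Proof.
move=> nct; pose a := fourier (Linf_L2 b) 0.
pose k := Linf_L2 (Linf_conj (zexp R 1) * (b - a%:A)).
have kE : k = Mz (-1) (Linf_L2 b - a *: e_ 0).
  apply: val_inj; rewrite /= -[zexp0 R (-1)]/(Linf_val (zexp R (-1))).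
  rewrite -Linf_conj_zexp; congr (_ * (_ - _ *: _)).
  by rewrite -[zexp0 R 0]/(Linf_val (zexp R 0)) zexp_0.
have Hk : H2 k by rewrite kE; apply: H2_backward; exact: inner_bdry_H2.
have kk : inprod k k0 = inprod k k by rewrite [LHS]inprod_k0// [RHS]inprod_k0.
exists k; last first.
  rewrite kk inprodff; apply/eqP => -[] /nsq_eq0 k_eq0.
  apply: (inner_bdry_nonconstant nct (c := a)).
  apply: Linf_L2_inj; apply/eqP; rewrite -subr_eq0; apply/eqP.
  have := mulop0 (zexp R 1); rewrite -k_eq0 {1}kE mulop_zexp mulop_zexp0 => bE.
  by rewrite -[RHS]bE zexp_0; congr (_ - _); exact: val_inj.
split=> // _ [h Hh <-].
rewrite kE mulopBr mulopZr inprodBl inprodZl.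
have e1 : inprod (Mz (-1) (Linf_L2 b)) (mulop b h) = 0.
  rewrite mulop_Linf_L2 unimodular_inprod//; apply: inprod_ortho_sym.
  exact: H2_inprod_zbar.
have e2 : inprod (Mz (-1) (e_ 0)) (mulop b h) = 0.
  rewrite mulop_zexp_e; apply: inprod_ortho_sym; apply: H2_inprod_zbar.
  exact: mulop_inner_H2.
apply: sub00 e1 _; exact: etrans (congr1 (fun x => a * x) e2) (mulr0 _).
Qed.

End inner.
End symbols.

(** * The two conditions, block by block *)

Section defect.
Variables (R : realType) (theta : inner_function R).
Local Notation C := R[i].
Implicit Types (f g h k : L2 R) (phi psi chi w : Linf R).
Local Notation e_ n := (Linf_L2 (zexp R n)).
Local Notation Mz n := (mulop (zexp R n)).
Local Notation b := (inner_bdry theta).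
Local Notation k0 := (k0tilde theta).
Variable X : {linear L2 R -> L2 R}.

Definition blockwise_symbols phi psi chi :=
  [/\ forall f, thetaH2 theta f -> X f = mulop phi f,
      forall k, model_space theta k -> X k = mulop psi k &
      forall f, H2minus f -> X f = mulop chi f].

(** The defect equation on the three blocks, each side multiplied by [z] or its
    conjugate: [X] commutes with [M_z] on [theta H2], with [M_(conj z)] on
    [H2-], and with [M_z] up to a rank-one term on [K_theta]. *)
Definition blockwise_defect w :=
  [/\ forall f, thetaH2 theta f -> X (Mz 1 f) = Mz 1 (X f),
      forall k, model_space theta k ->
        X (Mz 1 k) = Mz 1 (X k) + inprod k k0 *: mulop (zexp R 1) (Linf_L2 w) &
      forall f, H2minus f -> X (Mz (-1) f) = Mz (-1) (X f)].

Let ub : unimodular b. Proof. exact: unimodularP (inner_unimodular theta). Qed.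

Lemma MzK f : Mz 1 (Mz (-1) f) = f.
Proof. by rewrite mulop_zexp mulop_zexp0. Qed.

Lemma MzVK f : Mz (-1) (Mz 1 f) = f.
Proof. by rewrite mulop_zexp mulop_zexp0. Qed.

Let zexpVM (p q : Linf R) : zexp R 1 * (p * zexp R (-1) * q) = p * q.
Proof.
have z1 : zexp R 1 * zexp R (-1) = 1 by rewrite -zexpD addrN zexp_0.
by rewrite !mulrA [_ * p]mulrC -(mulrA p) z1 mulr1.
Qed.

Lemma blockwise_symbolsP phi psi chi :
  (forall f, X f = mulop phi (orth_proj (thetaH2 theta) f) +
     mulop psi (orth_proj (model_space theta) f) + mulop chi (Pminus f)) <->
  blockwise_symbols phi psi chi.
Proof. by apply: blocksP; exact: mulop0. Qed.

Lemma blockwise_defectP w :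
  (forall f, X f = adjoint (Mz 1) (X (Mz 1 (Pplus f))) +
     Mz 1 (X (adjoint (Mz 1) (Pminus f))) -
     tensor (Linf_L2 w) k0 (orth_proj (model_space theta) f)) <->
  blockwise_defect w.
Proof.
rewrite adjoint_mulop Linf_conj_zexp.
pose A f := Mz (-1) (X (Mz 1 f)).
pose K f := Mz (-1) (X (Mz 1 f)) - inprod f k0 *: Linf_L2 w.
pose T f := Mz 1 (X (Mz (-1) f)).
have A0 : A 0 = 0 by rewrite /A mulop0 raddf0 mulop0.
have K0 : K 0 = 0.
  by rewrite /K mulop0 raddf0 mulop0 inprod0l scale0r subr0.
have T0 : T 0 = 0 by rewrite /T mulop0 raddf0 mulop0.
have AKT f : Mz (-1) (X (Mz 1 (Pplus f))) + Mz 1 (X (Mz (-1) (Pminus f))) -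
     tensor (Linf_L2 w) k0 (orth_proj (model_space theta) f) =
   A (orth_proj (thetaH2 theta) f) + K (orth_proj (model_space theta) f) +
   T (Pminus f).
  rewrite (Pplus_split theta) mulopDr raddfD mulopDr -/(A _) -/(T _) /tensor /K.
  by rewrite -!addrA; congr (_ + (_ + _)); rewrite addrC.
apply: (iff_trans (B := forall f, X f = A (orth_proj (thetaH2 theta) f) +
   K (orth_proj (model_space theta) f) + T (Pminus f))).
  by split=> h f; rewrite h AKT.
apply: (iff_trans (blocksP theta X A0 K0 T0)); split=> -[hA hK hT]; split=> f Mf.
- by rewrite [in RHS]hA// MzK.
- by rewrite [in RHS]hK// mulopBr mulopZr MzK subrK.
- by rewrite [in RHS]hT// MzVK.
- by rewrite /A hA// MzVK.
- by rewrite /K hK// mulopDr mulopZr MzVK MzVK addrK.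
- by rewrite /T hT// MzK.
Qed.

(** For [k] in [K_theta], [z k] splits into a part in [K_theta], on which [X]
    multiplies by [psi], and a multiple of [theta], on which it multiplies by
    [phi]. The jump [phi - psi] is what prevents [X] from commuting with [M_z],
    and it determines [w]. *)
Lemma symbols_defect phi psi chi : blockwise_symbols phi psi chi ->
  blockwise_defect ((phi - psi) * zexp R (-1) * b).
Proof.
move=> [hA hK hT]; split=> f Mf.
- by rewrite !hA ?[mulop phi (Mz 1 _)]mulopC//; exact: thetaH2_shift.
- have := model_space_shift Mf; move: (inprod f k0) => c Kf.
  have -> : X (Mz 1 f) = X (Mz 1 f - c *: Linf_L2 b) + c *: X (Linf_L2 b).
    by rewrite -linearZ -raddfD subrK.
  rewrite (hK _ Kf) (hA _ (thetaH2_inner theta)) (hK _ Mf).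
  rewrite mulopBr mulopZr mulopC -addrA; congr (_ + _).
  rewrite -scalerN -scalerDr addrC -mulopBl; congr (_ *: _).
  by rewrite !mulop_Linf zexpVM.
- by rewrite !hT ?[mulop chi (Mz _ _)]mulopC//; exact: H2minus_shift.
Qed.

Lemma symbols_values phi psi chi : blockwise_symbols phi psi chi ->
  Linf_L2 chi = Mz 1 (X (e_ (-1))) /\
  Linf_L2 phi = mulop (Linf_conj b) (X (Linf_L2 b)).
Proof.
move=> [hA _ hT]; rewrite hT; last exact: H2minus_zexp.
rewrite hA; last exact: thetaH2_inner.
split; first by rewrite mulopC mulop_zexp_e zexp_0 mulop_Linf mulr1.
by rewrite mulop_Linf_L2 unimodularK.
Qed.

(** The symbols satisfy the defect equation with the explicit [w] of
    [symbols_defect]. Two defect functions agree as soon as one vector of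
    [K_theta] is not orthogonal to [k0]. *)
Lemma symbols_defect_uniq phi psi chi w : nonconstant theta ->
  blockwise_symbols phi psi chi -> blockwise_defect w ->
  psi = phi - zexp R 1 * Linf_conj b * w.
Proof.
move=> nct hs [_ hw _]; have [_ hw' _] := symbols_defect hs.
have [k Kk k_neq0] := model_space_k0_nonorthogonal nct.
have := hw k Kk; rewrite hw'// => /addrI/(congr1 (fun f => (inprod k k0)^-1 *: f)).
rewrite !scalerA mulVf// !scale1r !mulop_Linf => /Linf_L2_inj wE.
rewrite [_ * Linf_conj b]mulrC -mulrA -wE.
by rewrite zexpVM [(_ - _) * b]mulrC mulrA ub mul1r opprB addrC subrK.
Qed.

End defect.

(** * From the defect equation to the symbols *)

Section converse.
Variables (R : realType) (theta : inner_function R).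
Local Notation C := R[i].
Implicit Types (f g h k : L2 R) (phi psi chi w : Linf R).
Local Notation e_ n := (Linf_L2 (zexp R n)).
Local Notation Mz n := (mulop (zexp R n)).
Local Notation b := (inner_bdry theta).
Local Notation k0 := (k0tilde theta).
Variable X : {linear L2 R -> L2 R}.
Hypothesis bX : L2bounded X.

Let ub : unimodular b. Proof. exact: unimodularP (inner_unimodular theta). Qed.

(** The relation propagates the value of [X] at [conj z] to all powers
    [conj z ^ (n + 1)], where [X] multiplies by [chi0 = z X(conj z)]. This
    function is bounded by [bounded_symbol], and the powers span a dense
    subspace of [H2-]. *)
Lemma coanalytic_symbol :
  (forall f, H2minus f -> X (Mz (-1) f) = Mz (-1) (X f)) ->
  exists chi, forall f, H2minus f -> X f = mulop chi f.
Proof.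
move=> hX; pose chi0 := Mz 1 (X (e_ (-1))).
have Xe (n : nat) : X (e_ (-1 + -1 * n%:Z)) = mulop (zexp R (-1 + -1 * n%:Z)) chi0.
  elim: n => [|n IH]; first by rewrite mulr0 addr0 MzVK.
  have -> : (-1 + -1 * n.+1%:Z = -1 + (-1 + -1 * n%:Z))%R by lia.
  by rewrite -mulop_zexp_e hX ?IH ?mulop_zexp//; apply: H2minus_zexp; lia.
have [chi chiE] : exists chi, Linf_L2 chi = chi0.
  apply: (bounded_symbol (s := -1) bX (unimodular_zexp R (-1))) => // n.
  by rewrite -zexpD.
exists chi => f Hf; suff [] : [set f | H2minus f /\ X f = mulop chi f] f by [].
move: f Hf; apply: H2minus_ind.
- by apply: closed_subspace_eq => //; [exact: closed_H2minus|exact: nsq_mulop_le].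
- by move=> f [].
move=> n n0; split; first exact: H2minus_zexp.
have [m ->] : exists m : nat, n = -1 + -1 * m%:Z.
  by exists (`|n| - 1)%N; lia.
by rewrite Xe -chiE mulop_Linf_L2.
Qed.

(** The same on [theta H2], starting from the value of [X] at [theta]. *)
Lemma analytic_symbol :
  (forall f, thetaH2 theta f -> X (Mz 1 f) = Mz 1 (X f)) ->
  exists phi, forall f, thetaH2 theta f -> X f = mulop phi f.
Proof.
move=> hX; pose phi0 := mulop (Linf_conj b) (X (Linf_L2 b)).
have Xb (n : nat) : X (Linf_L2 (b * zexp R n%:Z)) = mulop (b * zexp R n%:Z) phi0.
  elim: n => [|n IH]; first by rewrite zexp_0 mulr1 unimodularKC.
  have -> : b * zexp R n.+1%:Z = zexp R 1 * (b * zexp R n%:Z).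
    by rewrite mulrCA -zexpD.
  rewrite -mulop_Linf hX ?IH -?mulopM//; rewrite -mulop_Linf.
  by apply: thetaH2_mul; exact: H2_zexp.
have [phi phiE] : exists phi, Linf_L2 phi = phi0.
  by apply: (bounded_symbol (s := 1) bX ub) => // n; rewrite mul1r.
exists phi => _ [h Hh <-].
suff [] : [set h | H2 h /\ (X \o mulop b) h = (mulop phi \o mulop b) h] h by [].
move: h Hh; apply: H2_ind.
- apply: (@closed_subspace_eq _ _ (X \o mulop b) (mulop phi \o mulop b)).
  + exact: closed_H2.
  + by apply: L2bounded_comp => //; exact: nsq_mulop_le.
  + by apply: L2bounded_comp; exact: nsq_mulop_le.
- by move=> f [].
move=> n n0; split; first exact: H2_zexp.
have [m ->] : exists m : nat, n = m%:Z by exists `|n|%N; lia.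
by rewrite /= mulop_Linf Xb -phiE mulop_Linf_L2.
Qed.

(** Iterating the compressed shift. Its [n]-th iterate [k'] at [k] differs
    from [z ^ n k] by an element of [theta H2]; hence [conj theta k'], which
    lies in [H2-], is the projection of [z ^ n conj theta k]. *)
Lemma compressed_shift_iter (D : L2 R -> L2 R) k :
  (forall k, model_space theta k ->
    nsq (D (Mz 1 k - inprod k k0 *: Linf_L2 b)) = nsq (D k)) ->
  model_space theta k -> forall n : nat, exists k',
  [/\ model_space theta k', nsq (D k') = nsq (D k) &
      nsq k' = nsq (Pminus (Mz n%:Z (mulop (Linf_conj b) k)))].
Proof.
move=> hD Kk n.
suff [k' [Kk' Dk' Hk']] : exists k', [/\ model_space theta k',
    nsq (D k') = nsq (D k) & thetaH2 theta (Mz n%:Z k - k')].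
  exists k'; split=> //.
  have ubc : unimodular (Linf_conj b) by rewrite /unimodular Linf_conjK mulrC.
  rewrite -[LHS](unimodular_nsq _ ubc).
  have Hm : H2minus (mulop (Linf_conj b) k').
    move=> h Hh; rewrite inprod_mulop Linf_conjK; exact: model_space_ortho.
  congr nsq; rewrite -[LHS](Pminus_id Hm) mulopC.
  have -> : Mz n%:Z k = k' + (Mz n%:Z k - k') by rewrite addrC subrK.
  rewrite mulopDr PminusD [X in _ = _ + X]Pminus_H2 ?addr0//.
  exact/thetaH2P.
elim: n => [|n [k' [Kk' Dk' Hk']]].
  exists k; split=> //; rewrite mulop_zexp0 subrr.
  by have [] := closed_thetaH2 theta.
exists (Mz 1 k' - inprod k' k0 *: Linf_L2 b); split.
- exact: model_space_shift.
- by rewrite hD.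
- have -> : n.+1%:Z = 1 + n%:Z by lia.
  rewrite -mulop_zexp opprB addrCA addrC -mulopBr.
  apply: (closed_subspaceD (closed_thetaH2 theta)); first exact: thetaH2_shift.
  exact: (closed_subspaceZ _ (closed_thetaH2 theta) (thetaH2_inner theta)).
Qed.

Let cancel_jump (V : zmodType) (p q r t : V) : p + q - r - (t - (r - q)) = p - t.
Proof. by rewrite opprB addrA [_ + (r - q)]addrA subrK addrK. Qed.

(** The middle block: with [psi = phi - z conj(theta) w], the error
    [D = X - M_psi] satisfies [D k' = z D k] for the compressed shift
    [k'] of [k]; its iterates tend to [0] while the norms of their images
    stay constant, so [D] vanishes. *)
Lemma model_symbol phi w : X (Linf_L2 b) = mulop phi (Linf_L2 b) ->
  (forall k, model_space theta k ->
    X (Mz 1 k) = Mz 1 (X k) + inprod k k0 *: Mz 1 (Linf_L2 w)) ->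
  forall k, model_space theta k ->
    X k = mulop (phi - zexp R 1 * Linf_conj b * w) k.
Proof.
move=> Xb hX k Kk; set psi := phi - _.
pose D f := X f - mulop psi f.
have psib : mulop psi (Linf_L2 b) = X (Linf_L2 b) - Mz 1 (Linf_L2 w).
  rewrite Xb mulopBl; congr (_ - _); rewrite !mulop_Linf; congr Linf_L2.
  by rewrite [LHS]mulrAC -(mulrA (zexp R 1)) ub mulr1.
have Dshift f : model_space theta f ->
    nsq (D (Mz 1 f - inprod f k0 *: Linf_L2 b)) = nsq (D f).
  move=> Kf; rewrite -[RHS](nsq_zexp 1); congr nsq.
  rewrite /D mulopBr mulopZr psib; move: (hX f Kf); move: (inprod f k0) => c hXf.
  have -> : X (Mz 1 f - c *: Linf_L2 b) = X (Mz 1 f) - c *: X (Linf_L2 b).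
    by rewrite -linearZ -raddfB.
  rewrite hXf [mulop psi (Mz 1 f)]mulopC [RHS]mulopBr scalerBr.
  exact: cancel_jump.
have [B DB] : exists B : R, forall f, nsq (D f) <= B * nsq f.
  have [BX hBX] := bX; have [Bp hBp] := nsq_mulop_le psi.
  exists (2 * (BX + Bp)) => f; apply: le_trans (nsqD_le _ _) _.
  by rewrite nsqN -[leLHS]mulrDr -[leRHS]mulrA [(BX + Bp) * _]mulrDl ler_wpM2l// lerD.
have D0 : nsq (D k) <= 0.
  apply: (@cst_le_cvg0 _ _ (fun n : nat =>
    B * nsq (Pminus (Mz n%:Z (mulop (Linf_conj b) k))))).
    move=> n; have [k' [_ <- <-]] := compressed_shift_iter Dshift Kk n.
    exact: DB.
  rewrite -(mulr0 B); apply: cvgMr.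
  exact: Pminus_shift_cvg0.
apply/eqP; rewrite -subr_eq0; apply/eqP/nsq_eq0/eqP.
by rewrite eq_le D0 nsq_ge0.
Qed.

Lemma defect_symbols w : blockwise_defect theta X w ->
  exists phi psi chi, blockwise_symbols theta X phi psi chi.
Proof.
move=> [hA hK hT]; have [phi phiE] := analytic_symbol hA.
have [chi chiE] := coanalytic_symbol hT.
exists phi, (phi - zexp R 1 * Linf_conj b * w), chi; split=> //.
by apply: model_symbol => //; apply: phiE; exact: thetaH2_inner.
Qed.

End converse.

Theorem theorem4p4 (R : realType) (theta : inner_function R)
    (X : {linear L2 R -> L2 R}) :
  nonconstant theta -> bounded_op X ->
  let z := zexp R 1 in
  let thetab := inner_bdry theta in
  let P_theta := orth_proj (thetaH2 theta) in
  let P_K := orth_proj (model_space theta) in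
  let has_symbols (phi psi chi : Linf R) := forall f : L2 R,
    X f = mulop phi (P_theta f) + mulop psi (P_K f) + mulop chi (Pminus f) in
  let has_defect (w : Linf R) := forall f : L2 R,
    X f = adjoint (mulop z) (X (mulop z (Pplus f)))
          + mulop z (X (adjoint (mulop z) (Pminus f)))
          - tensor (Linf_L2 w) (k0tilde theta) (P_K f) in
  ((exists phi psi chi : Linf R, has_symbols phi psi chi) <->
   (exists w : Linf R, has_defect w)) /\
  (forall phi psi chi w : Linf R,
    has_symbols phi psi chi -> has_defect w ->
    [/\ Linf_L2 chi = mulop z (X (Linf_L2 (Linf_conj z))),
        Linf_L2 phi = mulop (Linf_conj thetab) (X (Linf_L2 thetab)) &
        psi = phi - z * Linf_conj thetab * w]).
Proof.
move=> nct /bounded_opP bX /=; split; [split|].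
- move=> [phi [psi [chi /blockwise_symbolsP hs]]].
  exists ((phi - psi) * zexp R (-1) * inner_bdry theta).
  exact/blockwise_defectP/(symbols_defect hs).
- move=> [w /blockwise_defectP hw].
  have [phi [psi [chi hs]]] := defect_symbols bX hw.
  by exists phi, psi, chi; apply/blockwise_symbolsP.
- move=> phi psi chi w /blockwise_symbolsP hs /blockwise_defectP hw.
  have [chiE phiE] := symbols_values hs; rewrite Linf_conj_zexp.
  by split=> //; exact: symbols_defect_uniq hs hw.
Qed.
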